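(* Let $\mathbb{K}$ be an algebraically closed field of characteristic $0$ and let $r=f/g\in\mathbb{K}(X_1,\dots,X_n)$ be a non-composite reduced rational function of degree $d$. Then $$m(f,g)+\omega(f,g)+\theta(f,g)\le d^2-1.$$
   Context: $r=f/g$ is reduced if $\gcd(f,g)=1$; $d=\max(\deg f,\deg g)$; $r$ is non-composite if it cannot be written $u\circ h$ with $h\in\mathbb{K}(X_1,\dots,X_n)$ and $u\in\mathbb{K}(T)$ of degree $\ge2$. Put $f^\sharp=X_0^df(X_1/X_0,\dots,X_n/X_0)$, $g^\sharp=X_0^dg(X_1/X_0,\dots,X_n/X_0)$. For $(\mu:\lambda)\in\mathbb{P}^1_{\mathbb{K}}$ write $\mu f^\sharp+\lambda g^\sharp=\prod_{i=1}^{n(\mu:\lambda)}P_{(\mu:\lambda),i}^{e_{(\mu:\lambda),i}}$ with pairwise non-proportional irreducible homogeneous $P_{(\mu:\lambda),i}\in\mathbb{K}[X_0,\dots,X_n]$. Set $m(\mu:\lambda)=\sum_ie_{(\mu:\lambda),i}$, $\omega(\mu:\lambda)=\sum_i\deg(P_{(\mu:\lambda),i})(e_{(\mu:\lambda),i}-1)$, $\theta(\mu:\lambda)=\binom{\omega(\mu:\lambda)+1}{2}-\sum_i(e_{(\mu:\lambda),i}-1)$, and $m(f,g)=\sum_{(\mu:\lambda)\in\mathbb{P}^1}(m(\mu:\lambda)-1)$, $\omega(f,g)=\sum_{(\mu:\lambda)}\omega(\mu:\lambda)$, $\theta(f,g)=\sum_{(\mu:\lambda)}\theta(\mu:\lambda)$.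 *)

(* Defs.v *)
From HB Require Import structures.
From mathcomp Require Import all_boot all_order all_algebra.
From mathcomp Require Import mpoly.
Set Implicit Arguments. Unset Strict Implicit. Unset Printing Implicit Defensive.
Import Order.TTheory GRing.Theory Num.Theory.
Local Open Scope ring_scope.

Section Defs.
Variable K : fieldType.

(* total degree of a multivariate polynomial (0 for the zero polynomial) *)
Definition tdeg {k : nat} (p : {mpoly K[k]}) : nat := (msize p).-1.

Definition mhomogeneous {k : nat} (p : {mpoly K[k]}) : Prop :=
  forall m, m \in msupp p -> mdeg m = tdeg p.

Definition mconst_nz {k : nat} (p : {mpoly K[k]}) : Prop :=
  exists2 c : K, c != 0 & p = c%:MP.

Definition mdvd {k : nat} (h p : {mpoly K[k]}) : Prop :=
  exists q : {mpoly K[k]}, p = h * q.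

Definition mcoprime {k : nat} (f g : {mpoly K[k]}) : Prop :=
  forall h, mdvd h f -> mdvd h g -> mconst_nz h.

Definition mirreducible {k : nat} (p : {mpoly K[k]}) : Prop :=
  p != 0 /\ ~ mconst_nz p /\
  forall a b : {mpoly K[k]}, p = a * b -> mconst_nz a \/ mconst_nz b.

(* homogenization f^# = X_0^d f(X_1/X_0, ..., X_n/X_0) in K[X_0,...,X_n];
   variable X_i of K[X_1..X_n] is sent to the variable of index (lift ord0 i) *)
Definition homogenize {n : nat} (d : nat) (f : {mpoly K[n]}) : {mpoly K[n.+1]} :=
  \sum_(m <- msupp f)
     (f@_m *: ('X_(@ord0 n) ^+ (d - mdeg m)
               * \prod_(i < n) 'X_(lift ord0 i) ^+ (m i))).

Definition pe0 (k : nat) : {mpoly K[k]} * nat := (0, 0%N).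

Definition is_factorization {k : nat} (F : {mpoly K[k]})
    (s : seq ({mpoly K[k]} * nat)) : Prop :=
  F = \prod_(pe <- s) pe.1 ^+ pe.2 /\
  (forall i, (i < size s)%N ->
     mirreducible (nth (pe0 k) s i).1 /\ mhomogeneous (nth (pe0 k) s i).1 /\
     (0 < (nth (pe0 k) s i).2)%N) /\
  (forall i j, (i < j)%N -> (j < size s)%N ->
     forall c : K, (nth (pe0 k) s i).1 != c *: (nth (pe0 k) s j).1).

Definition m_fib {k : nat} (s : seq ({mpoly K[k]} * nat)) : nat :=
  \sum_(pe <- s) pe.2.
Definition omega_fib {k : nat} (s : seq ({mpoly K[k]} * nat)) : nat :=
  \sum_(pe <- s) tdeg pe.1 * (pe.2 - 1).
Definition theta_fib {k : nat} (s : seq ({mpoly K[k]} * nat)) : int :=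
  ('C((omega_fib s).+1, 2))%:Z - (\sum_(pe <- s) (pe.2 - 1))%:Z.

(* P^1(K) = {(1:t) | t in K} u {(0:1)}, encoded as option K *)
Definition P1pt (p : option K) : K * K :=
  match p with Some t => (1, t) | None => (0, 1) end.

Definition cstF {n : nat} (c : K) : {fraction {mpoly K[n]}} := FracField.tofrac (c%:MP).

(* r = f/g is composite: r = u o h with h in K(X), u = a/b in K(T) reduced
   of degree max(deg a, deg b) >= 2 *)
Definition composite {n : nat} (f g : {mpoly K[n]}) : Prop :=
  exists (a b : {poly K}) (h : {fraction {mpoly K[n]}}),
    [/\ coprimep a b, (2 <= maxn (size a).-1 (size b).-1)%N,
        (map_poly (@cstF n) b).[h] != 0 &
        FracField.tofrac f / FracField.tofrac g = (map_poly (@cstF n) a).[h] / (map_poly (@cstF n) b).[h]].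

End Defs.

(* Main.v *)
(** Restrict the homogeneous pencil to the plane, over [K(X_0, ..., X_n)], spanned
    by a general line over [K] and the generic point [X], and consider the closed
    1-forms [(U dT + V dY) / F] regular at infinity, [F] being the restriction of a
    form of degree [d].  The numerators [(U, V)] lie in a space of dimension
    [d^2 - 1], and closedness is linear in [F], so that the pencil of forms gives a
    pencil of linear operators.

    If [F = \prod_i P_i^(e_i)], the forms
    [\sum_i alpha_i dP_i / P_i + d(h / \prod_i P_i^(e_i - 1))] with
    [\sum_i alpha_i deg P_i = 0] and [deg h <= omega] are closed; they span a space
    whose dimension is exactly the contribution [m - 1 + omega + theta] of the fibre.

    The member [g(X) f - f(X) g] of the pencil passes through the generic point and
    has trivial kernel: the residue of a closed form along an irreducible curve with
    a smooth rational point is constant, and this member is irreducible, already on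
    the line.  Indeed a factor has its coefficients in the algebraic closure of
    [K(r)] in [K(X)], which a place embeds into [K(x)]; by Lüroth's theorem it is
    generated by some [h], of which [r] would be a composite.

    Relative to this invertible member, the kernels at the fibres are eigenspaces
    for distinct eigenvalues, so they are independent and their dimensions add up
    to at most [d^2 - 1]. *)
Require Import Defs.
From HB Require Import structures.
From mathcomp Require Import all_boot all_order all_algebra all_field.
From mathcomp Require Import mpoly ring zify.
From Stdlib Require Import Classical ClassicalEpsilon.
Set Implicit Arguments. Unset Strict Implicit. Unset Printing Implicit Defensive.
Import Order.TTheory GRing.Theory Num.Theory.
Local Open Scope ring_scope.

(** * Factorial domains *)

(** The generic point is adjoined for two reasons. A good member of the pencil over [K] would
    require a Bertini-type statement, whereas irreducibility of the member through the generic point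
    is an algebraic fact about [K(r)]. And over a field that is not closed an irreducible curve may
    split in an extension, with residues outside the base field; a smooth rational point forbids
    this, and the generic point is one. The plane also contains a line over [K], so that
    irreducibility and the independence of the forms are tested in one variable.

    The bound [d^2 - 1] arises as follows: [U] has [d(d+1)/2] coefficients, one of which, that of
    [T^(d-1)], must vanish; [V] has [d(d-1)/2] free ones, its top-degree part being determined by
    [U]. A fibre with [q] distinct factors gives [q - 1] parameters [alpha_i] and
    [C(omega+2, 2) - 1] parameters for [h], one being lost because [h = \prod_i P_i^(e_i - 1)]
    yields [d(1) = 0]. *)

Section FactorialDomains.

Import Pdiv.Idomain.

Section Factorial.
Variable R : idomainType.
Implicit Types (a b p q : R) (s : seq R).

Definition rdvd a b := exists c, b = a * c.

Definition prime_elt p :=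
  [/\ p != 0, p \isn't a GRing.unit
    & forall a b, rdvd p (a * b) -> rdvd p a \/ rdvd p b].

Definition irred_elt p :=
  [/\ p != 0, p \isn't a GRing.unit
    & forall a b, p = a * b -> a \is a GRing.unit \/ b \is a GRing.unit].

Definition prime_factored a s :=
  (forall p, p \in s -> prime_elt p) /\
  exists2 u, u \is a GRing.unit & a = u * \prod_(p <- s) p.

Definition factorial_dom := forall a, a != 0 -> exists s, prime_factored a s.

Lemma rdvd_mulr p a b : rdvd p a -> rdvd p (a * b).
Proof. by case=> c ->; exists (c * b); rewrite mulrA. Qed.

Lemma rdvd_mull p a b : rdvd p b -> rdvd p (a * b).
Proof. by rewrite mulrC; apply: rdvd_mulr. Qed.

Lemma rdvd_add p a b : rdvd p a -> rdvd p b -> rdvd p (a + b).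
Proof. by case=> c -> [d ->]; exists (c + d); rewrite mulrDr. Qed.

Lemma rdvd_addl p a b : rdvd p a -> rdvd p (a + b) -> rdvd p b.
Proof. by case=> c -> [d e]; exists (d - c); rewrite mulrBr -e addrAC subrr add0r. Qed.

Lemma prime_irred p : prime_elt p -> irred_elt p.
Proof.
case=> p0 pu pP; split=> // a b e.
have /pP[] : rdvd p (a * b) by exists 1; rewrite mulr1.
- case=> c ea; right; move: e; rewrite ea -mulrA -{1}(mulr1 p) => /(mulfI p0) e.
  by apply/unitrPr; exists c; rewrite mulrC.
- case=> c eb; left; move: e; rewrite eb mulrCA -{1}(mulr1 p) => /(mulfI p0) e.
  by apply/unitrPr; exists c.
Qed.

Lemma prime_assoc p u : u \is a GRing.unit -> prime_elt p -> prime_elt (p * u).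
Proof.
move=> uu [p0 pu pP]; split.
- by rewrite mulf_neq0 //; apply: contraTneq uu => ->; rewrite unitr0.
- by rewrite unitrMl.
- have H a : rdvd p a -> rdvd (p * u) a.
    by case=> c ->; exists (u^-1 * c); rewrite mulrA mulrK.
  move=> a b [c e]; have /pP[|] : rdvd p (a * b) by exists (u * c); rewrite mulrA.
    by move/H; left.
  by move/H; right.
Qed.

Lemma irred_prime p : factorial_dom -> irred_elt p -> prime_elt p.
Proof.
move=> fR [p0 pu pP]; have [[|q s] [sP [u uu e]]] := fR _ p0.
  by move: pu; rewrite e big_nil mulr1 uu.
have qp : prime_elt q by apply: sP; rewrite mem_head.
move: e; rewrite big_cons mulrCA => e.
have [uq|uq] := pP _ _ e; first by case: qp => _; rewrite uq.
by rewrite e; apply: prime_assoc.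
Qed.

Lemma prime_dvd_prod p s : prime_elt p -> rdvd p (\prod_(q <- s) q) ->
  exists2 q, q \in s & rdvd p q.
Proof.
move=> pp; elim: s => [|q s IH].
  rewrite big_nil => -[c e]; case: pp => _ /negP[].
  by apply/unitrPr; exists c.
rewrite big_cons => d; have [_ _ /(_ _ _ d)[dq|/IH[r rs dr]]] := pp.
  by exists q => //; rewrite mem_head.
by exists r => //; rewrite in_cons rs orbT.
Qed.

Lemma prime_factored_cancel p b s : prime_elt p -> prime_factored (p * b) s ->
  exists2 s', size s = (size s').+1 & prime_factored b s'.
Proof.
move=> pp [sP [u uu e]].
have [_ _ pM] := pp.
have /pM[d|d] : rdvd p (u * \prod_(q <- s) q) by rewrite -e; exists b.
  case: pp => _ /negP[]; apply/unitrPr; case: d => c d; exists (c * u^-1).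
  by rewrite mulrA -d divrr.
have [q qs [v ev]] := prime_dvd_prod pp d.
have [_ _ /(_ _ _ ev)[pu|vu]] := prime_irred (sP _ qs).
  by case: pp => _; rewrite pu.
exists (rem q s).
  by rewrite size_rem // prednK //; case: (s) qs.
split=> [r /mem_rem /sP //|]; exists (u * v); first by rewrite unitrMl.
have p0 : p != 0 by case: pp.
apply: (mulfI p0); rewrite e (perm_big _ (perm_to_rem qs)) /= big_cons ev.
by rewrite -!mulrA [u * _]mulrCA.
Qed.

Lemma prime_factored_unit u : u \is a GRing.unit -> prime_factored u [::].
Proof. by move=> uu; split=> //; exists u; rewrite ?big_nil ?mulr1. Qed.

Lemma prime_factored_prime p : prime_elt p -> prime_factored p [:: p].
Proof.
move=> pp; split=> [q|]; first by rewrite inE => /eqP->.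
by exists 1; rewrite ?unitr1 // big_seq1 mul1r.
Qed.

Lemma prime_factoredM a b s t :
  prime_factored a s -> prime_factored b t -> prime_factored (a * b) (s ++ t).
Proof.
move=> [sP [u uu ->]] [tP [v vu ->]]; split.
  by move=> p; rewrite mem_cat => /orP[/sP|/tP].
by exists (u * v); rewrite ?unitrMl // big_cat /= mulrACA.
Qed.

End Factorial.

Lemma field_factorial (K : fieldType) : factorial_dom K.
Proof. by move=> a a0; exists [::]; apply: prime_factored_unit; rewrite unitfE. Qed.

Section FactorialPoly.
Variable R : idomainType.
Implicit Types (c p : R) (f g h : {poly R}).

Lemma rdvd_polyC p f : rdvd p%:P f <-> forall i, rdvd p f`_i.
Proof.
split=> [[c ->] i|]; first by exists c`_i; rewrite coefCM.
elim/poly_ind: f => [|f c IH] H; first by exists 0; rewrite mulr0.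
have [|g eg] := IH.
  by move=> i; have := H i.+1; rewrite coefD coefMX coefC /= addr0.
have [d ed] := H 0%N; move: ed; rewrite coefD coefMX coefC /= add0r => ed.
by exists (g * 'X + d%:P); rewrite mulrDr mulrA -eg -polyCM -ed.
Qed.

Lemma polyC_unit c : (c%:P \is a GRing.unit) = (c \is a GRing.unit).
Proof.
rewrite poly_unitE coefC eqxx size_polyC; have [->|//] := eqVneq c 0.
by rewrite unitr0.
Qed.

Lemma prime_polyC p : prime_elt p -> prime_elt p%:P.
Proof.
move=> [p0 pu pP]; split; first by rewrite polyC_eq0.
  by rewrite poly_unitE coefC eqxx (negPf pu) andbF.
have dX h : rdvd p%:P (h * 'X) -> rdvd p%:P h.
  move=> /rdvd_polyC H; apply/rdvd_polyC=> i.
  by have := H i.+1; rewrite coefMX.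
have dC c : rdvd p c -> rdvd p%:P c%:P.
  by case=> d ->; exists d%:P; rewrite polyCM.
move=> f; elim/poly_ind: f => [|f c IHf] g; first by left; exists 0; rewrite mulr0.
elim/poly_ind: g => [|g d IHg] H; first by right; exists 0; rewrite mulr0.
have /pP[dc|dd] : rdvd p (c * d).
  have /rdvd_polyC/(_ 0%N) := H.
  by rewrite coef0M !coefD !coefMX !coefC /= !add0r.
- have : rdvd p%:P (f * (g * 'X + d%:P)).
    apply: dX; apply: (@rdvd_addl _ _ (c%:P * (g * 'X + d%:P))).
      exact/rdvd_mulr/dC.
    by rewrite mulrAC addrC -mulrDl.
  case/IHf=> [df|]; last by right.
  by left; apply: rdvd_add; [apply: rdvd_mulr|apply: dC].
- have /IHg : rdvd p%:P ((f * 'X + c%:P) * g).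
    apply: dX; apply: (@rdvd_addl _ _ ((f * 'X + c%:P) * d%:P)).
      exact/rdvd_mull/dC.
    by rewrite addrC -mulrA -mulrDr.
  case=> [|dg]; first by left.
  by right; apply: rdvd_add; [apply: rdvd_mulr|apply: dC].
Qed.

Definition primitive_poly f := forall p, prime_elt p -> ~ rdvd p%:P f.

Hypothesis fR : factorial_dom R.

(** Gauss's lemma. A prime of [R] stays prime in [{poly R}]; dividing [f * h] but not the primitive
    [f], it divides [h], so the primes of [c] are cancelled one at a time. *)
Lemma primitive_cancel f c g : primitive_poly f -> c != 0 ->
  rdvd f (c%:P * g) -> rdvd f g.
Proof.
move=> pf /fR[s [sP [u uu ->]]].
elim: s sP g => [|q s IH] sP g.
  rewrite big_nil mulr1 => -[h e]; exists (u^-1%:P * h).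
  by rewrite mulrCA -e mulrA -polyCM mulVr // mul1r.
have qp : prime_elt q by apply: sP; rewrite mem_head.
rewrite big_cons mulrCA polyCM -mulrA => -[h e].
have [_ _ /(_ f h)[||[h' eh]]] := prime_polyC qp.
- by rewrite -e; exists ((u * \prod_(j <- s) j)%:P * g).
- by move/(pf _ qp).
apply: IH => [r rs|]; first by apply: sP; rewrite in_cons rs orbT.
exists h'; apply: (@mulfI _ q%:P); last by rewrite e eh mulrCA.
by rewrite polyC_eq0; case: qp.
Qed.

(** Irreducibility over the fraction field of [R], constants included: a factorization there becomes
    one of a multiple [c *: f] once denominators are cleared. *)
Definition frac_irred f :=
  forall c A B, c != 0 -> c *: f = A * B -> (size A <= 1)%N \/ (size B <= 1)%N.

Lemma primitive_dvdp f g : primitive_poly f -> f %| g -> rdvd f g.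
Proof.
move=> pf /dvdpP[[c h] /= c0 e]; apply: (primitive_cancel pf c0).
by exists h; rewrite mul_polyC e mulrC.
Qed.

Lemma frac_irred_prime f : primitive_poly f -> frac_irred f -> (1 < size f)%N ->
  prime_elt f.
Proof.
move=> pf irf sf; have f0 : f != 0 by rewrite -size_poly_gt0 (leq_trans _ sf).
split=> //.
  by rewrite poly_unitE; case: (size f) sf => [|[]].
move=> g h [q e].
have /dvdpP[[c A] /= c0 ef] := dvdp_gcdl f g.
have [sA|sG] := irf _ _ _ c0 ef.
  left; apply: (primitive_dvdp pf); apply: dvdp_trans (dvdp_gcdr f g).
  have A0 : A != 0.
    apply: contra_neq f0 => A0; apply/eqP; move/eqP: ef.
    by rewrite A0 mul0r scale_poly_eq0 (negPf c0).
  rewrite (size1_polyC sA) mul_polyC in ef.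
  apply/dvdpP; exists (A`_0, c%:P); last by rewrite /= mul_polyC ef.
  by rewrite /= -polyC_eq0 -(size1_polyC sA).
right; apply: (primitive_dvdp pf).
have cp : coprimep f g.
  rewrite coprimep_def eqn_leq sG lt0n size_poly_eq0 gcdp_eq0 (negPf f0) //.
by rewrite -(Gauss_dvdpr _ cp) e dvdp_mulr.
Qed.

(** A constant prime dividing [f] divides its leading coefficient, so the number of primes of the
    latter bounds how many can be extracted. *)
Lemma content f : f != 0 -> exists c f1,
  [/\ c != 0, f = c%:P * f1 & primitive_poly f1].
Proof.
move=> f0; have lf0 : lead_coef f != 0 by rewrite lead_coef_eq0.
have [s] := fR lf0; have [n] := ubnP (size s).
elim: n f s f0 {lf0} => // n IH f s f0 lt_s sf.
have [pf|] := classic (primitive_poly f).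
  by exists 1, f; rewrite oner_neq0 mul1r.
move=> npf; have [p] := not_all_ex_not _ _ npf.
move=> npp; have [pp ndf] := imply_to_and _ _ npp; have [f1 ef] := NNPP _ ndf.
move: sf; rewrite ef lead_coefM lead_coefC => /(prime_factored_cancel pp).
case=> s' es sf1.
have [||c [f2 [c0 e pf2]]] := IH f1 s' _ _ sf1.
- by apply: contra_neq f0; rewrite ef => ->; rewrite mulr0.
- by move: lt_s; rewrite es ltnS.
exists (p * c), f2; split=> //; last by rewrite polyCM -mulrA -e.
by rewrite mulf_neq0 //; case: pp.
Qed.

Lemma prime_factored_polyC c s : prime_factored c s ->
  prime_factored c%:P (map polyC s).
Proof.
case=> sP [u uu ->]; split.
  by move=> p /mapP[q qs ->]; apply/prime_polyC/sP.
exists u%:P; first by rewrite polyC_unit.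
by rewrite big_map polyCM rmorph_prod.
Qed.

Lemma prime_factored_cancelC c f s : c != 0 -> prime_factored (c%:P * f) s ->
  exists s', prime_factored f s'.
Proof.
move=> /fR[t [tP [u uu ->]]].
elim: t tP s => [|q t IH] tP s.
  rewrite big_nil mulr1 => -[sP [v vu e]]; exists s; split=> //.
  exists (u^-1%:P * v); last by rewrite -mulrA -e mulrA -polyCM mulVr // mul1r.
  by rewrite unitrMl // polyC_unit unitrV.
have qp : prime_elt q by apply: tP; rewrite mem_head.
rewrite big_cons mulrCA polyCM -mulrA => /(prime_factored_cancel (prime_polyC qp)).
case=> s' _; apply: IH => r rt; apply: tP; by rewrite in_cons rt orbT.
Qed.

Lemma poly_factorial : factorial_dom {poly R}.
Proof.
move=> f; have [n] := ubnP (size f); elim: n f => // n IH f lt_f f0.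
have [c [f1 [c0 ef pf1]]] := content f0.
have f10 : f1 != 0 by apply: contra_neq f0; rewrite ef => ->; rewrite mulr0.
have [s cs] := fR c0.
suff [t ft] : exists t, prime_factored f1 t.
  by exists (map polyC s ++ t); rewrite ef; apply/prime_factoredM/ft/prime_factored_polyC.
have sf : size f1 = size f by rewrite ef size_Cmul.
have [le1|gt1] := leqP (size f1) 1.
  rewrite (size1_polyC le1); have d0 : f1`_0 != 0 by rewrite -polyC_eq0 -(size1_polyC le1).
  by have [t ft] := fR d0; exists (map polyC t); apply: prime_factored_polyC.
have [irf|] := classic (frac_irred f1).
  by exists [:: f1]; apply/prime_factored_prime/frac_irred_prime.
move=> nirf; have [d] := not_all_ex_not _ _ nirf.
move=> nirA; have [A] := not_all_ex_not _ _ nirA.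
move=> nirB; have [B] := not_all_ex_not _ _ nirB.
move=> nAB; have [d0 nAB'] := imply_to_and _ _ nAB.
have [e nAB''] := imply_to_and _ _ nAB'.
have [/negP sA /negP sB] := not_or_and _ _ nAB''.
rewrite -!ltnNge in sA sB.
have sAB : (size A + size B).-1 = size f1.
  rewrite -(size_scale f1 d0) e size_mul // -size_poly_gt0; exact: ltnW.
have [||sa fa] := IH A.
- rewrite -ltnS; apply: leq_trans lt_f; rewrite -sf -sAB.
  by case: (size B) sB => [|[|m]] // _; rewrite !addnS ltnS ltnS leq_addr.
- by rewrite -size_poly_gt0 ltnW.
have [||sb fb] := IH B.
- rewrite -ltnS; apply: leq_trans lt_f; rewrite -sf -sAB.
  by case: (size A) sA => [|[|m]] // _; rewrite !addSn ltnS ltnS leq_addl.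
- by rewrite -size_poly_gt0 ltnW.
(* Only the multiple [d *: f1] splits into smaller polynomials; the primes of [d] are removed from
   its factorization afterwards. *)
apply: (@prime_factored_cancelC d f1 (sa ++ sb) d0).
by rewrite mul_polyC e; apply: prime_factoredM.
Qed.

End FactorialPoly.

(** [coprimep] over a domain is coprimality over its fraction field. In [c *: f = A * gcd],
    primality makes [f] divide [A], and then the gcd is constant, or the gcd, and then [f] divides a
    constant multiple of [g], hence [g], as it divides no nonzero constant. *)
Lemma prime_coprimep (R : idomainType) (f g : {poly R}) :
  prime_elt f -> (1 < size f)%N -> ~ rdvd f g -> coprimep f g.
Proof.
move=> [f0 _ pf] sf nd.
have /dvdpP[[c A] /= c0 ef] := dvdp_gcdl f g.
have /pf[[A' eA]|[q eq]] : rdvd f (A * gcdp f g) by exists c%:P; rewrite -ef -mul_polyC mulrC.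
  have e1 : c%:P = A' * gcdp f g.
    by apply: (mulfI f0); rewrite mulrA -eA -ef -mul_polyC mulrC.
  have cP0 : c%:P != 0 by rewrite polyC_eq0.
  have A'0 : A' != 0 by apply: contra_neq cP0 => A0; rewrite e1 A0 mul0r.
  have G0 : gcdp f g != 0 by apply: contra_neq cP0 => G0; rewrite e1 G0 mulr0.
  have := size_polyC c; rewrite e1 size_mul // c0 coprimep_def.
  move: A'0 G0; rewrite -!size_poly_gt0.
  case: (size A') => [|[|x]] // ; case: (size (gcdp f g)) => [|[|y]] //.
  by rewrite !addSn addnS.
have /dvdpP[[c2 B] /= c20 eg] := dvdp_gcdr f g.
have /pf[[w ew]|//] : rdvd f (c2%:P * g) by exists (B * q); rewrite mul_polyC eg eq mulrCA.
have c2P0 : c2%:P != 0 by rewrite polyC_eq0.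
have w0 : w != 0 by apply: contra_neq c2P0 => w0; rewrite ew w0 mulr0.
have := size_polyC c2; rewrite ew size_mul // c20; move: sf w0; rewrite -size_poly_gt0.
case: (size f) => [|[|x]] // _; case: (size w) => // y _.
by rewrite !addSn addnS.
Qed.

Lemma prime_iso (R S : idomainType) (f : {rmorphism R -> S}) (g : {rmorphism S -> R}) q :
  cancel f g -> cancel g f -> prime_elt q -> prime_elt (g q).
Proof.
move=> fK gK [q0 qu qP]; split.
- by apply: contra_neq q0 => e'; rewrite -(gK q) e' rmorph0.
- by apply: contra qu => /(rmorph_unit f); rewrite gK.
- have H b : rdvd q (f b) -> rdvd (g q) b.
    by case=> c e'; exists (g c); rewrite -rmorphM -e' fK.
  move=> b c [d e']; have /qP[] : rdvd q (f b * f c).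
  - by rewrite -rmorphM e' rmorphM gK; exists (f d).
  - by move/H; left.
  - by move/H; right.
Qed.

Lemma factorial_iso (R S : idomainType) (f : {rmorphism R -> S}) (g : {rmorphism S -> R}) :
  cancel f g -> cancel g f -> factorial_dom S -> factorial_dom R.
Proof.
move=> fK gK fS a a0.
have fa0 : f a != 0 by apply: contra_neq a0 => e; rewrite -(fK a) e rmorph0.
have [s [sP [u uu e]]] := fS _ fa0.
exists (map g s); split; last first.
  by exists (g u); rewrite ?rmorph_unit // big_map -rmorph_prod -rmorphM -e fK.
by move=> p /mapP[q /sP qp ->]; exact: prime_iso fK gK qp.
Qed.

End FactorialDomains.

(** * Splitting off one variable of a multivariate polynomial *)

Lemma mpoly_rmorph_ext (R : comNzRingType) (S : nzRingType) n
    (f g : {rmorphism {mpoly R[n]} -> S}) :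
  (forall c, f c%:MP = g c%:MP) -> (forall i, f 'X_i = g 'X_i) -> f =1 g.
Proof.
move=> ec eX; elim/mpolyind=> [|c m p _ _ IH]; first by rewrite !rmorph0.
rewrite !rmorphD IH; congr (_ + _).
rewrite -mul_mpolyC !rmorphM ec mpolyXE_id !rmorph_prod; congr (_ * _).
by apply: eq_bigr => i _; rewrite !rmorphXn eX.
Qed.

Section MpolySplit.
Variables (R : comNzRingType) (n : nat).

Definition msplit_var (i : 'I_n.+1) : {poly {mpoly R[n]}} :=
  if unlift ord0 i is Some j then ('X_j)%:P else 'X.

Definition msplit : {rmorphism {mpoly R[n.+1]} -> {poly {mpoly R[n]}}} :=
  mmap (polyC \o @mpolyC n R) msplit_var.

Definition mlift : {rmorphism {mpoly R[n]} -> {mpoly R[n.+1]}} :=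
  mmap (@mpolyC n.+1 R) (fun j => 'X_(lift ord0 j)).

Definition mjoin : {rmorphism {poly {mpoly R[n]}} -> {mpoly R[n.+1]}} :=
  horner_eval 'X_ord0 \o map_poly mlift.

Lemma msplitK : cancel msplit mjoin.
Proof.
apply: (@mpoly_rmorph_ext _ _ _ (mjoin \o msplit) idfun) => [c|i] /=.
  by rewrite mmapC /= map_polyC /= mmapC horner_evalE hornerC.
rewrite mmapX mmap1U /msplit_var; case: unliftP => [j|] -> /=.
  by rewrite map_polyC /= mmapX mmap1U horner_evalE hornerC.
by rewrite map_polyX horner_evalE hornerX.
Qed.

Lemma mjoinK : cancel mjoin msplit.
Proof.
have H p : msplit (mlift p) = p%:P.
  move: p; apply: (@mpoly_rmorph_ext _ _ _ (msplit \o mlift) polyC) => [c|i] /=.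
    by rewrite !mmapC.
  by rewrite mmapX mmap1U /= mmapX mmap1U /msplit_var liftK.
elim/poly_ind=> [|p c IH]; first by rewrite !rmorph0.
rewrite !rmorphD !rmorphM IH; congr (_ * _ + _).
  by rewrite /= map_polyX horner_evalE hornerX mmapX mmap1U /msplit_var unlift_none.
by rewrite /= map_polyC /= horner_evalE hornerC H.
Qed.

End MpolySplit.

Lemma mpoly_factorial (K : fieldType) n : factorial_dom {mpoly K[n]}.
Proof.
elim: n => [|n IH].
  move=> p p0; exists [::]; apply: prime_factored_unit.
  have e : p = (p@_0)%:MP.
    apply/mpolyP=> m; rewrite mcoeffC.
    have -> : m = 0%MM by apply/mnmP; case.
    by rewrite eqxx mulr1.
  rewrite e; apply: rmorph_unit; rewrite unitfE.
  by apply: contra_neq p0; rewrite {2}e => ->; rewrite mpolyC0.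
exact: (factorial_iso (@msplitK K n) (@mjoinK K n) (poly_factorial IH)).
Qed.

(** * Points where a nonzero polynomial does not vanish *)

Section Nonvanishing.
Variable K : fieldType.
Hypothesis K0 : [pchar K] =i pred0.

Lemma natr_eq0_char0 m : (m%:R == 0 :> K) = (m == 0)%N.
Proof. by move/pcharf0P: K0 => ->. Qed.

Lemma poly_nonroot (q : {poly K}) : q != 0 -> exists x, q.[x] != 0.
Proof.
move=> q0; apply: NNPP => H.
pose s := [seq i%:R : K | i <- iota 0 (size q)].
have /(max_poly_roots q0) : all (root q) s.
  by apply/allP=> x _; apply/negPn/negP => nx; apply: H; exists x.
rewrite size_map size_iota ltnn => /(_ _)/negP[] //.
rewrite map_inj_in_uniq ?iota_uniq // => i j _ _.
wlog le_ij : i j / (i <= j)%N.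
  by move=> W e; case/orP: (leq_total i j) => /W; [apply|move=> ->].
move=> e; apply/eqP; rewrite eqn_leq le_ij /=.
by rewrite -subn_eq0 -natr_eq0_char0 natrB // e subrr.
Qed.

Lemma mpoly_nonroot n (p : {mpoly K[n]}) : p != 0 -> exists v, p.@[v] != 0.
Proof.
elim: n p => [|n IH] p p0.
  exists (fun _ => 0); have e : p = (p@_0)%:MP.
    apply/mpolyP=> m; rewrite mcoeffC.
    have -> : m = 0%MM by apply/mnmP; case.
    by rewrite eqxx mulr1.
  by rewrite e mevalC; apply: contra_neq p0; rewrite {2}e => ->; rewrite mpolyC0.
have q0 : msplit K n p != 0.
  by apply: contra_neq p0 => e; rewrite -(msplitK p) e rmorph0.
have [v vP] : exists v, (lead_coef (msplit K n p)).@[v] != 0.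
  by apply: IH; rewrite lead_coef_eq0.
have [|x xP] := @poly_nonroot (map_poly (meval v) (msplit K n p)).
  by apply: contra_neq vP => e; rewrite -coef_map /= e coef0.
exists (fun i => if unlift ord0 i is Some j then v j else x).
have -> // : p.@[fun i => if unlift ord0 i is Some j then v j else x]
    = (map_poly (meval v) (msplit K n p)).[x].
pose ev : {rmorphism {mpoly K[n.+1]} -> K} :=
  meval (fun i => if unlift ord0 i is Some j then v j else x).
pose ev' : {rmorphism {mpoly K[n.+1]} -> K} :=
  horner_eval x \o map_poly (meval v) \o msplit K n.
move: p {p0 q0 vP xP}; apply: (@mpoly_rmorph_ext _ _ _ ev ev') => [c|i].
  by rewrite /ev /ev' /= mevalC mmapC /= map_polyC /= mevalC horner_evalE hornerC.
rewrite /ev /ev' /= mevalXU mmapX mmap1U /msplit_var.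
case: unlift => [j|]; first by rewrite map_polyC /= mevalXU horner_evalE hornerC.
by rewrite map_polyX horner_evalE hornerX.
Qed.

End Nonvanishing.

(** * Fraction fields of domains *)

Local Notation tofrac := (@FracField.tofrac _).

Lemma fracP (R : idomainType) (w : {fraction R}) :
  exists a b, b != 0 /\ w = tofrac a / tofrac b.
Proof.
elim/quotW: w => x; exists (\n_x), (\d_x); split; first exact: denom_ratioP.
apply: (canRL (mulfK _)); first by rewrite tofrac_eq0 denom_ratioP.
unlock FracField.tofrac; rewrite -[LHS]FracField.pi_mul; apply/eqmodP => /=.
rewrite FracField.equivfE /FracField.mulf !numden_Ratio ?oner_eq0 ?mulr1 //.
by rewrite mulrC.
all: exact: denom_ratioP.
Qed.

Lemma frac_eq (R : idomainType) (a b c d : R) : b != 0 -> d != 0 ->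
  (tofrac a / tofrac b = tofrac c / tofrac d) <-> a * d = c * b.
Proof.
move=> b0 d0; split=> [|e].
  by move/eqP; rewrite eqr_div ?tofrac_eq0 // -!rmorphM /= tofrac_eq => /eqP.
by apply/eqP; rewrite eqr_div ?tofrac_eq0 // -!rmorphM /= tofrac_eq e.
Qed.

Section FracLift.
Variables (R : idomainType) (E : fieldType) (f : {rmorphism R -> E}).
Hypothesis f0 : forall a, f a = 0 -> a = 0.

Definition frac_lift_fun (w : {fraction R}) : E :=
  f (\n_(repr w)) / f (\d_(repr w)).

Lemma frac_lift_funE a b : b != 0 -> frac_lift_fun (tofrac a / tofrac b) = f a / f b.
Proof.
move=> b0; rewrite /frac_lift_fun; set w := tofrac a / tofrac b.
have d0 : \d_(repr w) != 0 by apply: denom_ratioP.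
have nz c : c != 0 -> f c != 0 by apply: contra_neq => /f0.
apply/eqP; rewrite eqr_div ?nz // -!rmorphM; apply/eqP; congr (f _).
apply/(frac_eq _ _ d0 b0); rewrite -/w.
apply/esym/(canRL (mulfK _)); first by rewrite tofrac_eq0.
rewrite -[w]reprK; unlock FracField.tofrac; rewrite -[LHS]FracField.pi_mul.
apply/eqmodP => /=.
rewrite FracField.equivfE /FracField.mulf reprK !numden_Ratio ?oner_eq0 ?mulr1 //.
by rewrite mulrC.
all: exact: denom_ratioP.
Qed.

Lemma frac_lift_is_zmod : zmod_morphism frac_lift_fun.
Proof.
move=> v w; have [a [b [b0 ->]]] := fracP v; have [c [d [d0 ->]]] := fracP w.
have nz x : x != 0 -> f x != 0 by apply: contra_neq => /f0.
rewrite -mulNr -rmorphN addf_div ?tofrac_eq0 // -!rmorphM -rmorphD /=.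
rewrite !frac_lift_funE ?mulf_neq0 // rmorphD !rmorphM rmorphN.
by rewrite -mulNr addf_div ?nz.
Qed.

Lemma frac_lift_is_monoid : monoid_morphism frac_lift_fun.
Proof.
split; first by rewrite -[1]divr1 -(rmorph1 tofrac) frac_lift_funE ?oner_eq0 // rmorph1 divr1.
move=> v w; have [a [b [b0 ->]]] := fracP v; have [c [d [d0 ->]]] := fracP w.
have nz x : x != 0 -> f x != 0 by apply: contra_neq => /f0.
rewrite mulf_div -!rmorphM /= !frac_lift_funE ?mulf_neq0 // !rmorphM.
by rewrite mulf_div.
Qed.

HB.instance Definition _ := GRing.isZmodMorphism.Build _ _ frac_lift_fun frac_lift_is_zmod.
HB.instance Definition _ := GRing.isMonoidMorphism.Build _ _ frac_lift_fun frac_lift_is_monoid.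

Lemma frac_lift : exists g : {rmorphism {fraction R} -> E}, forall a, g (tofrac a) = f a.
Proof.
exists frac_lift_fun => a.
by rewrite /= -[tofrac a]divr1 -(rmorph1 tofrac) frac_lift_funE ?oner_eq0 // rmorph1 divr1.
Qed.

End FracLift.

Lemma frac_poly_reduced (K : fieldType) (w : {fraction {poly K}}) :
  exists P Q, [/\ Q != 0, coprimep P Q & w = tofrac P / tofrac Q].
Proof.
have [a [b [b0 ->]]] := fracP w.
exists (a %/ gcdp a b), (b %/ gcdp a b).
have g0 : gcdp a b != 0 by rewrite gcdp_eq0 negb_and b0 orbT.
have q0 : b %/ gcdp a b != 0.
  by apply: contra_neq b0 => e; rewrite -(divpK (dvdp_gcdr a b)) e mul0r.
split=> //; first by rewrite coprimep_div_gcd // b0 orbT.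
apply/frac_eq => //; apply: (mulIf g0).
by rewrite -mulrA divpK ?dvdp_gcdr // [RHS]mulrAC divpK ?dvdp_gcdl.
Qed.

(** * Lüroth's theorem *)

Lemma ex_min_size (R : nzRingType) (P : {poly R} -> Prop) :
  (exists p, P p) -> exists2 p, P p & forall q, P q -> (size p <= size q)%N.
Proof.
case=> p; have [n] := ubnP (size p); elim: n p => // n IH p lt_p Pp.
have [[q [Pq lt_q]]|H] := classic (exists q, P q /\ (size q < size p)%N).
  by apply: (IH q) => //; apply: leq_trans lt_q _.
exists p => // q Pq; rewrite leqNgt; apply/negP => lt_q.
by apply: H; exists q.
Qed.

(* Bezoutian-type polynomial [Q(x) P(T) - P(x) Q(T)], with [x] the inner
   variable and [T] the outer one. *)
Definition near_sep (K : nzRingType) (P Q : {poly K}) : {poly {poly K}} :=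
  Q *: P^:P - P *: Q^:P.

Section NearSeparated.
Variable K : fieldType.
Implicit Types P Q : {poly K}.

Lemma swap_near_sep P Q : swapXY (near_sep P Q) = - near_sep P Q.
Proof.
rewrite /near_sep -!mul_polyC raddfB /= !rmorphM /= !swapXY_polyC !swapXY_map_polyC.
by rewrite opprB mulrC [X in _ - X]mulrC.
Qed.

Lemma near_sep_sizeY P Q :
  (size (swapXY (near_sep P Q)) <= maxn (size P) (size Q))%N.
Proof.
rewrite swap_near_sep size_polyN /near_sep; apply: leq_trans (size_polyD _ _) _.
rewrite size_polyN geq_max; apply/andP.
by split; apply: leq_trans (size_scale_leq _ _) _; rewrite size_map_polyC (leq_maxl, leq_maxr).
Qed.

(** The coefficient of [x^k] in [near_sep P Q] is [Q_k P(T) - P_k Q(T)], and [E] divides all of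
    these. As [P] and [Q] are not proportional, they generate both [P] and [Q], which are
    coprime. *)
Lemma near_sep_cofactor P Q (D : {poly {poly K}}) (E : {poly K}) :
  coprimep P Q -> Q != 0 -> (forall c, P != c *: Q) ->
  near_sep P Q = D * E^:P -> size E = 1%N.
Proof.
move=> cPQ Q0 PQ e.
have dE k : E %| Q`_k *: P - P`_k *: Q.
  have -> : Q`_k *: P - P`_k *: Q = (swapXY D)`_k * E.
    have /(congr1 (fun u => (swapXY u)`_k)) := e.
    rewrite rmorphM /= swapXY_map_polyC coefMC => <-.
    rewrite /near_sep -!mul_polyC raddfB /= !rmorphM /= !swapXY_polyC !swapXY_map_polyC.
    by rewrite coefB !coefMC !coef_map /= !mul_polyC.
  by rewrite dvdp_mull.
have lQ : lead_coef Q != 0 by rewrite lead_coef_eq0.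
set c := P`_(size Q).-1 / lead_coef Q.
have d1 : E %| P - c *: Q.
  have -> : P - c *: Q = (lead_coef Q)^-1 *: (lead_coef Q *: P - P`_(size Q).-1 *: Q).
    by rewrite scalerBr !scalerA mulVf // scale1r /c mulrC.
  by rewrite dvdpZr ?invr_eq0 //; apply: dE.
have PcQ : P - c *: Q != 0 by rewrite subr_eq0.
have lPc : lead_coef (P - c *: Q) != 0 by rewrite lead_coef_eq0.
set l := (size (P - c *: Q)).-1.
have dQ : E %| Q.
  have : E %| Q`_l *: (P - c *: Q) - (Q`_l *: P - P`_l *: Q).
    by rewrite dvdp_sub ?dE // -mul_polyC dvdp_mull.
  have -> : Q`_l *: (P - c *: Q) - (Q`_l *: P - P`_l *: Q) = lead_coef (P - c *: Q) *: Q.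
    rewrite /lead_coef -/l coefB coefZ scalerBr opprB addrC addrA subrK scalerBl.
    by rewrite scalerA [c * _]mulrC.
  by rewrite dvdpZr.
have dP : E %| P by rewrite -(subrK (c *: Q) P) dvdp_add // -mul_polyC dvdp_mull.
by apply/eqP; rewrite size_poly_eq1; move/coprimepP: cPQ; apply.
Qed.

End NearSeparated.

Lemma pencil_neq0 (K L : fieldType) (cst : {rmorphism K -> L}) (rn rd : {poly K}) (r : L) :
  coprimep rn rd -> (1 < maxn (size rn) (size rd))%N ->
  map_poly cst rn - r *: map_poly cst rd != 0.
Proof.
move=> rnd gt1; rewrite subr_eq0; apply/negP => /eqP e.
have cop : coprimep (map_poly cst rn) (map_poly cst rd) by rewrite coprimep_map.
have s1 : size rd = 1%N.
  rewrite -(size_map_poly cst); apply/eqP; rewrite size_poly_eq1.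
  by move/coprimepP: cop; apply=> //; rewrite e -mul_polyC dvdp_mull.
move: gt1; rewrite ltnNge => /negP[].
rewrite s1 geq_max leqnn andbT -(size_map_poly cst) e.
by apply: leq_trans (size_scale_leq _ _) _; rewrite size_map_poly s1.
Qed.

Section Luroth.
Variables (K : closedFieldType) (L : fieldType).
Variables (cst : {rmorphism K -> L}) (j : {rmorphism L -> {fraction {poly K}}}).
Hypothesis jc : forall c, j (cst c) = tofrac c%:P.

Local Notation x := (tofrac ('X : {poly K})).
Local Notation cF := (FracField.tofrac (R := {poly K}) \o polyC).

Lemma horner_cF (p : {poly K}) : (map_poly cF p).[x] = tofrac p.
Proof. by rewrite map_poly_comp horner_map /= -/(_ \Po _) comp_polyXr. Qed.

Lemma map_j_cst (p : {poly K}) : map_poly j (map_poly cst p) = map_poly cF p.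
Proof. by rewrite -map_poly_comp; apply: eq_map_poly => c /=; rewrite jc. Qed.

Lemma nonconst_transcendental h (p : {poly K}) :
  (forall c, h != cst c) -> p != 0 -> (map_poly cst p).[h] != 0.
Proof.
move=> hc p0; have [rs ->] := closed_field_poly_normal p.
rewrite map_polyZ hornerZ mulf_neq0 //; first by rewrite fmorph_eq0 lead_coef_eq0.
rewrite rmorph_prod horner_prod prodf_seq_neq0; apply/allP => z _ /=.
by rewrite rmorphB /= map_polyX map_polyC hornerXsubC subr_eq0 hc.
Qed.

Variables (rn rd : {poly K}) (r : L).
Hypothesis rnd : coprimep rn rd.
Hypothesis rd0 : rd != 0.
Hypothesis jr : j r = tofrac rn / tofrac rd.

Let Phi := map_poly cst rn - r *: map_poly cst rd.

Lemma Phi_root : root (map_poly j Phi) x.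
Proof.
apply/rootP; rewrite /Phi rmorphB /= map_polyZ !map_j_cst hornerD hornerN hornerZ !horner_cF.
by rewrite jr divfK ?tofrac_eq0 // subrr.
Qed.

Section MinimalPoly.
Variables (D : {poly L}) (h : L) (P Q : {poly K}).
Hypothesis D0 : D != 0.
Hypothesis Dx : root (map_poly j D) x.
Hypothesis Dmin : forall E, E != 0 -> root (map_poly j E) x -> (size D <= size E)%N.

Lemma min_dvdp B : root (map_poly j B) x -> D %| B.
Proof.
move=> Bx; apply/modp_eq0P; apply: NNPP => /eqP R0.
have : root (map_poly j (B %% D)) x.
  have -> : B %% D = B - (B %/ D) * D by rewrite {2}(divp_eq B D) addrAC subrr add0r.
  have e E : map_poly j (B - E * D) = map_poly j B - map_poly j E * map_poly j D.
    by rewrite rmorphB; congr (_ - _); rewrite rmorphM.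
  apply/rootP; rewrite e hornerD hornerN hornerM.
  by rewrite (rootP Bx) (rootP Dx) mulr0 subr0.
by move/(Dmin R0); rewrite leqNgt ltn_modp D0.
Qed.

Hypothesis Q0 : Q != 0.
Hypothesis cPQ : coprimep P Q.
Hypothesis jh : j h = tofrac P / tofrac Q.
Hypothesis hnc : forall c, h != cst c.
Variables (i1 i2 : nat).
Hypothesis hD : D`_i1 = h * D`_i2.
Hypothesis D20 : D`_i2 != 0.

Let B := map_poly cst P - h *: map_poly cst Q.

Lemma PQ_nonprop c : P != c *: Q.
Proof.
apply/negP => /eqP e; move: (hnc c) => /negP[]; apply/eqP/(fmorph_inj j).
rewrite jc jh e -mul_polyC rmorphM mulfK // tofrac_eq0 //.
Qed.

Lemma size_B : size B = maxn (size P) (size Q).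
Proof.
have m0 : (0 < maxn (size P) (size Q))%N.
  by rewrite leq_max size_poly_gt0 orbC size_poly_gt0 Q0.
apply/eqP; rewrite eqn_leq; apply/andP; split.
  apply: leq_trans (size_polyD _ _) _; rewrite size_polyN.
  rewrite geq_max size_map_poly leq_maxl /=.
  by apply: leq_trans (size_scale_leq _ _) _; rewrite size_map_poly leq_maxr.
rewrite -(prednK m0); rewrite ltnNge; apply/negP => /leq_sizeP/(_ _ (leqnn _))/eqP; apply/negP.
rewrite /B coefB coefZ !coef_map /= subr_eq0; apply/negP => /eqP e.
set k := (maxn _ _).-1 in e.
have [Qk|Qk] := eqVneq Q`_k 0.
  move/eqP: e; rewrite Qk rmorph0 mulr0 fmorph_eq0 => /eqP Pk.
  have [le|lt] := leqP (size P) (size Q).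
    move: Qk; rewrite /k (maxn_idPr le) => /eqP; rewrite -/(lead_coef Q) lead_coef_eq0.
    by rewrite (negPf Q0).
  move: Pk; rewrite /k (maxn_idPl (ltnW lt)) => /eqP; rewrite -/(lead_coef P) lead_coef_eq0.
  by rewrite -size_poly_eq0; case: (size P) lt.
move: (hnc (P`_k / Q`_k)) => /negP[]; apply/eqP.
by rewrite fmorph_div e mulfK // fmorph_eq0.
Qed.

Lemma B_root : root (map_poly j B) x.
Proof.
apply/rootP; rewrite /B rmorphB /= map_polyZ !map_j_cst hornerD hornerN hornerZ !horner_cF.
by rewrite jh divfK ?tofrac_eq0 // subrr.
Qed.

Lemma clear_denominators (R : idomainType) (p : {poly {fraction R}}) :
  exists c q, c != 0 /\ tofrac c *: p = map_poly (FracField.tofrac (R := R)) q.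
Proof.
elim/poly_ind: p => [|p w [c [q [c0 e]]]].
  by exists 1, 0; rewrite oner_neq0 scaler0 rmorph0.
have [a [b [b0 ->]]] := fracP w.
exists (c * b), (b *: q * 'X + (c * a)%:P); split; first by rewrite mulf_neq0.
have -> : map_poly (FracField.tofrac (R := R)) (b *: q * 'X + (c * a)%:P)
  = tofrac b *: (tofrac c *: p) * 'X + (tofrac c * tofrac a)%:P.
  by rewrite rmorphD rmorphM /= map_polyZ map_polyX map_polyC /= -e rmorphM.
rewrite scalerDr scalerAl scalerA rmorphM /=; congr (_ + _).
  by congr (_ *: _ * _); rewrite mulrC.
by rewrite -mul_polyC -polyCM -mulrA [_ * (_ / _)]mulrC divfK ?tofrac_eq0.
Qed.

(** The primitive form [D2] of [D] in [K[x][T]] divides [near_sep P Q], whose degree in [x] is at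
    most the larger degree of [P] and [Q]. Two coefficients of [D2] have the ratio [h = P / Q], in
    lowest terms, so [D2] already reaches that degree in [x]; the cofactor is then free of [x],
    hence constant, and the degrees in [T] agree. *)
Lemma min_size_eq : size D = size B.
Proof.
have /dvdpP[E eB] := min_dvdp B_root.
have [c [D1 [c0 eD1]]] := clear_denominators (map_poly j D).
have pK : factorial_dom {poly K} := poly_factorial (@field_factorial K).
have sD1 : size D1 = size D.
  by rewrite -(size_map_poly j) -(size_scale (map_poly j D) (_ : tofrac c != 0)) ?tofrac_eq0 // eD1 size_map_inj_poly ?rmorph0 //; move=> u v /eqP; rewrite tofrac_eq => /eqP.
have D10 : D1 != 0 by rewrite -size_poly_eq0 sD1 size_poly_eq0.
have [c' [D2 [c'0 eD2 prD2]]] := content pK D10.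
have inj : injective (FracField.tofrac (R := {poly K})).
  by move=> u v /eqP; rewrite tofrac_eq => /eqP.
have sD2 : size D2 = size D by rewrite -sD1 eD2 mul_polyC size_scale.
have D20' : D2 != 0 by rewrite -size_poly_eq0 sD2 size_poly_eq0.
have [e [E1 [e0 eE1]]] := clear_denominators (map_poly j E).
have eN : map_poly (FracField.tofrac (R := {poly K})) (near_sep P Q) = tofrac Q *: map_poly j B.
  rewrite /near_sep rmorphB /= !map_polyZ -!map_poly_comp /B rmorphB /= map_polyZ !map_j_cst.
  by rewrite jh scalerBr scalerA mulrCA divff ?mulr1 // tofrac_eq0.
have dv : rdvd D2 (near_sep P Q).
  apply: (primitive_cancel pK prD2 (mulf_neq0 c0 e0)).
  exists (c'%:P * Q%:P * E1); apply: (map_inj_poly inj (rmorph0 _)).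
  rewrite rmorphM /= eN map_polyC /= eB.
  have -> : map_poly j (E * D) = map_poly j E * map_poly j D by rewrite rmorphM.
  rewrite !rmorphM /= !map_polyC /= -eE1.
  have : map_poly (FracField.tofrac (R := {poly K})) D1 = tofrac c' *: map_poly (FracField.tofrac (R := {poly K})) D2.
    by rewrite eD2 rmorphM /= map_polyC mul_polyC.
  rewrite -eD1 -!mul_polyC => e1.
  have comm_id (R : comNzRingType) (a1 a2 a3 b1 u v w : R) :
      a1 * v = b1 * w -> a1 * a2 * (a3 * (u * v)) = w * (b1 * a3 * (a2 * u)).
    move=> e2; have -> : a1 * a2 * (a3 * (u * v)) = a1 * v * (a2 * a3 * u) by ring.
    by rewrite e2; ring.
  exact: comm_id e1.
have sN : size (near_sep P Q) = size B.
  rewrite -(size_map_inj_poly inj (rmorph0 _)) eN size_scale ?tofrac_eq0 //.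
  by rewrite size_map_poly.
have {dv} [F eF] := dv.
have N0 : near_sep P Q != 0.
  by rewrite -size_poly_gt0 sN size_B leq_max orbC size_poly_gt0 Q0.
have F0 : F != 0 by apply: contra_neq N0; rewrite eF => ->; rewrite mulr0.
have eD12 : D2`_i1 * Q = P * D2`_i2.
  apply/inj; rewrite !rmorphM /=; apply: (@mulfI _ (tofrac c')).
    by rewrite tofrac_eq0.
  have ej i : tofrac c' * tofrac D2`_i = tofrac c * j D`_i.
    have /(congr1 (fun u : {poly _} => u`_i)) := eD1.
    rewrite coefZ !coef_map /= => ->.
    by rewrite eD2 coefCM rmorphM.
  have comm_id (k : fieldType) (c1 c2 d1 d2 p q w : k) : q != 0 ->
      c2 * d1 = c1 * (p / q * w) -> c2 * d2 = c1 * w -> c2 * (d1 * q) = c2 * (p * d2).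
    by move=> q0 e1 e2; rewrite mulrA e1 [RHS]mulrCA e2; field.
  apply: comm_id (ej i2); first by rewrite tofrac_eq0.
  by rewrite ej hD rmorphM jh.
have D2i2 : D2`_i2 != 0.
  have /(congr1 (fun u : {poly _} => u`_i2)) := eD1.
  rewrite coefZ !coef_map /= eD2 coefCM rmorphM => e1.
  apply: contra_neq D20 => e2; move/eqP: e1.
  rewrite e2 rmorph0 mulr0 mulf_eq0 tofrac_eq0 (negPf c0) /= fmorph_eq0.
  by move/eqP.
have Qd : Q %| D2`_i2.
  by rewrite -(@Gauss_dvdpr _ D2`_i2 P) 1?coprimep_sym // -eD12 dvdp_mull.
have {Qd} /dvdpP[w ew] := Qd.
have w0 : w != 0 by apply: contra_neq D2i2; rewrite ew => ->; rewrite mul0r.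
have ew1 : D2`_i1 = w * P.
  by apply: (mulIf Q0); rewrite eD12 ew mulrCA mulrA.
have sY : (maxn (size P) (size Q) <= sizeY D2)%N.
  rewrite geq_max; apply/andP; split.
    apply: leq_trans (max_size_coefXY D2 i1); rewrite ew1.
    have [->|P0] := eqVneq P 0; first by rewrite size_poly0.
    by rewrite size_mul // -(prednK (_ : 0 < size w)%N) ?size_poly_gt0 // addSn leq_addl.
  apply: leq_trans (max_size_coefXY D2 i2); rewrite ew.
  by rewrite size_mul // -(prednK (_ : 0 < size w)%N) ?size_poly_gt0 // addSn leq_addl.
have sF : (size (swapXY F) <= 1)%N.
  have := near_sep_sizeY P Q; rewrite eF rmorphM size_mul ?swapXY_eq0 // -!sizeYE => le.
  have := leq_trans le sY; have Y0 : (0 < sizeY D2)%N by rewrite lt0n sizeY_eq0.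
  by rewrite -(prednK Y0) addSn /= -addn1 leq_add2l.
have eF' : F = ((swapXY F)`_0)^:P.
  by rewrite -swapXY_polyC -(size1_polyC sF) swapXYK.
have := near_sep_cofactor cPQ Q0 PQ_nonprop (_ : near_sep P Q = D2 * _).
move=> /(_ (swapXY F)`_0); rewrite -eF' => /(_ eF) sE.
rewrite -sN eF size_mul // sD2 eF' size_map_polyC sE addn1 //.
Qed.

End MinimalPoly.

(** Let [D] be a minimal polynomial of [x] over [L]; some coefficient [h] of its monic form is not
    constant, because [x] is transcendental over [K]. By [min_size_eq], [D] is associate to
    [P(T) - h Q(T)], which has coefficients in [K(h)], and this puts [r] in [K(h)]. If [D] is
    smaller than the equation [rn - r rd] of [x], then [r] has degree at least 2 in [h]. *)
Lemma luroth :
  (exists h (a b : {poly K}), [/\ coprimep a b, (2 <= maxn (size a).-1 (size b).-1)%N,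
     (map_poly cst b).[h] != 0 & r = (map_poly cst a).[h] / (map_poly cst b).[h]])
  \/ (forall D, D != 0 -> root (map_poly j D) x ->
       (maxn (size rn) (size rd) <= size D)%N).
Proof.
have inj : injective (FracField.tofrac (R := {poly K})).
  by move=> u v /eqP; rewrite tofrac_eq => /eqP.
have [le1|gt1] := leqP (maxn (size rn) (size rd)) 1.
  by right=> D D0 _; apply: leq_trans le1 _; rewrite size_poly_gt0.
have Phi0 : Phi != 0 by apply: pencil_neq0.
have [|D [D0 Dx] Dmin'] := @ex_min_size L (fun D => D != 0 /\ root (map_poly j D) x).
  by exists Phi; split=> //; apply: Phi_root.
have Dmin E : E != 0 -> root (map_poly j E) x -> (size D <= size E)%N.
  by move=> E0 Ex; apply: Dmin'.
have [le|lt] := leqP (maxn (size rn) (size rd)) (size D).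
  by right=> E E0 Ex; apply: leq_trans le (Dmin _ E0 Ex).
left; have l0 : lead_coef D != 0 by rewrite lead_coef_eq0.
have [i hi] : exists i, forall c, D`_i / lead_coef D != cst c.
  apply: NNPP => H.
  have Hc i : exists c, ((lead_coef D)^-1 *: D)`_i = cst c.
    apply: NNPP => Hi; apply: H; exists i => c; apply/negP => /eqP e; apply: Hi.
    by exists c; rewrite coefZ mulrC.
  have [q eq] : exists q, (lead_coef D)^-1 *: D = map_poly cst q.
    elim/poly_ind: ((lead_coef D)^-1 *: D) Hc => [|p c IH] Hc.
      by exists 0; rewrite rmorph0.
    have [|q ->] := IH; first by move=> k; have := Hc k.+1; rewrite coefD coefMX coefC addr0.
    have [d] := Hc 0%N; rewrite coefD coefMX coefC add0r => ->.
    by exists (q * 'X + d%:P); rewrite rmorphD rmorphM /= map_polyX map_polyC.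
  have : (map_poly j (map_poly cst q)).[x] = 0.
    by rewrite -eq map_polyZ hornerZ (rootP Dx) mulr0.
  rewrite map_j_cst horner_cF => /eqP; rewrite tofrac_eq0 => /eqP q0.
  move/eqP: eq; rewrite q0 rmorph0 scale_poly_eq0 invr_eq0 (negPf l0) /=.
  by rewrite (negPf D0).
set h := D`_i / lead_coef D in hi.
have [P [Q [Q0 cPQ jh]]] := frac_poly_reduced (j h).
have hD : D`_i = h * D`_(size D).-1 by rewrite /h divfK.
have sDB := min_size_eq D0 Dx Dmin Q0 cPQ jh hi hD l0.
set B := _ - _ in sDB.
have sB : size B = maxn (size P) (size Q) by apply: size_B.
have DB : D %= B.
  by rewrite -dvdp_size_eqp ?sDB //; apply: (min_dvdp D0 Dx Dmin); apply: B_root.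
have BPhi : B %| Phi by rewrite -(eqp_dvdl _ DB); apply: (min_dvdp D0 Dx Dmin); apply: Phi_root.
pose f : {rmorphism {poly K} -> L} := horner_eval h \o map_poly cst.
have [|psi psiE] := @frac_lift _ _ f.
  move=> p fp; apply: NNPP => /eqP p0.
  by have /negP[] := nonconst_transcendental hi p0; apply/eqP.
have psicF p : map_poly psi (map_poly cF p) = map_poly cst p.
  rewrite -map_poly_comp; apply: eq_map_poly => c /=.
  by rewrite psiE /f /= map_polyC horner_evalE hornerC.
have psix : psi x = h by rewrite psiE /f /= map_polyX horner_evalE hornerX.
pose Dz := map_poly cF P - x *: map_poly cF Q.
have psiD : map_poly psi Dz = B by rewrite /Dz rmorphB /= map_polyZ !psicF psix.
(* [B] is the image of [Dz] under [x |-> h] and divides [rn - r rd]; hence the images of the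
   remainders satisfy [R1 = r R2], and a quotient of two coefficients expresses [r] through [h]. *)
pose R1 := map_poly cF rn %% Dz; pose R2 := map_poly cF rd %% Dz.
have eR : map_poly psi R1 = r *: map_poly psi R2.
  rewrite !map_modp psiD !psicF -modpZl; apply/eqP; rewrite -subr_eq0 -modpN -modpD.
  by apply/eqP/modp_eq0P.
have R20 : R2 != 0.
  apply/negP => /eqP R20; have : B %| map_poly cst rd.
    by apply/modp_eq0P; rewrite -psiD -psicF -map_modp -/R2 R20 rmorph0.
  rewrite -(eqp_dvdl _ DB) => /dvdpP[E eE].
  have : (map_poly j (map_poly cst rd)).[x] = 0.
    have -> : map_poly j (map_poly cst rd) = map_poly j E * map_poly j D by rewrite eE rmorphM.
    by rewrite hornerM (rootP Dx) mulr0.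
  rewrite map_j_cst horner_cF => /eqP; rewrite tofrac_eq0.
  by rewrite (negPf rd0).
have l20 : psi (lead_coef R2) != 0 by rewrite fmorph_eq0 lead_coef_eq0.
have [a [b [b0 cab eab]]] := frac_poly_reduced (R1`_(size R2).-1 / lead_coef R2).
have bh : (map_poly cst b).[h] != 0.
  by rewrite -[_.[h]]/(f b) -psiE fmorph_eq0 tofrac_eq0.
have er : r = (map_poly cst a).[h] / (map_poly cst b).[h].
  rewrite -[(map_poly cst a).[h]]/(f a) -[(map_poly cst b).[h]]/(f b) -!psiE -fmorph_div.
  rewrite -eab fmorph_div; apply: (canRL (mulfK l20)).
  have /(congr1 (fun u : {poly L} => u`_(size R2).-1)) := eR.
  by rewrite coefZ !coef_map => <-.
exists h, a, b; split=> //.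
(* If the degree were at most 1, [rn] and [rd] would divide combinations of [P] and [Q], of size at
   most [size D], against [lt]. *)
rewrite leqNgt; apply/negP => small.
have sab : (size a <= 2)%N /\ (size b <= 2)%N.
  move: small; rewrite gtn_max => /andP[].
  by case: (size a) => [|[|[|]]] // ; case: (size b) => [|[|[|]]].
have hom (p : {poly K}) : (size p <= 2)%N ->
    (map_poly cF p).[j h] * tofrac Q = tofrac (p`_0 *: Q + p`_1 *: P).
  move=> sp; rewrite (horner_coef_wide _ (_ : _ <= 2)%N) ?size_map_poly //.
  rewrite big_ord_recl big_ord1 !coef_map /= expr0 expr1 mulr1 jh mulrDl.
  rewrite -mulrA divfK ?tofrac_eq0 // -!rmorphM -rmorphD /=.
  by rewrite !mul_polyC.
have jhor (p : {poly K}) : j (map_poly cst p).[h] = (map_poly cF p).[j h].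
  by rewrite -horner_map map_j_cst.
have key : rn * (b`_0 *: Q + b`_1 *: P) = rd * (a`_0 *: Q + a`_1 *: P).
  apply: inj; rewrite !rmorphM /= -!hom; try by case: sab.
  have jb0 : (map_poly cF b).[j h] != 0 by rewrite -jhor fmorph_eq0.
  have : tofrac rn * (map_poly cF b).[j h] = tofrac rd * (map_poly cF a).[j h].
    have /(congr1 j) := er; rewrite jr fmorph_div !jhor => e.
    rewrite -[tofrac rn](divfK (_ : tofrac rd != 0)) ?tofrac_eq0 // e.
    by rewrite mulrAC divfK // mulrC.
  by rewrite !mulrA => ->.
have nb : b`_0 *: Q + b`_1 *: P != 0.
  have jb0 : (map_poly cF b).[j h] * tofrac Q != 0.
    by rewrite -jhor mulf_neq0 ?tofrac_eq0 // fmorph_eq0.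
  by move: jb0; rewrite hom ?tofrac_eq0 //; case: sab.
have sc (p : {poly K}) : (size (p`_0 *: Q + p`_1 *: P)%R <= size D)%N.
  rewrite sDB sB; apply: leq_trans (size_polyD _ _) _.
  rewrite geq_max; apply/andP.
  by split; apply: leq_trans (size_scale_leq _ _) _; rewrite (leq_maxl, leq_maxr).
move: lt; rewrite ltnNge => /negP[]; rewrite geq_max; apply/andP; split.
  have [->|rn0] := eqVneq rn 0; first by rewrite size_poly0.
  apply: leq_trans (sc a); apply: dvdp_leq.
    apply/negP => /eqP e0; move/eqP: key; rewrite e0 mulr0 mulf_eq0 (negPf rn0).
    by rewrite (negPf nb).
  by rewrite -(@Gauss_dvdpr _ _ rd) // -key dvdp_mulr.
apply: leq_trans (sc b); apply: dvdp_leq => //.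
by rewrite -(@Gauss_dvdpr _ _ rn) 1?coprimep_sym // key dvdp_mulr.
Qed.

End Luroth.

(** * The generic fibre on a line is irreducible *)

(** A root [z] of [D] is adjoined: it is a root of [p], hence algebraic, and [D = D' * ('X - z)]
    leads to the smaller [D'] over a larger field, so the induction has to range over all [E].
    Algebraicity descends again because the equations have coefficients in [F0]. *)
Lemma factor_coef_algebraic (F0 : fieldType) n (E : fieldType) (phi : {rmorphism F0 -> E})
    (p : {poly F0}) (D : {poly E}) :
  (size D < n)%N -> p != 0 -> D \is monic -> D %| map_poly phi p ->
  forall i, algebraicOver phi D`_i.
Proof.
elim: n E phi D => // n IH E phi D lt_D p0 Dm Dp i.
have [s1|s1] := leqP (size D) 1.
  have -> : D = 1.
    rewrite (size1_polyC s1); have := monicP Dm.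
    by rewrite {1}(size1_polyC s1) lead_coefC => ->.
  by rewrite coef1; case: eqP => _; [apply: algebraic1|apply: algebraic0].
have [|q [sq qD] qmin] := @ex_min_size E (fun q => (1 < size q)%N /\ q %| D).
  by exists D.
have irq : irreducible_poly q.
  split=> // u su uq; rewrite -dvdp_size_eqp // eqn_leq dvdp_leq //=; last first.
    by rewrite -size_poly_gt0 ltnW.
  apply: qmin; split; last exact: dvdp_trans uq qD.
  rewrite ltn_neqAle eq_sym su size_poly_gt0.
  by apply: contraTneq uq => ->; rewrite dvd0p -size_poly_gt0 ltnW.
have [E' _ [z qz _]] := irredp_FAdjoin irq.
pose io : {rmorphism E -> E'} := in_alg E'.
have Dz : root (map_poly io D) z.
  by case/dvdpP: qD => u ->; rewrite rmorphM rootM qz orbT.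
have /factor_theorem [D' eD'] := Dz.
have D'm : D' \is monic.
  have := map_monic io D; rewrite eD' Dm => /esym.
  by rewrite monicMr // monicXsubC.
have sD' : size D = (size D').+1.
  rewrite -(size_map_poly io) eD' size_Mmonic ?monicXsubC ?monic_neq0 //.
  by rewrite size_XsubC addn2.
have Dp' : D' * ('X - z%:P) %| map_poly (io \o phi) p.
  by rewrite -eD' map_poly_comp dvdp_map.
have aD' k : algebraicOver (io \o phi) D'`_k.
  apply: IH => //; first by rewrite -ltnS -sD'.
  by apply: dvdp_trans Dp'; apply: dvdp_mulr.
have az : algebraicOver (io \o phi) z.
  exists p => //; case/dvdpP: Dp' => u ->.
  by rewrite !rootM root_XsubC eqxx !orbT.
have : algebraicOver (io \o phi) (io D`_i).
  rewrite -coef_map eD' mulrBr coefB coefMX coefMC.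
  apply: algebraic_sub; last exact: algebraic_mul.
  by case: eqP => // _; apply: algebraic0.
case=> u u0; rewrite map_poly_comp rootE horner_map fmorph_eq0 => ru.
by exists u.
Qed.

(** * The place attached to the leading monomial *)

Section LeadingPlace.
Variables (k : fieldType) (n : nat).
Local Notation M := {mpoly k[n]}.
Local Notation kap c := (tofrac (c%:MP : M)).

Definition mlt (e d : M) : Prop := e = 0 \/ (mlead e < mlead d)%O.
Definition mle (e d : M) : Prop := e = 0 \/ (mlead e <= mlead d)%O.

Lemma mlt_mle e d : mlt e d -> mle e d.
Proof. by case=> [->|/ltW lt]; [left|right]. Qed.

Lemma mltD e1 e2 d : mlt e1 d -> mlt e2 d -> mlt (e1 + e2) d.
Proof.
case=> [->|l1]; first by rewrite add0r.
case=> [->|l2]; first by rewrite addr0; right.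
right; apply: le_lt_trans (mleadD_le _ _) _.
by rewrite ltUx l1 l2.
Qed.

Lemma mltM e1 d1 e2 d2 : d1 != 0 -> d2 != 0 -> mlt e1 d1 -> mle e2 d2 ->
  mlt (e1 * e2) (d1 * d2).
Proof.
move=> n1 n2 [->|l1]; first by rewrite mul0r; left.
case=> [->|l2]; first by rewrite mulr0; left.
have [->|z1] := eqVneq e1 0; first by rewrite mul0r; left.
have [->|z2] := eqVneq e2 0; first by rewrite mulr0; left.
by right; rewrite !mleadM //; apply: ltmc_le_add.
Qed.

Lemma mle_refl d : mle d d. Proof. by right. Qed.

(* [small] is the maximal ideal of the valuation ring attached to the leading
   monomial, whose residue field is [k]. *)
Definition small (w : {fraction M}) : Prop :=
  exists e d, [/\ d != 0, w = tofrac e / tofrac d & mlt e d].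

Definition residue (w : {fraction M}) (c : k) : Prop := small (w - kap c).

Lemma small0 : small 0.
Proof. by exists 0, 1; split; [apply: oner_neq0|rewrite rmorph0 mul0r|left]. Qed.

Lemma smallD v w : small v -> small w -> small (v + w).
Proof.
move=> [e1 [d1 [n1 -> l1]]] [e2 [d2 [n2 -> l2]]].
exists (e1 * d2 + e2 * d1), (d1 * d2); split; first exact: mulf_neq0.
  by rewrite addf_div ?tofrac_eq0 // -!rmorphM -rmorphD.
apply: mltD; first by apply: mltM => //; apply: mle_refl.
by rewrite (mulrC d1); apply: mltM => //; apply: mle_refl.
Qed.

Lemma smallZ v c : small v -> small (kap c * v).
Proof.
move=> [e [d [n0 -> l]]]; exists (c%:MP * e), d; split=> //.
  by rewrite rmorphM mulrA.
rewrite mulrC -[d]mulr1; apply: mltM => //; first exact: oner_neq0.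
by right; rewrite mleadC mlead1.
Qed.

Lemma smallM v w : small v -> small w -> small (v * w).
Proof.
move=> [e1 [d1 [n1 -> l1]]] [e2 [d2 [n2 -> l2]]].
exists (e1 * e2), (d1 * d2); split; first exact: mulf_neq0.
  by rewrite mulf_div -!rmorphM.
by apply: mltM => //; apply: mlt_mle.
Qed.

Lemma smallN v : small v -> small (- v).
Proof.
by move/(smallZ (-1)); rewrite mpolyCN mpolyC1 rmorphN rmorph1 mulN1r.
Qed.

Lemma small_kap c : small (kap c) -> c = 0.
Proof.
case=> e [d [d0 eq lt]]; apply: NNPP => /eqP c0.
have : c%:MP * d = e.
  apply/eqP; rewrite -tofrac_eq rmorphM /= eq divfK ?tofrac_eq0 //.
move=> ee; case: lt => [e0|].
  by move: ee; rewrite e0 => /eqP; rewrite mulf_eq0 mpolyC_eq0 (negPf c0) (negPf d0).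
by rewrite -ee mul_mpolyC mleadZ // ltxx.
Qed.

Lemma residue_uniq w c d : residue w c -> residue w d -> c = d.
Proof.
move=> rc rd; apply/eqP; rewrite -subr_eq0; apply/eqP/small_kap.
have -> : kap (c - d) = (w - kap d) - (w - kap c).
  by rewrite mpolyCB rmorphB opprB [RHS]addrC addrA subrK.
exact/smallD/smallN.
Qed.

Lemma residueC c : residue (kap c) c.
Proof. rewrite /residue subrr; exact: small0. Qed.

Lemma residueD v w c d : residue v c -> residue w d -> residue (v + w) (c + d).
Proof.
rewrite /residue mpolyCD rmorphD opprD addrACA => sv sw; exact: smallD.
Qed.

Lemma residueN v c : residue v c -> residue (- v) (- c).
Proof. by rewrite /residue mpolyCN rmorphN -opprD; apply: smallN. Qed.

Lemma residueM v w c d : residue v c -> residue w d -> residue (v * w) (c * d).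
Proof.
rewrite /residue => sv sw.
have -> : v * w - kap (c * d)
    = (v - kap c) * (w - kap d) + kap d * (v - kap c) + kap c * (w - kap d).
  by rewrite mpolyCM rmorphM /=; ring.
by apply: smallD; [apply: smallD; [apply: smallM|]|]; rewrite //; apply: smallZ.
Qed.

Lemma residue1 : residue 1 1.
Proof. by rewrite -(rmorph1 tofrac) -mpolyC1; apply: residueC. Qed.

Lemma residueX v c m : residue v c -> residue (v ^+ m) (c ^+ m).
Proof.
move=> r; elim: m => [|m IH]; first exact: residue1.
by rewrite !exprS; apply: residueM.
Qed.

Lemma residue_sum (I : Type) (s : seq I) F G :
  (forall i, residue (F i) (G i)) -> residue (\sum_(i <- s) F i) (\sum_(i <- s) G i).
Proof.
move=> r; elim: s => [|i s IH]; last by rewrite !big_cons; apply: residueD.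
by rewrite !big_nil -[0](rmorph0 tofrac) -mpolyC0; apply: residueC.
Qed.

Lemma residue_prod (I : Type) (s : seq I) F G :
  (forall i, residue (F i) (G i)) -> residue (\prod_(i <- s) F i) (\prod_(i <- s) G i).
Proof.
move=> r; elim: s => [|i s IH]; last by rewrite !big_cons; apply: residueM.
by rewrite !big_nil; apply: residue1.
Qed.

(** With equal leading monomials, the quotient of the leading coefficients is the residue; otherwise
    the comparison of the monomials decides. *)
Lemma small_or w : w != 0 -> (exists c, residue w c) \/ small w^-1.
Proof.
have [a [b [b0 ->]]] := fracP w => /negP w0.
have a0 : a != 0 by apply/negP => /eqP a0; apply: w0; rewrite a0 rmorph0 mul0r eqxx.
have [lt|gt|e] := ltgtP (mlead a) (mlead b).
- by left; exists 0; rewrite /residue mpolyC0 rmorph0 subr0; exists a, b; split=> //; right.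
- by right; rewrite invf_div; exists b, a; split=> //; right.
left; pose c := mleadc a / mleadc b.
exists c, (a - c *: b), b; split=> //.
  have -> : tofrac (a - c *: b) = tofrac a - kap c * tofrac b.
    by rewrite rmorphB -mul_mpolyC; congr (_ - _); rewrite rmorphM.
  by rewrite mulrBl mulfK ?tofrac_eq0.
have [->|z] := eqVneq (a - c *: b) 0; first by left.
right; rewrite lt_neqAle; apply/andP; split; last first.
  apply: le_trans (mleadB_le _ _) _; rewrite leUx e lexx /=.
  exact: mleadZ_le.
apply: contra_neq z => ez; apply/eqP; rewrite -mleadc_eq0 ez mcoeffB mcoeffZ.
by rewrite /c e divfK ?subrr ?mleadc_eq0.
Qed.

Lemma residueV w c : c != 0 -> residue w c -> residue w^-1 c^-1.
Proof.
move=> c0 r; have w0 : w != 0.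
  apply: contra_neq c0 => w0; apply: small_kap.
  by have := smallN r; rewrite w0 sub0r opprK.
have [[d rd]|sw] := small_or (invr_neq0 w0); last first.
  rewrite invrK in sw; case/eqP: c0; apply: small_kap.
  have -> : kap c = w - (w - kap c) by rewrite opprB addrC subrK.
  exact/smallD/smallN.
suff -> : c^-1 = d by [].
have := residueM r rd; rewrite divff // => r1.
by apply: (mulfI c0); rewrite divff // (residue_uniq r1 residue1).
Qed.

End LeadingPlace.

(** * The relative algebraic closure of a field and its image under a place *)

Section RelativeClosure.
Variables (F0 X : fieldType) (phi : {rmorphism F0 -> X}).

Definition algebraic_pred : {pred X} :=
  fun w => if excluded_middle_informative (algebraicOver phi w) then true else false.

Lemma algebraic_predP w : reflect (algebraicOver phi w) (w \in algebraic_pred).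
Proof.
rewrite unfold_in; case: excluded_middle_informative => H; first exact: ReflectT.
exact: ReflectF.
Qed.

Fact algebraic_pred_divring : divring_closed algebraic_pred.
Proof.
split; first exact/algebraic_predP/algebraic1.
  move=> v w /algebraic_predP av /algebraic_predP aw.
  exact/algebraic_predP/algebraic_sub.
move=> v w /algebraic_predP av /algebraic_predP aw.
exact/algebraic_predP/algebraic_div.
Qed.

HB.instance Definition _ :=
  GRing.isDivringClosed.Build X algebraic_pred algebraic_pred_divring.

Record rel_closure := RelClosure { rcval : X; _ : rcval \in algebraic_pred }.
HB.instance Definition _ := [isSub for rcval].
HB.instance Definition _ := [Choice of rel_closure by <:].
HB.instance Definition _ := [SubChoice_isSubComUnitRing of rel_closure by <:].
HB.instance Definition _ := [SubComUnitRing_isSubIntegralDomain of rel_closure by <:].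
HB.instance Definition _ := [SubIntegralDomain_isSubField of rel_closure by <:].

Definition rc_val : {rmorphism rel_closure -> X} := val.

Lemma rc_algebraic (w : rel_closure) : algebraicOver phi (rc_val w).
Proof. exact/algebraic_predP/(valP w). Qed.

Lemma rc_lift w : algebraicOver phi w -> exists v, rc_val v = w.
Proof. by move/algebraic_predP => aw; exists (RelClosure aw). Qed.

Fact rc_base_proof c : phi c \in algebraic_pred.
Proof. exact/algebraic_predP/algebraic_id. Qed.

Definition rc_base_fun c := RelClosure (rc_base_proof c).

Fact rc_base_is_zmod : zmod_morphism rc_base_fun.
Proof. by move=> c d; apply: val_inj; rewrite /= rmorphB. Qed.

Fact rc_base_is_monoid : monoid_morphism rc_base_fun.
Proof. by split=> [|c d]; apply: val_inj; rewrite /= ?rmorph1 ?rmorphM. Qed.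

HB.instance Definition _ := GRing.isZmodMorphism.Build _ _ rc_base_fun rc_base_is_zmod.
HB.instance Definition _ := GRing.isMonoidMorphism.Build _ _ rc_base_fun rc_base_is_monoid.

Definition rc_base : {rmorphism F0 -> rel_closure} := rc_base_fun.

Lemma rc_val_base c : rc_val (rc_base c) = phi c. Proof. by []. Qed.

Variables (k : fieldType) (n : nat) (theta : {rmorphism X -> {fraction {mpoly k[n]}}}).
Hypothesis theta_phi : forall c, exists d, residue (theta (phi c)) d.

Lemma rc_residue_ex (w : rel_closure) : exists c, residue (theta (rc_val w)) c.
Proof.
have [p p0 pw] := rc_algebraic w.
have [/eqP w0|w0] := boolP (theta (rc_val w) == 0).
  by exists 0; rewrite /residue mpolyC0 rmorph0 subr0 w0; apply: small0.
have [//|sw] := small_or w0.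
(* an algebraic element cannot be infinite: divide its equation by the top power *)
pose q := (lead_coef p)^-1 *: p.
have lp0 : lead_coef p != 0 by rewrite lead_coef_eq0.
have sq : size q = size p by rewrite size_scale ?invr_eq0.
have : (map_poly phi q).[rc_val w] = 0.
  by rewrite map_polyZ hornerZ (rootP pw) mulr0.
have sp : (0 < size p)%N by rewrite size_poly_gt0.
rewrite (horner_coef_wide _ (_ : _ <= (size p).-1.+1)%N); last by rewrite size_map_poly sq prednK.
rewrite big_ord_recr /= !coef_map /= -[q`_ _]/(q`_(size p).-1).
have -> : q`_(size p).-1 = 1 by rewrite coefZ mulVf.
rewrite rmorph1 mul1r => /(congr1 theta); rewrite rmorphD rmorph_sum /= rmorph0 rmorphXn /=.
set v := theta _ in w0 sw *; set m := (size p).-1.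
move/(congr1 (fun u => u * v^-1 ^+ m)).
rewrite mul0r mulrDl -exprMn divff // expr1n => e.
have : small (1 : {fraction {mpoly k[n]}}).
  have -> : 1 = - (\sum_(i < m) (theta (phi q`_i * rc_val w ^+ i)) * v^-1 ^+ m).
    apply/eqP; rewrite -addr_eq0 addrC; apply/eqP; apply: etrans e; rewrite mulr_suml.
    by congr (_ + _); apply: eq_bigr => i _; rewrite coef_map.
  apply: smallN; elim/big_ind: _ => [||i _]; first exact: small0.
    exact: smallD.
  have em : v^-1 ^+ m = v^-1 ^+ i * (v^-1 * v^-1 ^+ (m - i.+1)).
    by rewrite -exprS -exprD addnS -addSn subnKC.
  rewrite rmorphM rmorphXn /= -[theta (rcval w)]/v em.
  rewrite -mulrA [v ^+ i * _]mulrA -exprMn divff // expr1n mul1r.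
  have [d rd] := theta_phi q`_i.
  have : residue (v^-1 ^+ (m - i.+1)) (if (m - i.+1 == 0)%N then 1 else 0).
    case: (m - i.+1)%N => [|l]; first by rewrite expr0; apply: residue1.
    rewrite -[0](expr0n _ l.+1); apply: residueX.
    by rewrite /residue mpolyC0 rmorph0 subr0.
  move=> rv; have r0 : residue v^-1 0 by rewrite /residue mpolyC0 rmorph0 subr0.
  have := residueM rd (residueM r0 rv); rewrite mul0r mulr0.
  by rewrite /residue mpolyC0 rmorph0 subr0.
rewrite -(rmorph1 tofrac) -mpolyC1 => /small_kap/eqP.
by rewrite oner_eq0.
Qed.

Definition rc_residue_fun w := proj1_sig (constructive_indefinite_description _ (rc_residue_ex w)).

Lemma rc_residueP w : residue (theta (rc_val w)) (rc_residue_fun w).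
Proof. exact: (proj2_sig (constructive_indefinite_description _ (rc_residue_ex w))). Qed.

(** A place that is finite on an entire field is an embedding of it, and elements algebraic over
    [F0] have finite residues; this produces the embedding that [luroth] takes as input. *)
Lemma rc_residue_morph : exists j : {rmorphism rel_closure -> k},
  forall w, residue (theta (rc_val w)) (j w).
Proof.
have Z : zmod_morphism rc_residue_fun.
  move=> v w; apply: residue_uniq (rc_residueP _) _.
  by rewrite !rmorphB; apply: residueD; [|apply: residueN]; apply: rc_residueP.
have MM : monoid_morphism rc_residue_fun.
  split=> [|v w]; apply: residue_uniq (rc_residueP _) _.
    by rewrite !rmorph1; apply: residue1.
  by rewrite !rmorphM; apply: residueM; apply: rc_residueP.
pose m := GRing.isZmodMorphism.Build _ _ rc_residue_fun Z.
pose m' := GRing.isMonoidMorphism.Build _ _ rc_residue_fun MM.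
pose j : {rmorphism rel_closure -> k} := HB.pack rc_residue_fun m m'.
by exists j; apply: rc_residueP.
Qed.

End RelativeClosure.

Section FibreIrreducible.
Variables (K : closedFieldType) (X : fieldType) (cX : {rmorphism K -> X}) (n : nat).
Local Notation k := {fraction {poly K}}.
Variable theta : {rmorphism X -> {fraction {mpoly k[n]}}}.
Hypothesis theta_c : forall c, theta (cX c) = tofrac ((tofrac c%:P : k)%:MP).
Variables (rn rd : {poly K}) (r : X).
Hypothesis rnd : coprimep rn rd.
Hypothesis rd0 : rd != 0.
Hypothesis rnd_gt1 : (1 < maxn (size rn) (size rd))%N.
Hypothesis theta_r : residue (theta r) (tofrac rn / tofrac rd).

Local Notation cF := (FracField.tofrac (R := {poly K}) \o polyC).
Local Notation rho := (tofrac rn / tofrac rd).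

Lemma rho_nonconst c : rho != cF c.
Proof.
apply/negP => /eqP /=; rewrite -[tofrac c%:P]divr1 -(rmorph1 tofrac).
move=> /(frac_eq rn c%:P rd0 (oner_neq0 _)); rewrite mulr1 => e.
have s1 : size rd = 1%N.
  apply/eqP; rewrite size_poly_eq1; move/coprimepP: rnd; apply=> //.
  by rewrite e dvdp_mull.
move: rnd_gt1; rewrite ltnNge => /negP[].
rewrite geq_max s1 leqnn andbT e mul_polyC.
by apply: leq_trans (size_scale_leq _ _) _; rewrite s1.
Qed.

Lemma r_nonconst c : r != cX c.
Proof.
apply/negP => /eqP rc; have := theta_r; rewrite rc theta_c => H.
have /negP[] := rho_nonconst c; apply/eqP; exact: residue_uniq H (residueC _ _).
Qed.

Let Phi : {poly X} := map_poly cX rn - r *: map_poly cX rd.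

(** [luroth] is applied to the algebraic closure [L] of [K(r)] in [X], embedded in [K(x)] by the
    place, with [r] sent to [rho]. A monic factor of [Phi] has its coefficients in [L], so it and
    its cofactor descend; the image of [Phi] vanishes at [x], hence so does one of the two, which
    then has full size. *)
Lemma fibre_irreducible :
  (exists h (a b : {poly K}), [/\ coprimep a b, (2 <= maxn (size a).-1 (size b).-1)%N,
     (map_poly cX b).[h] != 0 & r = (map_poly cX a).[h] / (map_poly cX b).[h]])
  \/ (forall A, A %| Phi -> (size A <= 1)%N \/ (maxn (size rn) (size rd) <= size A)%N).
Proof.
pose f : {rmorphism {poly K} -> X} := horner_eval r \o map_poly cX.
have fnz p : f p = 0 -> p = 0.
  move=> fp; apply: NNPP => /eqP p0.
  by have /negP[] := nonconst_transcendental r_nonconst p0; apply/eqP.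
have [phi phiE] := frac_lift fnz.
have res_poly p : residue (theta (f p)) (map_poly cF p).[rho].
  rewrite /f /= horner_evalE !horner_coef !size_map_poly rmorph_sum /=.
  apply: residue_sum => i; rewrite rmorphM rmorphXn !coef_map /= theta_c.
  by apply: residueM; [apply: residueC|apply: residueX].
have theta_phi w : exists d, residue (theta (phi w)) d.
  have [a [b [b0 ->]]] := fracP w.
  rewrite !fmorph_div /= !phiE.
  eexists; apply: residueM (res_poly a) _; apply: residueV (res_poly b).
  exact: (@nonconst_transcendental K _ cF _ _ rho_nonconst).
have [j jP] := rc_residue_morph theta_phi.
set L := rel_closure phi in j jP *.
pose cst : {rmorphism K -> L} := rc_base phi \o cF.
have val_cst c : rc_val phi (cst c) = cX c.
  by rewrite /cst /= phiE /f /= map_polyC horner_evalE hornerC.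
pose rL := rc_base phi (tofrac 'X).
have val_r : rc_val phi rL = r.
  by rewrite /rL rc_val_base phiE /f /= map_polyX horner_evalE hornerX.
have jc c : j (cst c) = tofrac c%:P.
  by apply: residue_uniq (jP _) _; rewrite val_cst theta_c; apply: residueC.
have jr : j rL = rho by apply: residue_uniq (jP _) _; rewrite val_r.
have val_poly p : map_poly (rc_val phi) (map_poly cst p) = map_poly cX p.
  by rewrite -map_poly_comp; apply: eq_map_poly => c; exact: val_cst.
have [[h [a [b [cab sab bh er]]]]|Lmin] := luroth jc rnd rd0 jr.
  left; exists (rc_val phi h), a, b.
  have ev p : (map_poly cX p).[rc_val phi h] = rc_val phi (map_poly cst p).[h].
    by rewrite -val_poly horner_map.
  split=> //; first by rewrite ev fmorph_eq0.
  by rewrite !ev -fmorph_div -er val_r.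
right=> A APhi.
pose PhiL : {poly L} := map_poly cst rn - rL *: map_poly cst rd.
have ePhi : Phi = map_poly (rc_val phi) PhiL.
  rewrite /PhiL rmorphB; congr (_ - _); first exact: esym (val_poly _).
  by rewrite -val_r -val_poly -map_polyZ.
pose PhiF : {poly k} := map_poly cF rn - tofrac 'X *: map_poly cF rd.
have phi_cF p : map_poly phi (map_poly cF p) = map_poly cX p.
  rewrite -map_poly_comp; apply: eq_map_poly => c /=.
  by rewrite phiE /f /= map_polyC horner_evalE hornerC.
have ePhiF : Phi = map_poly phi PhiF.
  rewrite /PhiF rmorphB; congr (_ - _); first exact: esym (phi_cF _).
  have -> : r = phi (tofrac 'X) by rewrite phiE /f /= map_polyX horner_evalE hornerX.
  by rewrite -phi_cF -map_polyZ.
have Phi0 : Phi != 0 by apply: pencil_neq0.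
have PhiL0 : PhiL != 0 by apply: pencil_neq0.
have PhiF0 : PhiF != 0 by apply: pencil_neq0.
have [A0|A0] := eqVneq A 0.
  by left; rewrite A0 size_poly0.
pose A' := (lead_coef A)^-1 *: A.
have lA : (lead_coef A)^-1 != 0 by rewrite invr_eq0 lead_coef_eq0.
have A'm : A' \is monic by rewrite monicE lead_coefZ mulVf // -invr_eq0.
have A'Phi : A' %| map_poly phi PhiF by rewrite -ePhiF dvdpZl.
have [q eq] : exists q : {poly L}, A' = map_poly (rc_val phi) q.
  have Hc i : exists c, A'`_i = rc_val phi c.
    have [c ec] := rc_lift (factor_coef_algebraic (ltnSn _) PhiF0 A'm A'Phi i).
    by exists c.
  elim/poly_ind: (A') Hc => [|p c IH] Hc; first by exists 0; rewrite rmorph0.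
  have [|q ->] := IH; first by move=> i; have := Hc i.+1; rewrite coefD coefMX coefC addr0.
  have [d] := Hc 0%N; rewrite coefD coefMX coefC add0r => ->.
  exists (q * 'X + d%:P); rewrite rmorphD rmorphM /= (map_polyX (rc_val phi)).
  by rewrite (map_polyC (rc_val phi)).
have sA : size A = size q by rewrite -(size_scale A lA) -/A' eq size_map_poly.
have /dvdpP[E eE] : q %| PhiL.
  by rewrite -(dvdp_map (rc_val phi)) -eq -ePhi dvdpZl.
have := Phi_root jc rd0 jr.
rewrite -/PhiL.
have -> : map_poly j PhiL = map_poly j E * map_poly j q by rewrite eE rmorphM.
rewrite rootM => /orP[Ex|qx].
  (* Here the cofactor vanishes at [x]; it takes up the whole degree and leaves a constant for
     [A]. *)
  left; have E0 : E != 0 by apply: contra_neq PhiL0; rewrite eE => ->; rewrite mul0r.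
  have q0 : q != 0 by apply: contra_neq PhiL0; rewrite eE => ->; rewrite mulr0.
  have := Lmin _ E0 Ex.
  have sP : (size PhiL <= maxn (size rn) (size rd))%N.
    apply: leq_trans (size_polyD _ _) _; rewrite size_polyN geq_max size_map_poly leq_maxl.
    by apply: leq_trans (size_scale_leq _ _) _; rewrite size_map_poly leq_maxr.
  move: sP; rewrite eE size_mul // sA => le1 le2.
  have := leq_trans le1 le2; have : (0 < size E)%N by rewrite size_poly_gt0.
  case: (size E) => // m _; rewrite addSn /= -[m.+1]addn1 leq_add2l.
  by [].
right; rewrite sA; apply: Lmin => //.
by rewrite -size_poly_eq0 -sA size_poly_eq0.
Qed.

End FibreIrreducible.

Lemma mmap_homog_scale (R : comNzRingType) (S : comNzRingType) n (f : {rmorphism R -> S})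
    (h h' : 'I_n -> S) (c : S) d (q : {mpoly R[n]}) :
  q \is d.-homog -> (forall i, h i = c * h' i) -> mmap f h q = c ^+ d * mmap f h' q.
Proof.
move=> /dhomogP hq hh; rewrite /mmap mulr_sumr; apply: eq_big_seq => m /hq /= dm.
rewrite mulrCA; congr (_ * _); rewrite /mmap1.
under eq_bigr => i _ do rewrite hh exprMn.
rewrite big_split /= -dm mdegE; congr (_ * _).
by rewrite -expr_sum.
Qed.

(** * Restriction of forms to a line, and its realization by a place *)

Section Line.
Variables (K : closedFieldType) (n : nat) (a b : 'I_n -> K).

Definition line : {rmorphism {mpoly K[n]} -> {poly K}} :=
  mmap polyC (fun j => (a j)%:P + b j *: 'X).

Lemma horner_line q t : (line q).[t] = q.@[fun j => a j + b j * t].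
Proof.
pose e1 : {rmorphism {mpoly K[n]} -> K} := horner_eval t \o line.
pose e2 : {rmorphism {mpoly K[n]} -> K} := meval (fun j => a j + b j * t).
apply: (mpoly_rmorph_ext (f := e1) (g := e2)) => [c|i]; rewrite /e1 /e2 /=.
  by rewrite mmapC mevalC horner_evalE hornerC.
by rewrite mmapX mmap1U mevalXU horner_evalE !hornerE.
Qed.

End Line.

(** The coefficient [v] may be zero: [e] is a formal degree, which makes the notion multiplicative
    without side conditions. *)
Definition deg_lead (R : nzRingType) (e : nat) (p : {poly R}) (v : R) :=
  (size p <= e.+1)%N /\ p`_e = v.

Lemma deg_leadM (R : nzRingType) e1 e2 (p1 p2 : {poly R}) v1 v2 :
  deg_lead e1 p1 v1 -> deg_lead e2 p2 v2 -> deg_lead (e1 + e2) (p1 * p2) (v1 * v2).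
Proof.
move=> [s1 c1] [s2 c2]; split.
  apply: leq_trans (size_polyMleq _ _) _.
  by apply: (@leq_trans (e1.+1 + e2.+1).-1); [rewrite -!subn1 leq_sub2r // leq_add|rewrite addnS].
have lt : (e1 < (e1 + e2).+1)%N by rewrite ltnS leq_addr.
rewrite coefM (bigD1 (Ordinal lt)) //= addKn c1 c2 big1 ?addr0 // => i ne.
have [lt1|gt1|e] := ltngtP i e1; last by case/eqP: ne; apply: val_inj.
  rewrite [p2`_ _]nth_default ?mulr0 //; apply: leq_trans s2 _.
  by rewrite ltn_subRL ltn_add2r.
by rewrite nth_default ?mul0r //; apply: leq_trans s1 _.
Qed.

Lemma deg_leadX (R : nzRingType) e (p : {poly R}) v m :
  deg_lead e p v -> deg_lead (e * m) (p ^+ m) (v ^+ m).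
Proof.
move=> h; elim: m => [|m IH]; last by rewrite !exprS mulnS; apply: deg_leadM.
by rewrite !expr0 muln0; split; rewrite ?size_poly1 ?coef1.
Qed.

Lemma line_deg_lead (K : closedFieldType) n (a b : 'I_n -> K) d q :
  q \is d.-homog -> deg_lead d (line a b q) q.@[b].
Proof.
move=> /dhomogP hq; rewrite /line /= /mmap mevalE.
have H m : m \in msupp q -> deg_lead d ((q@_m)%:P * mmap1 (fun j => (a j)%:P + b j *: 'X) m)
    (q@_m * \prod_i b i ^+ m i).
  move=> /hq /= <-; rewrite -[mdeg m]add0n; apply: deg_leadM.
    by split; rewrite ?size_polyC_leq1 ?coefC.
  rewrite mdegE /mmap1.
  elim/big_ind3: _ => [||i _]; first by split; rewrite ?size_poly1 ?coef1.
    by move=> *; apply: deg_leadM.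
  rewrite -[m i in X in deg_lead X]mul1n; apply: deg_leadX; split.
    apply: leq_trans (size_polyD _ _) _; rewrite geq_max.
    rewrite (leq_trans (size_polyC_leq1 _)) //=.
    by apply: leq_trans (size_scale_leq _ _) _; rewrite size_polyX.
  by rewrite coefD coefC coefZ coefX mulr1 add0r.
elim: (msupp q) H => [|m s IH] H; first by rewrite !big_nil; split; rewrite ?size_poly0 ?coef0.
rewrite !big_cons; have [s1 c1] := H m (mem_head _ _).
have [|s2 c2] := IH; first by move=> m' m's; apply: H; rewrite in_cons m's orbT.
split; last by rewrite coefD c1 c2.
by apply: leq_trans (size_polyD _ _) _; rewrite geq_max s1.
Qed.

Section PlaceAtLine.
Variables (K : closedFieldType) (n : nat) (a b : 'I_n -> K).
Hypothesis K0 : [pchar K] =i pred0.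
Local Notation k := {fraction {poly K}}.
Local Notation M := {mpoly k[n.+1]}.
Local Notation cF := (FracField.tofrac (R := {poly K}) \o polyC).
Local Notation cX := (FracField.tofrac (R := {mpoly K[n]}) \o @mpolyC n K).

(* The generic point is moved to infinity along the cone over the line: the
   coordinate [X_j] becomes [(a_j + b_j x) y_0 + y_(j+1)], and [y_0] is the largest
   variable for the monomial order. *)
Definition cone_var (j : 'I_n) : M :=
  (cF (a j) + cF (b j) * tofrac 'X)%:MP * 'X_ord0 + 'X_(lift ord0 j).

Definition cone : {rmorphism {mpoly K[n]} -> M} :=
  mmap (@mpolyC n.+1 k \o cF) cone_var.

(** Setting [y_0 = 0] and [y_(j+1) = v_j] sends the cone to the point [v], which is chosen off the
    zeros of [q]. *)
Lemma cone_inj q : cone q = 0 -> q = 0.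
Proof.
move=> e; apply: NNPP => /eqP q0; have [v /negP] := mpoly_nonroot K0 q0; apply.
pose w (i : 'I_n.+1) : k := if unlift ord0 i is Some j then cF (v j) else 0.
have : cF q.@[v] = meval w (cone q).
  pose e1 : {rmorphism {mpoly K[n]} -> k} := cF \o meval v.
  pose e2 : {rmorphism {mpoly K[n]} -> k} := meval w \o cone.
  apply: (mpoly_rmorph_ext (f := e1) (g := e2)) => [c|i]; rewrite /e1 /e2 /=.
    by rewrite mevalC mmapC mevalC.
  rewrite mevalXU mmapX mmap1U /cone_var rmorphD rmorphM /= mevalC !mevalXU.
  by rewrite /w unlift_none liftK mulr0 add0r.
by rewrite e meval0 => /eqP; rewrite tofrac_eq0 polyC_eq0.
Qed.

Lemma cone_frac : exists theta : {rmorphism {fraction {mpoly K[n]}} -> {fraction M}},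
  forall q, theta (tofrac q) = tofrac (cone q).
Proof.
have [|theta thetaE] := @frac_lift _ _ (FracField.tofrac (R := M) \o cone).
  by move=> q /eqP; rewrite tofrac_eq0 => /eqP /cone_inj.
by exists theta => q; rewrite thetaE.
Qed.

(** Division by [y_0^d] turns the coordinates into [a_j + b_j x + y_(j+1) / y_0], whose last term is
    small. *)
Lemma residue_cone d q : q \is d.-homog ->
  residue (tofrac (cone q) / tofrac ('X_ord0 : M) ^+ d) (tofrac (line a b q)).
Proof.
move=> hq; have Y0 : tofrac ('X_ord0 : M) != 0.
  rewrite tofrac_eq0; apply/negP => /eqP/(congr1 (mcoeff U_(ord0))).
  by rewrite mcoeffX eqxx mcoeff0 => /eqP; rewrite oner_eq0.
pose h (j : 'I_n) : {fraction M} := tofrac (cone_var j).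
pose h' (j : 'I_n) : {fraction M} := tofrac (cone_var j) / tofrac 'X_ord0.
pose kap : {rmorphism K -> {fraction M}} := FracField.tofrac (R := M) \o @mpolyC n.+1 k \o cF.
have -> : tofrac (cone q) = mmap kap h q.
  pose e1 : {rmorphism {mpoly K[n]} -> {fraction M}} := FracField.tofrac (R := M) \o cone.
  pose e2 : {rmorphism {mpoly K[n]} -> {fraction M}} := mmap kap h.
  apply: (mpoly_rmorph_ext (f := e1) (g := e2)) => [c|i]; rewrite /e1 /e2 /=.
    by rewrite !mmapC.
  by rewrite !mmapX !mmap1U.
rewrite (@mmap_homog_scale _ _ _ kap h h' (tofrac 'X_ord0) d) //; last first.
  by move=> i; rewrite /h /h' mulrC divfK.
rewrite mulrC mulKf ?expf_neq0 //.
have -> : tofrac (line a b q) = mmap cF (fun j => cF (a j) + cF (b j) * tofrac 'X) q.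
  pose e1 : {rmorphism {mpoly K[n]} -> k} := FracField.tofrac (R := {poly K}) \o line a b.
  pose e2 : {rmorphism {mpoly K[n]} -> k} := mmap cF (fun j => cF (a j) + cF (b j) * tofrac 'X).
  apply: (mpoly_rmorph_ext (f := e1) (g := e2)) => [c|i]; rewrite /e1 /e2 /=.
    by rewrite !mmapC.
  by rewrite !mmapX !mmap1U rmorphD /= -mul_polyC rmorphM.
rewrite /mmap; apply: residue_sum => m; apply: residueM; first exact: residueC.
rewrite /mmap1; apply: residue_prod => i; apply: residueX.
rewrite /residue /h' /cone_var rmorphD rmorphM /= mulrDl mulfK //.
rewrite addrAC subrr add0r.
exists ('X_(lift ord0 i)), 'X_ord0; split=> //; first by rewrite -tofrac_eq0.
right; rewrite !mleadXm; apply/ltmcP; first by rewrite !mdeg1.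
exists ord0; first by move=> j; rewrite ltn0.
by rewrite !mnm1E eqxx.
Qed.

End PlaceAtLine.

Lemma horner_frac_hom (K : nzRingType) (R : idomainType) (c : {rmorphism K -> R})
    (p : {poly K}) (A B : R) e :
  B != 0 -> (size p <= e.+1)%N ->
  (map_poly (FracField.tofrac (R := R) \o c) p).[tofrac A / tofrac B] * tofrac B ^+ e
    = tofrac (\sum_(i < e.+1) c p`_i * A ^+ i * B ^+ (e - i)).
Proof.
move=> B0 sp; rewrite (horner_coef_wide _ (_ : _ <= e.+1)%N); last first.
  exact: leq_trans (size_poly _ _) sp.
rewrite mulr_suml rmorph_sum /=; apply: eq_bigr => i _.
have eB : tofrac B ^+ e = tofrac B ^+ i * tofrac B ^+ (e - i).
  by rewrite -exprD subnKC // -ltnS.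
rewrite coef_map /= !rmorphM !rmorphXn /= eB mulrA; congr (_ * _).
by rewrite -mulrA expr_div_n divfK // expf_neq0 // tofrac_eq0.
Qed.

(** * Homogenization and dehomogenization *)

Section Homogenize.
Variables (K : closedFieldType) (n : nat).
Implicit Types (f : {mpoly K[n]}) (d : nat).

Lemma homogenize_homog d f : (tdeg f <= d)%N -> homogenize d f \is d.-homog.
Proof.
move=> le; rewrite /homogenize big_seq; apply: rpred_sum => m mf; apply: rpredZ.
have md : (mdeg m <= d)%N.
  apply: leq_trans le; rewrite /tdeg -ltnS prednK ?msize_mdeg_lt //.
  exact: leq_ltn_trans (msize_mdeg_lt mf).
have hX i e : ('X_i : {mpoly K[n.+1]}) ^+ e \is e.-homog.
  by have := @dhomogMn _ _ mdeg 1 ('X_i : {mpoly K[n.+1]}) e; rewrite mul1n; apply; rewrite dhomogX /= mdeg1.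
suff : 'X_(@ord0 n) ^+ (d - mdeg m) * \prod_(i < n) 'X_(lift ord0 i) ^+ m i
    \is [in K[n.+1], (d - mdeg m + mdeg m).-homog] by rewrite subnK.
apply: dhomogM => //; rewrite mdegE.
elim/big_ind2: _ => [|e1 p1 e2 p2 h1 h2|i _] //; first exact: dhomog1.
exact: dhomogM.
Qed.

(** The point [(l, l X_1, ..., l X_n)] is a rescaled [(1, X_1, ..., X_n)], so a form of degree [d]
    only gains the factor [l^d]. The freedom in [l] is meant for the denominator of [h], which need
    not be homogeneous and might vanish for [l = 1]. *)
Definition dehom_var (l : K) (i : 'I_n.+1) : {mpoly K[n]} :=
  if unlift ord0 i is Some j then l *: 'X_j else l%:MP.

Definition dehom (l : K) : {rmorphism {mpoly K[n.+1]} -> {mpoly K[n]}} :=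
  mmap (@mpolyC n K) (dehom_var l).

Lemma dehom_homogenize l d f : (tdeg f <= d)%N -> dehom l (homogenize d f) = l ^+ d *: f.
Proof.
move=> le; rewrite [in RHS](mpolyE f) scaler_sumr /homogenize rmorph_sum.
apply: eq_big_seq => m mf /=.
have md : (mdeg m <= d)%N.
  apply: leq_trans le; rewrite /tdeg -ltnS prednK ?msize_mdeg_lt //.
  exact: leq_ltn_trans (msize_mdeg_lt mf).
rewrite mmapZ scalerA [l ^+ d * _]mulrC -scalerA -[RHS]mul_mpolyC; congr (_ * _).
rewrite rmorphM rmorphXn rmorph_prod /= mmapX mmap1U /dehom_var unlift_none.
under eq_bigr => i _ do rewrite rmorphXn /= mmapX mmap1U /dehom_var liftK -mul_mpolyC exprMn.
rewrite big_split /= -mpolyXE_id -expr_sum -mdegE mulrA -exprD subnK //.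
by rewrite -mul_mpolyC rmorphXn.
Qed.

Lemma dehom_nonzero (B : {mpoly K[n.+1]}) : [pchar K] =i pred0 -> B != 0 ->
  exists2 l, l != 0 & dehom l B != 0.
Proof.
move=> K0 B0; have X0 : 'X_(@ord0 n) != 0 :> {mpoly K[n.+1]}.
  apply/negP => /eqP/(congr1 (mcoeff U_(ord0))).
  by rewrite mcoeffX eqxx mcoeff0 => /eqP; rewrite oner_eq0.
have [v] := mpoly_nonroot K0 (mulf_neq0 B0 X0).
rewrite mevalM mevalXU mulf_eq0 negb_or => /andP[Bv l0].
exists (v ord0) => //; apply: contra_neq Bv => e.
pose w (j : 'I_n) := v (lift ord0 j) / v ord0.
pose e1 : {rmorphism {mpoly K[n.+1]} -> K} := meval v.
pose e2 : {rmorphism {mpoly K[n.+1]} -> K} := meval w \o dehom (v ord0).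
have -> : meval v B = meval w (dehom (v ord0) B).
  apply: (mpoly_rmorph_ext (f := e1) (g := e2)) => [c|i]; rewrite /e1 /e2 /=.
    by rewrite mmapC !mevalC.
  rewrite mmapX mmap1U mevalXU /dehom_var; case: unliftP => [j|] -> /=.
    by rewrite mevalZ mevalXU /w mulrC divfK.
  by rewrite mevalC.
by rewrite e meval0.
Qed.

End Homogenize.

(** A decomposition of the quotient of the two forms dehomogenizes to one of [f / g]. With
    [h = A / B], this is carried out on the polynomial identity left after clearing denominators,
    for an [l] at which [B] survives. *)
Lemma generic_fibre_irreducible (K : closedFieldType) n (f g : {mpoly K[n]}) d
    (a b : 'I_n.+1 -> K) (rn := line a b (homogenize d f)) (rd := line a b (homogenize d g))
    (cX := FracField.tofrac (R := {mpoly K[n.+1]}) \o @mpolyC n.+1 K)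
    (r := tofrac (homogenize d f) / tofrac (homogenize d g)) :
  [pchar K] =i pred0 -> ~ composite f g -> g != 0 ->
  (tdeg f <= d)%N -> (tdeg g <= d)%N ->
  coprimep rn rd -> rd != 0 -> (1 < maxn (size rn) (size rd))%N ->
  forall A, A %| (map_poly cX rn - r *: map_poly cX rd) ->
    (size A <= 1)%N \/ (maxn (size rn) (size rd) <= size A)%N.
Proof.
move=> K0 ncomp g0 df dg crn rd0 gt1.
have [theta thetaE] := cone_frac a b K0.
have hf := homogenize_homog df; have hg := homogenize_homog dg.
have gs0 : homogenize d g != 0.
  by apply: contra_neq rd0; rewrite /rd => ->; rewrite rmorph0.
have theta_c c : theta (cX c) = tofrac ((tofrac c%:P)%:MP).
  by rewrite /cX /= thetaE /= mmapC.
have Y0 : tofrac ('X_ord0 : {mpoly {fraction {poly K}}[n.+2]}) != 0.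
  rewrite tofrac_eq0; apply/negP => /eqP/(congr1 (mcoeff U_(ord0))).
  by rewrite mcoeffX eqxx mcoeff0 => /eqP; rewrite oner_eq0.
have theta_r : residue (theta r) (tofrac rn / tofrac rd).
  rewrite /r fmorph_div /= !thetaE.
  have cancel_div (F : fieldType) (x y z : F) : z != 0 -> x / y = x / z / (y / z).
    by move=> z0; rewrite invf_div mulrA divfK.
  rewrite (cancel_div _ _ _ _ (expf_neq0 d Y0)).
  apply: residueM; first exact: residue_cone.
  by apply: residueV; [rewrite tofrac_eq0|apply: residue_cone].
have [[h [u [v [cuv suv vh er]]]]|//] := fibre_irreducible theta_c crn rd0 gt1 theta_r.
case: ncomp; have [A [B [B0 eh]]] := fracP h.
have [l l0 Bl] := dehom_nonzero K0 B0.
pose e := maxn (size u) (size v).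
pose H (p : {poly K}) : {mpoly K[n.+1]} := \sum_(i < e.+1) (p`_i)%:MP * A ^+ i * B ^+ (e - i).
pose Al := dehom n l A; pose Bl' := dehom n l B.
pose Hl (p : {poly K}) : {mpoly K[n]} := \sum_(i < e.+1) (p`_i)%:MP * Al ^+ i * Bl' ^+ (e - i).
have dH p : dehom n l (H p) = Hl p.
  rewrite /H rmorph_sum; apply: eq_bigr => i _.
  by rewrite !rmorphM !rmorphXn /= mmapC.
have key : homogenize d f * H v = homogenize d g * H u.
  have su : (size u <= e.+1)%N by apply: leqW; rewrite leq_maxl.
  have sv : (size v <= e.+1)%N by apply: leqW; rewrite leq_maxr.
  apply/eqP; rewrite -tofrac_eq !rmorphM /=.
  rewrite -!(horner_frac_hom (@mpolyC n.+1 K)) // -eh.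
  have := er; rewrite /r => er'.
  rewrite -[tofrac (homogenize d f)](divfK (_ : tofrac (homogenize d g) != 0)) ?tofrac_eq0 //.
  rewrite er' !mulrA; apply/eqP; congr (_ * _).
  by rewrite mulrAC divfK // mulrC.
have {}key : f * Hl v = g * Hl u.
  have := congr1 (dehom n l) key; rewrite !rmorphM !dH !dehom_homogenize //.
  by rewrite -!scalerAl => /(scalerI (expf_neq0 d l0)).
pose h' := tofrac Al / tofrac Bl'.
have ev (p : {poly K}) : (size p <= e.+1)%N ->
    (map_poly (@cstF K n) p).[h'] * tofrac Bl' ^+ e = tofrac (Hl p).
  move=> sp; rewrite -(horner_frac_hom (@mpolyC n K)) //.
have su : (size u <= e.+1)%N by apply: leqW; rewrite leq_maxl.
have sv : (size v <= e.+1)%N by apply: leqW; rewrite leq_maxr.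
have B'0 : tofrac Bl' ^+ e != 0 by rewrite expf_neq0 // tofrac_eq0.
have tg0 : tofrac g != 0 by rewrite tofrac_eq0.
have key' : tofrac f * (map_poly (@cstF K n) v).[h'] = tofrac g * (map_poly (@cstF K n) u).[h'].
  apply: (mulIf B'0); rewrite -!mulrA !ev //.
  by rewrite -!rmorphM key.
(* If [v] vanished at [h'], then by [key'] so would [u], against Bezout for the coprime pair. *)
have v0 : (map_poly (@cstF K n) v).[h'] != 0.
  apply/negP => /eqP ev0; move/eqP: key'; rewrite ev0 mulr0 eq_sym mulf_eq0 (negPf tg0) /= => /eqP eu0.
  have /Bezout_eq1_coprimepP[[p q] /= epq] := cuv.
  pose cst : {rmorphism K -> {fraction {mpoly K[n]}}} := FracField.tofrac (R := {mpoly K[n]}) \o @mpolyC n K.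
  have : (map_poly cst (p * u + q * v)).[h'] = 0.
    have eu' : (map_poly cst u).[h'] = 0 := eu0.
    have ev' : (map_poly cst v).[h'] = 0 := ev0.
    rewrite rmorphD hornerD.
    have hM x y : (map_poly cst (x * y)).[h'] = (map_poly cst x).[h'] * (map_poly cst y).[h'].
      by rewrite rmorphM hornerM.
    by rewrite [X in X + _]hM [X in _ + X]hM eu' ev' !mulr0 addr0.
  by rewrite epq rmorph1 hornerC => /eqP; rewrite oner_eq0.
exists u, v, h'; split=> //.
have div_eq (F : fieldType) (x y z t : F) : y != 0 -> t != 0 -> x * t = y * z -> x / y = z / t.
  by move=> y0 t0 exy; apply/eqP; rewrite eqr_div // exy mulrC.
exact (div_eq _ _ _ _ _ tg0 v0 key').
Qed.

(** * Ruppert's closed forms *)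

Section Bivariate.
Variable k : fieldType.
Implicit Types (p q : {poly {poly k}}).

(** In [{poly {poly k}}] the outer variable is [T] and the inner one is [Y]. *)
Definition derivY p : {poly {poly k}} := map_poly (fun c : {poly k} => c^`()) p.

Lemma coef_derivY p i : (derivY p)`_i = (p`_i)^`().
Proof. by rewrite coef_map_id0 // deriv0. Qed.

Lemma derivYD p q : derivY (p + q) = derivY p + derivY q.
Proof. by apply/polyP=> i; rewrite coefD !coef_derivY coefD derivD. Qed.

Lemma derivYN p : derivY (- p) = - derivY p.
Proof. by apply/polyP=> i; rewrite coefN !coef_derivY coefN derivN. Qed.

Lemma derivYB p q : derivY (p - q) = derivY p - derivY q.
Proof. by rewrite derivYD derivYN. Qed.

Lemma derivYM p q : derivY (p * q) = derivY p * q + p * derivY q.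
Proof.
apply/polyP=> i; rewrite coefD !coefM !coef_derivY coefM.
rewrite (big_morph _ (@derivD _) (@deriv0 _)) -big_split /=.
by apply: eq_bigr => j _; rewrite derivM !coef_derivY.
Qed.

Lemma derivYC (c : {poly k}) : derivY c%:P = c^`()%:P.
Proof. by apply/polyP=> i; rewrite coef_derivY !coefC; case: eqP => // _; rewrite deriv0. Qed.

Lemma derivY_deriv p : derivY p^`() = (derivY p)^`().
Proof. by apply/polyP=> i; rewrite coef_derivY !coef_deriv coef_derivY derivMn. Qed.

Definition spec (u : k) : {rmorphism {poly {poly k}} -> {poly k}} :=
  map_poly (horner_eval u).

Definition ev (t u : k) : {rmorphism {poly {poly k}} -> k} := horner_eval t \o spec u.

Definition Yc (u : k) : {poly {poly k}} := ('X - u%:P)%:P.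

Lemma spec_polyC u (p : {poly k}) : spec u p^:P = p.
Proof.
rewrite /spec /= -map_poly_comp; apply/polyP=> i.
by rewrite coef_map_id0 /= ?hornerC //= horner_evalE hornerC.
Qed.

Lemma spec_Yc u : spec u (Yc u) = 0.
Proof. by rewrite /spec /= map_polyC /= horner_evalE hornerXsubC subrr. Qed.

Lemma ev_Yc t u : ev t u (Yc u) = 0.
Proof. by rewrite /ev /= -[map_poly _ _]/(spec u (Yc u)) spec_Yc horner_evalE horner0. Qed.

Lemma spec_eq0 u p : spec u p = 0 -> exists q, p = Yc u * q.
Proof.
move=> e; apply/rdvd_polyC => i.
have /eqP : (p`_i).[u] = 0.
  by have /(congr1 (fun r : {poly _} => r`_i)) := e; rewrite coef_map /= coef0 horner_evalE.
by move/factor_theorem => [c ec]; exists c; rewrite mulrC.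
Qed.

Lemma Yc_cancel u F p m a : spec u F != 0 -> Yc u ^+ m * p = F * a ->
  exists a', a = Yc u ^+ m * a'.
Proof.
move=> F0; elim: m a p => [|m IH] a p e; first by exists a; rewrite mul1r.
have : spec u (F * a) = 0 by rewrite -e exprS -mulrA rmorphM spec_Yc mul0r.
rewrite rmorphM => /eqP; rewrite mulf_eq0 (negPf F0) /= => /eqP/spec_eq0[a1 ea].
have Y0 : Yc u != 0 by rewrite polyC_eq0 polyXsubC_eq0.
have [|a' ea'] := IH a1 p.
  by apply: (mulfI Y0); rewrite mulrA -exprS e ea mulrCA.
by exists a'; rewrite ea ea' exprS mulrA.
Qed.

(** The letters stand for partial derivatives; the first hypothesis is closedness and the second its
    [T]-derivative. Taking [FT] times the second minus [FTT] times the first eliminates [Z] modulo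
    [F] and leaves [F_T v(W) = W v(F_T)] for [v = F_T d/dY - F_Y d/dT]. *)
Lemma ruppert_identity (R : comNzRingType)
    (F FT FY FTT FTY W WT WY WTY Z ZT ZTT : R) :
  F * (WY - ZT) = FY * W - FT * Z ->
  FT * (WY - ZT) + F * (WTY - ZTT) = (FTY * W + FY * WT) - (FTT * Z + FT * ZT) ->
  FT * (FT * WY - FY * WT)
    = W * (FT * FTY - FY * FTT) + F * (FTT * (WY - ZT) - FT * (WTY - ZTT)).
Proof.
move=> e1 e2; apply/eqP; rewrite -subr_eq0; apply/eqP.
transitivity (FT * ((FT * (WY - ZT) + F * (WTY - ZTT))
     - ((FTY * W + FY * WT) - (FTT * Z + FT * ZT)))
   - FTT * (F * (WY - ZT) - (FY * W - FT * Z))); first by ring.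
by rewrite e1 e2 !subrr !mulr0 subr0.
Qed.

(* With [v] the derivation tangent to the curve [F = 0], closedness makes [W / F_T]
   constant along the branch through [(t, u)]; as [W] vanishes at the point, it lies
   in every ideal [(F, (Y - u)^j)] localized there. *)
Section Branch.
Hypothesis k0 : [pchar k] =i pred0.
Variables (t u : k) (F W Z : {poly {poly k}}).
Hypothesis closed : F * (derivY W - Z^`()) = derivY F * W - F^`() * Z.
Hypothesis Ft : ev t u F = 0.
Hypothesis FTt : ev t u F^`() != 0.
Hypothesis Wt : ev t u W = 0.

Lemma spec_deriv p : spec u p^`() = (spec u p)^`().
Proof. by rewrite /spec /= deriv_map. Qed.

Lemma spec_F_neq0 : spec u F != 0.
Proof.
apply: contra_neq FTt => e.
by rewrite /ev /= -[map_poly _ _]/(spec u F^`()) spec_deriv e deriv0 horner_evalE horner0.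
Qed.

(** Since [F_T] does not vanish at the point, [F] and [Y - u] generate the maximal ideal of the
    local ring there; [s] is a denominator allowed by the localization. *)
Lemma branch_step B : ev t u B = 0 ->
  exists s w B1, ev t u s != 0 /\ s * B = w * F + B1 * Yc u.
Proof.
move=> Bt; have /eqP/factor_theorem[B' eB] : (spec u B).[t] = 0 := Bt.
have /eqP/factor_theorem[F' eF] : (spec u F).[t] = 0 := Ft.
have F't : F'.[t] != 0.
  have : (spec u F)^`().[t] != 0 by rewrite -spec_deriv.
  by rewrite eF derivM derivXsubC mulr1 hornerD hornerM hornerXsubC subrr mulr0 add0r.
have [|B1 eB1] := @spec_eq0 u (F'^:P * B - B'^:P * F).
  by rewrite rmorphB !rmorphM !spec_polyC eB eF mulrA mulrA [F' * _]mulrC subrr.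
exists F'^:P, B'^:P, B1; split.
  by rewrite /ev /= -[map_poly _ _]/(spec u F'^:P) spec_polyC horner_evalE.
by rewrite [B1 * _]mulrC -eB1 addrC subrK.
Qed.

Let v p := F^`() * derivY p - derivY F * p^`().

Lemma vM p q : v (p * q) = v p * q + p * v q.
Proof. by rewrite /v derivYM derivM; ring. Qed.

Lemma vD p q : v (p + q) = v p + v q.
Proof. by rewrite /v derivYD derivD; ring. Qed.

Lemma vF : v F = 0. Proof. by rewrite /v mulrC subrr. Qed.

Lemma vYc : v (Yc u) = F^`().
Proof. by rewrite /v /Yc derivC mulr0 subr0 derivYC derivXsubC mulr1. Qed.

Lemma vYcX j : v (Yc u ^+ j.+1) = j.+1%:R * Yc u ^+ j * F^`().
Proof.
elim: j => [|j IH]; first by rewrite expr1 vYc mulr1 mul1r.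
by rewrite exprS vM vYc IH -[in RHS]addn1 natrD exprS; ring.
Qed.

Lemma vW : exists Q, F^`() * v W = W * v F^`() + F * Q.
Proof.
have := congr1 (fun p : {poly _} => p^`()) closed.
rewrite !(derivM, derivB) => e2.
eexists; rewrite /v; apply: (ruppert_identity closed).
by rewrite derivY_deriv; exact: e2.
Qed.

Lemma branch_vanish j : exists s a b, ev t u s != 0 /\ s * W = a * F + b * Yc u ^+ j.
Proof.
elim: j => [|j [s [a [b [st e]]]]].
  by exists 1, 0, W; rewrite rmorph1 oner_neq0 mul0r add0r mulr1 mul1r.
suff bt : ev t u b = 0.
  have [s' [w [b1 [s't e']]]] := branch_step bt.
  exists (s' * s), (s' * a + w * Yc u ^+ j), b1; split.
    by rewrite rmorphM mulf_neq0.
  rewrite -mulrA e mulrDr [s' * (b * _)]mulrA e' exprS.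
  by ring.
case: j e => [|j] e.
  have := congr1 (ev t u) e; rewrite rmorphM Wt mulr0 rmorphD rmorphM Ft mulr0 add0r.
  by rewrite expr0 mulr1 => <-.
(* Apply [v] to [s W = a F + b (Y - u)^(j+1)]. As [v(F) = 0] and [v(Y - u) = F_T], only
   [(j+1) s F_T^2 b (Y - u)^j] survives modulo [F] and [(Y - u)^(j+1)]; cancelling [(Y - u)^j]
   shows, in characteristic 0, that [b] vanishes at the point. *)
have [Q eQ] := vW.
have ev1 := congr1 v e; rewrite vM vD !vM vF vYcX mulr0 addr0 in ev1.
pose c := F^`() * v s + s * v F^`().
have key : Yc u ^+ j * (j.+1%:R * s * F^`() ^+ 2 * b - Yc u * (c * b - s * F^`() * v b))
   = F * (c * a + s ^+ 2 * Q - s * F^`() * v a).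
  apply/eqP; rewrite -subr_eq0; apply/eqP.
  transitivity (s * F^`() * ((v a * F + (v b * Yc u ^+ j.+1 + b * (j.+1%:R * Yc u ^+ j * F^`())))
       - (v s * W + s * v W)) + c * (s * W - (a * F + b * Yc u ^+ j.+1))
       + s ^+ 2 * (F^`() * v W - (W * v F^`() + F * Q))).
    by rewrite /c (exprS (Yc u)); ring.
  by rewrite ev1 e eQ !subrr !mulr0 !addr0.
have [a' ea'] := Yc_cancel spec_F_neq0 key.
have Y0 : Yc u ^+ j != 0 by rewrite expf_neq0 // polyC_eq0 polyXsubC_eq0.
rewrite ea' [in RHS]mulrCA in key; have := congr1 (ev t u) (mulfI Y0 key).
rewrite [in RHS]rmorphM Ft mul0r rmorphB [X in _ - X]rmorphM ev_Yc mul0r subr0.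
rewrite !rmorphM rmorph_nat => /eqP; rewrite !mulf_eq0 (natr_eq0_char0 k0) /=.
by rewrite (negPf st) !(negPf FTt) /= => /eqP.
Qed.

End Branch.

(** The element [c] of the ideal [(F, W)] plays the role of a resultant: its order [m] at [u] bounds
    the contact of [W] with the branch, and [j = m + 1] exceeds it. *)
Lemma ideal_branch_absurd t u F (c : {poly k}) W p q :
  spec u F != 0 -> ev t u F = 0 -> c != 0 -> p * F + q * W = c%:P ->
  (forall j, exists s a b, ev t u s != 0 /\ s * W = a * F + b * Yc u ^+ j) -> False.
Proof.
move=> F0 Ft c0 e H.
have [m [c' c'u ec]] := multiplicity_XsubC c u.
rewrite c0 /= in c'u.
have [s' [a [b [st es]]]] := H m.+1.
have key : Yc u ^+ m * (s' * c'%:P - Yc u * (q * b)) = F * (s' * p + q * a).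
  have eY : c%:P = c'%:P * Yc u ^+ m by rewrite ec polyCM rmorphXn.
  apply/eqP; rewrite -subr_eq0; apply/eqP.
  transitivity (s' * (c'%:P * Yc u ^+ m - c%:P) - s' * (p * F + q * W - c%:P)
      + q * (s' * W - (a * F + b * Yc u ^+ m.+1))).
    by rewrite (exprS (Yc u)); ring.
  by rewrite -eY e es !subrr mulr0 addr0.
have [a' ea'] := Yc_cancel F0 key.
have Y0 : Yc u ^+ m != 0 by rewrite expf_neq0 // polyC_eq0 polyXsubC_eq0.
rewrite ea' [in RHS]mulrCA in key; have := congr1 (ev t u) (mulfI Y0 key).
rewrite [in RHS]rmorphM Ft mul0r rmorphB [X in _ - X]rmorphM ev_Yc mul0r subr0.
rewrite rmorphM => /eqP; rewrite mulf_eq0 (negPf st) orFb.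
have -> : ev t u c'%:P = c'.[u].
  by rewrite /ev /= map_polyC /= horner_evalE hornerC horner_evalE.
by rewrite -rootE (negPf c'u).
Qed.

Section KernelZero.
Hypothesis k0 : [pchar k] =i pred0.
Variables (t u u0 : k) (d : nat) (l : k) (F : {poly {poly k}}).
Hypothesis sF : size F = d.+1.
Hypothesis d0 : (0 < d)%N.
Hypothesis lF : lead_coef F = l%:P.
Hypothesis l0 : l != 0.
Hypothesis irrF : forall A, A %| spec u0 F -> (size A <= 1)%N \/ (d.+1 <= size A)%N.
Hypothesis Ft : ev t u F = 0.
Hypothesis FTt : ev t u F^`() != 0.

Lemma unit_lead_spec (A : {poly {poly k}}) : lead_coef A \is a GRing.unit ->
  size (spec u0 A) = size A.
Proof.
rewrite poly_unitE => /andP[/eqP s1 uc]; apply: size_map_poly_id0.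
change ((lead_coef A).[u0] != 0); rewrite (size1_polyC (eq_leq s1)) hornerC.
by apply: contraTneq uc => ->; rewrite unitr0.
Qed.

(** The leading coefficient in [T] is a nonzero constant, so those of the factors are units and no
    degree is lost at [Y = u0], where the factorization is trivial. *)
Lemma F_prime : prime_elt F.
Proof.
have F0 : F != 0 by rewrite -size_poly_eq0 sF.
apply: irred_prime.
  exact: poly_factorial (poly_factorial (@field_factorial k)).
split=> //.
  by rewrite poly_unitE sF; case: (d) d0.
move=> A B eF.
have luF : lead_coef F \is a GRing.unit by rewrite lF polyC_unit unitfE.
have [lA lB] : lead_coef A \is a GRing.unit /\ lead_coef B \is a GRing.unit.
  by move: luF; rewrite eF lead_coefM unitrM => /andP.
have unit1 (C : {poly {poly k}}) : lead_coef C \is a GRing.unit -> (size C <= 1)%N -> C \is a GRing.unit.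
  move=> uC /size1_polyC eC; move: uC; rewrite {1}eC lead_coefC => uC.
  by rewrite eC polyC_unit.
have : spec u0 A %| spec u0 F by rewrite eF rmorphM dvdp_mulr.
move/irrF; rewrite unit_lead_spec // => -[sA|sA]; first by left; apply: unit1.
right; apply: unit1 => //.
have := sF; rewrite eF size_mul; last first.
- by apply: contra_neq F0 => e; rewrite eF e mulr0.
- by apply: contra_neq F0 => e; rewrite eF e mul0r.
move=> e; have A0 : (0 < size A)%N by apply: leq_trans sA.
move: e sA A0; set x := size A; set y := size B; move: x y; clear; lia.
Qed.

Lemma F_ndvd (W : {poly {poly k}}) : (size W <= d)%N -> rdvd F W -> W = 0.
Proof.
move=> sW [q e]; apply: NNPP => /eqP W0.
have F0 : F != 0 by rewrite -size_poly_eq0 sF.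
have q0 : q != 0 by apply: contra_neq W0; rewrite e => ->; rewrite mulr0.
move: sW; rewrite e size_mul // sF addSn /= leqNgt -{1}[d]addn0 ltn_add2l.
by rewrite size_poly_gt0 q0.
Qed.

Lemma F_coprime (W : {poly {poly k}}) : (size W <= d)%N -> W != 0 -> coprimep F W.
Proof.
move=> sW W0; apply: prime_coprimep; first exact: F_prime.
  by rewrite sF ltnS.
by move/(F_ndvd sW)/eqP; apply/negP.
Qed.

(** The residue is [c0], the value of [U / F_T] at the smooth point. After subtracting [c0 dF / F],
    the first numerator [W] vanishes to all orders along the branch, which is impossible for a
    nonzero polynomial of degree less than [d] in [T]; then [F] divides [F_T Z], so [Z = 0]. What
    remains is [c0 dF / F], and its coefficient of [T^(d-1)] is [c0 d l], so the corner condition on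
    [U] kills [c0]. *)
Lemma ruppert_kernel_zero (U V : {poly {poly k}}) :
  (size U <= d)%N -> (size V <= d)%N -> U`_d.-1`_0 = 0 ->
  F * (derivY U - V^`()) = derivY F * U - F^`() * V ->
  U = 0 /\ V = 0.
Proof.
move=> sU sV U00 e.
have F0 : F != 0 by rewrite -size_poly_eq0 sF.
pose c0 := ev t u U / ev t u F^`().
pose C : {poly {poly k}} := c0%:P%:P.
have sFT : (size F^`() <= d)%N by rewrite -ltnS -sF lt_size_deriv.
have sFY : (size (derivY F) <= d)%N.
  apply/leq_sizeP => i le; rewrite coef_derivY.
  move: le; rewrite leq_eqVlt => /orP[/eqP <-|lt].
    have := lF; rewrite /lead_coef sF /= => ->; by rewrite derivC.
  by rewrite nth_default ?deriv0 // sF.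
have sCm (p : {poly {poly k}}) : (size p <= d)%N -> (size (C * p)%R <= d)%N.
  by move=> sp; rewrite mul_polyC; apply: leq_trans (size_scale_leq _ _) sp.
have sB (p q : {poly {poly k}}) : (size p <= d)%N -> (size q <= d)%N -> (size (p - q)%R <= d)%N.
  by move=> sp sq; apply: leq_trans (size_polyD _ _) _; rewrite size_polyN geq_max sp.
pose W := U - C * F^`(); pose Z := V - C * derivY F.
have dYC : derivY C = 0 by rewrite derivYC derivC.
have dTC : C^`() = 0 by rewrite derivC.
have closed : F * (derivY W - Z^`()) = derivY F * W - F^`() * Z.
  rewrite /W /Z derivYB derivB derivYM derivM dYC dTC !mul0r !add0r derivY_deriv.
  apply/eqP; rewrite -subr_eq0; apply/eqP.
  transitivity (F * (derivY U - V^`()) - (derivY F * U - F^`() * V)); first by ring.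
  by rewrite e subrr.
have Wt : ev t u W = 0.
  rewrite rmorphB rmorphM /C /c0.
  have -> : ev t u (ev t u U / ev t u F^`())%:P%:P = ev t u U / ev t u F^`().
    by rewrite /ev /= map_polyC /= horner_evalE hornerC horner_evalE hornerC.
  by rewrite divfK ?subrr.
have W0 : W = 0.
  apply: NNPP => /eqP W0.
  have sW : (size W <= d)%N by apply: sB => //; apply: sCm.
  have /Bezout_coprimepP[[p q] /= epq] := F_coprime sW W0.
  have s1 : size (p * F + q * W) = 1%N by rewrite (eqp_size epq) size_poly1.
  have e1 := size1_polyC (eq_leq s1).
  apply: (ideal_branch_absurd (spec_F_neq0 FTt) Ft _ e1).
    by rewrite -polyC_eq0 -e1 -size_poly_eq0 s1.
  exact: (branch_vanish k0 closed Ft FTt Wt).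
have FZ : rdvd F (F^`() * Z).
  exists (Z^`()); move: closed; rewrite W0 mulr0 sub0r.
  have -> : derivY (0 : {poly {poly k}}) = 0 by rewrite -[0]polyC0 derivYC deriv0.
  by rewrite sub0r mulrN => /oppr_inj ->.
have FT0 : F^`() != 0 by apply: contraNneq FTt => ->; rewrite rmorph0.
have Z0 : Z = 0.
  have [_ _ /(_ _ _ FZ)[/(F_ndvd sFT) FT|dZ]] := F_prime.
    by rewrite FT eqxx in FT0.
  by apply: F_ndvd dZ; apply: sB => //; apply: sCm.
have eU : U = C * F^`() by apply/eqP; rewrite -subr_eq0 -/W W0.
have eV : V = C * derivY F by apply/eqP; rewrite -subr_eq0 -/Z Z0.
have c00 : c0 = 0.
  move: U00; rewrite eU coefCM coef_deriv prednK // coefCM.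
  have := lF; rewrite /lead_coef sF /= => ->.
  rewrite coefMn coefC /= -mulr_natr => /eqP.
  rewrite [c0 * _ == 0]mulf_eq0 => /orP[/eqP //|].
  by rewrite mulf_eq0 (negPf l0) (natr_eq0_char0 k0) eqn0Ngt d0.
by rewrite eU eV /C c00 !mul0r.
Qed.

End KernelZero.
End Bivariate.

(** * Independence of eigenvectors in a pencil of operators *)

Lemma independent_card_le (k : fieldType) (T : finType) D (phi : T -> 'rV[k]_D) :
  (forall x : T -> k, \sum_t x t *: phi t = 0 -> forall t, x t = 0) -> (#|T| <= D)%N.
Proof.
move=> H; pose M := \matrix_(i < #|T|) phi (enum_val i).
have /eqP <- : row_free M; last exact: rank_leq_col.
apply: inj_row_free => v vM; apply/rowP => i; rewrite mxE.
have -> : v 0 i = (fun t => v 0 (enum_rank t)) (enum_val i) by rewrite enum_valK.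
apply: (H (fun t => v 0 (enum_rank t))); apply: etrans vM; rewrite mulmx_sum_row.
rewrite (reindex (@enum_val T T)) /=; last by apply: onW_bij; apply: enum_val_bij.
by apply: eq_bigr => j _; rewrite enum_valK rowK.
Qed.

Section EigenIndependent.
Variables (k : fieldType) (V W : lmodType {poly k}) (A B : V -> W) (S : V -> Prop).
Hypothesis A_lin : forall c v w, A (c%:P *: v + w) = c%:P *: A v + A w.
Hypothesis B_lin : forall c v w, B (c%:P *: v + w) = c%:P *: B v + B w.
Hypothesis S0 : S 0.
Hypothesis S_lin : forall (c : k) v w, S v -> S w -> S (c%:P *: v + w).
Hypothesis Binj : forall v, S v -> B v = 0 -> v = 0.

Lemma sum_lin (f : V -> W) (I : Type) (s : seq I) (c : I -> k) (v : I -> V) :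
  (forall c v w, f (c%:P *: v + w) = c%:P *: f v + f w) ->
  f (\sum_(i <- s) (c i)%:P *: v i) = \sum_(i <- s) (c i)%:P *: f (v i).
Proof.
move=> fl; have f0 : f 0 = 0.
  have := fl 1 0 0; rewrite polyC1 !scale1r addr0 => /eqP.
  by rewrite -subr_eq0 opprD addNKr oppr_eq0 => /eqP.
elim: s => [|i s IH]; first by rewrite !big_nil.
by rewrite !big_cons fl IH.
Qed.

Lemma sum_S (I : Type) (s : seq I) (c : I -> k) (v : I -> V) :
  (forall i, S (v i)) -> S (\sum_(i <- s) (c i)%:P *: v i).
Proof.
move=> Sv; elim: s => [|i s IH]; first by rewrite big_nil.
by rewrite big_cons; apply: S_lin.
Qed.

(** Applying [A - e_j B] to the relation kills the [j]-th vector and multiplies the others by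
    [e_i - e_j]; injectivity of [B] on [S] then removes the operator. Scalars appear as constants
    [c%:P] because pairs of numerators form a module over [{poly k}]. *)
Lemma eigen_independent (I : eqType) (s : seq I) (e : I -> k) (v : I -> V) :
  uniq s -> {in s &, injective e} -> (forall i, S (v i)) ->
  (forall i, i \in s -> A (v i) = (e i)%:P *: B (v i)) ->
  \sum_(i <- s) v i = 0 -> forall i, i \in s -> v i = 0.
Proof.
have cancelC (c : k) (w : V) : c != 0 -> c%:P *: w = 0 -> w = 0.
  move=> c0 /(congr1 (fun w => (c^-1)%:P *: w)).
  by rewrite scaler0 scalerA -polyCM mulVf // polyC1 scale1r.
elim: s v => [|j s IH] v //= /andP[js us] einj Sv ev sum0.
have B0 : B (\sum_(i <- s) (e i - e j)%:P *: v i) = 0.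
  have lin1 : \sum_(i <- j :: s) (1 : k)%:P *: v i = 0.
    by under eq_bigr do rewrite polyC1 scale1r.
  have zero (f : V -> W) : (forall c v w, f (c%:P *: v + w) = c%:P *: f v + f w) -> f 0 = 0.
    by move=> fl; have := sum_lin [::] (fun _ : I => 1) v fl; rewrite !big_nil.
  have sA := sum_lin (j :: s) (fun _ => 1) v A_lin.
  have sB := sum_lin (j :: s) (fun _ => 1) v B_lin.
  rewrite lin1 zero // in sA; rewrite lin1 zero // in sB.
  have sA' : \sum_(i <- j :: s) (e i)%:P *: B (v i) = 0.
    by rewrite [RHS]sA; apply: eq_big_seq => i /ev ->; rewrite polyC1 scale1r.
  rewrite sum_lin //.
  under eq_bigr do rewrite polyCB scalerBl.
  rewrite big_split /= sumrN -scaler_sumr.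
  have -> : \sum_(i <- s) (e i)%:P *: B (v i) = - ((e j)%:P *: B (v j)).
    by apply/eqP; rewrite -addr_eq0 addrC; apply/eqP; apply: etrans sA'; rewrite big_cons.
  have -> : \sum_(i <- s) B (v i) = - B (v j).
    apply/eqP; rewrite -addr_eq0 addrC; apply/eqP; apply: etrans (esym sB).
    rewrite big_cons polyC1 scale1r; congr (_ + _).
    by under [RHS]eq_bigr do rewrite scale1r.
  by rewrite scalerN opprK addNr.
have vs i : i \in s -> v i = 0.
  move=> is_; have ij : e i - e j != 0.
    rewrite subr_eq0; apply: contraNneq js => /einj <- //; first by rewrite in_cons is_ orbT.
    by rewrite mem_head.
  apply: (cancelC _ _ ij); apply: (IH (fun i => (e i - e j)%:P *: v i)) => //.
  - by move=> x y xs ys; apply: einj; rewrite in_cons ?xs ?ys orbT.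
  - by move=> x; rewrite -[_ *: _]addr0; apply: S_lin.
  - move=> x xs; rewrite -[_ *: v x]addr0 A_lin B_lin.
    rewrite ev ?in_cons ?xs ?orbT //.
    have := sum_lin [::] (fun _ : I => 1) v A_lin; rewrite !big_nil => ->.
    have := sum_lin [::] (fun _ : I => 1) v B_lin; rewrite !big_nil => ->.
    by rewrite !addr0 !scalerA mulrC.
  - by apply: Binj => //; apply: sum_S.
move=> i; rewrite in_cons => /orP[/eqP->|/vs//].
by move: sum0; rewrite big_cons big_seq big1 ?addr0.
Qed.

Variables (D : nat) (coord : V -> 'rV[k]_D).
Hypothesis coord_lin : forall c v w, coord (c%:P *: v + w) = c *: coord v + coord w.
Hypothesis coord_inj : forall v, S v -> coord v = 0 -> v = 0.

Lemma coord_sum (I : Type) (s : seq I) (c : I -> k) (v : I -> V) :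
  coord (\sum_(i <- s) (c i)%:P *: v i) = \sum_(i <- s) c i *: coord (v i).
Proof.
have c0 : coord 0 = 0.
  have := coord_lin 1 0 0; rewrite polyC1 !scale1r addr0 => /eqP.
  by rewrite -subr_eq0 opprD addNKr oppr_eq0 => /eqP.
elim: s => [|i s IH]; first by rewrite !big_nil.
by rewrite !big_cons coord_lin IH.
Qed.

Lemma eigen_card_le (I : eqType) (s : seq I) (e : I -> k) (N : I -> nat)
    (v : forall i, 'I_(N i) -> V) :
  uniq s -> {in s &, injective e} -> (forall i j, S (@v i j)) ->
  (forall i j, i \in s -> A (@v i j) = (e i)%:P *: B (@v i j)) ->
  (forall i (x : 'I_(N i) -> k), i \in s -> \sum_j (x j)%:P *: @v i j = 0 -> forall j, x j = 0) ->
  (\sum_(i <- s) N i <= D)%N.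
Proof.
move=> us einj Sv ev ind.
have [->|[i0 i0s]] : s = [::] \/ exists i0, i0 \in s.
- by case: (s) => [|i0 t]; [left|right; exists i0; rewrite mem_head].
- by rewrite big_nil.
pose T := {i : 'I_(size s) & 'I_(N (nth i0 s i))}.
have <- : #|{: T}| = \sum_(i <- s) N i.
  rewrite card_tagged sumnE big_map big_enum /= (big_nth i0) big_mkord.
  by apply: eq_bigr => i _; rewrite card_ord.
apply: (@independent_card_le k _ D (fun t : T => coord (v (nth i0 s (tag t)) (tagged t)))).
move=> x; rewrite -(coord_sum (index_enum _)) => /coord_inj sum0.
pose w (i : 'I_(size s)) := \sum_(j < N (nth i0 s i)) (x (Tagged _ j))%:P *: v (nth i0 s i) j.
have sw : \sum_(i <- enum 'I_(size s)) w i = 0.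
  rewrite -[RHS]sum0; last by apply: sum_S.
  rewrite big_enum /= /w sig_big_dep /=; apply: eq_bigr => -[i j] _ //=.
have w0 i : w i = 0.
  apply: (@eigen_independent _ (enum 'I_(size s)) (fun i => e (nth i0 s i)) w _ _ _ _ sw).
  - exact: enum_uniq.
  - move=> a b _ _ /einj; rewrite !mem_nth // => /(_ isT isT) /eqP.
    by rewrite nth_uniq // => /eqP; apply: val_inj.
  - by move=> a; apply: sum_S.
  - move=> a _; rewrite /w !sum_lin // scaler_sumr; apply: eq_bigr => j _.
    by rewrite ev ?mem_nth // !scalerA mulrC.
  - by rewrite mem_enum.
case=> i j; apply: (ind _ (fun j => x (Tagged _ j)) _ (w0 i)).
exact: mem_nth.
Qed.

End EigenIndependent.

(** * Total degree, and the space of numerators *)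

Section TotalDegree.
Variable k : fieldType.
Implicit Types (p q U V : {poly {poly k}}) (m n d : nat).
Local Notation Y := ('X%:P : {poly {poly k}}).

Definition tdlt n p := forall i j, (n <= i + j)%N -> p`_i`_j = 0.

Lemma tdlt0 n : tdlt n 0. Proof. by move=> i j _; rewrite !coef0. Qed.

Lemma tdltD n p q : tdlt n p -> tdlt n q -> tdlt n (p + q).
Proof. by move=> tp tq i j ij; rewrite !coefD tp ?tq ?addr0. Qed.

Lemma tdltN n p : tdlt n p -> tdlt n (- p).
Proof. by move=> tp i j ij; rewrite !coefN tp ?oppr0. Qed.

Lemma tdltB n p q : tdlt n p -> tdlt n q -> tdlt n (p - q).
Proof. by move=> tp tq; apply: tdltD => //; apply: tdltN. Qed.

Lemma tdltZ n (c : k) p : tdlt n p -> tdlt n (c%:P *: p).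
Proof. by move=> tp i j ij; rewrite coefZ coefCM tp ?mulr0. Qed.

Lemma tdlt_le m n p : (m <= n)%N -> tdlt m p -> tdlt n p.
Proof. by move=> mn tp i j ij; apply: tp; apply: leq_trans mn ij. Qed.

Lemma tdltM m n p q : tdlt m p -> tdlt n q -> tdlt (m + n).-1 (p * q).
Proof.
move=> tp tq i j ij; rewrite coefM coef_sum big1 // => a _.
rewrite coefM big1 // => b _.
have [le|lt] := leqP m (a + b); first by rewrite tp ?mul0r.
rewrite tq ?mulr0 //; have := ltn_ord a; have := ltn_ord b.
by move: ij lt; move: (nat_of_ord a) (nat_of_ord b) => x y; lia.
Qed.

Lemma tdltM1 m n p q : tdlt m.+1 p -> tdlt n.+1 q -> tdlt (m + n).+1 (p * q).
Proof. by move=> tp tq; have := tdltM tp tq; rewrite addSn addnS. Qed.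

Lemma tdltC (c : k) : tdlt 1 c%:P%:P.
Proof.
move=> i j ij; rewrite coefC; case: i ij => [|i] ij /=; last by rewrite coef0.
by rewrite coefC; case: j ij.
Qed.

Lemma tdlt_deriv n p : tdlt n p -> tdlt n.-1 p^`().
Proof.
by move=> tp i j ij; rewrite coef_deriv coefMn tp ?mul0rn //; move: ij; lia.
Qed.

Lemma tdlt_derivY n p : tdlt n p -> tdlt n.-1 (derivY p).
Proof.
by move=> tp i j ij; rewrite coef_derivY coef_deriv tp ?mul0rn //; move: ij; lia.
Qed.

Lemma coef_XM p i j : ('X * p)`_i`_j = if i is i'.+1 then p`_i'`_j else 0.
Proof. by rewrite mulrC coefMX; case: i => //=; rewrite coef0. Qed.

Lemma coef_YM p i j : (Y * p)`_i`_j = if j is j'.+1 then p`_i`_j' else 0.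
Proof. by rewrite coefCM mulrC coefMX; case: j. Qed.

(** The Euler field multiplies the part of degree [n] by [n], so the top parts cancel. *)
Lemma tdlt_euler n p : tdlt n.+1 p ->
  tdlt n ('X * p^`() + Y * derivY p - n%:R * p).
Proof.
move=> tp i j ij.
have -> : ('X * p^`() + Y * derivY p - n%:R * p)`_i`_j = p`_i`_j *+ (i + j) - p`_i`_j *+ n.
  rewrite -mulr_natl mulr_natl coefB coefB !coefD coef_XM coef_YM -[n%:R * p]/(n%:R * p).
  rewrite mulr_natl !coefMn; congr (_ - _).
  rewrite mulrnDr; congr (_ + _).
    by case: i ij => [|i] ij; rewrite ?mulr0n // coef_deriv coefMn.
  by case: j ij => [|j] ij; rewrite ?mulr0n // coef_derivY coef_deriv.
have [->|ne] := eqVneq (i + j)%N n; first by rewrite subrr.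
by rewrite tp ?mul0rn ?subrr // ltn_neqAle eq_sym ne.
Qed.

(* The last bound makes the 1-form [(U dT + V dY) / F], with [deg F = d], regular at
   infinity. *)
Definition admissible d (w : {poly {poly k}} * {poly {poly k}}) :=
  [/\ tdlt d w.1, tdlt d w.2 & tdlt d ('X * w.1 + Y * w.2)].

Lemma admissible0 d : admissible d 0.
Proof. by split; rewrite /= ?mulr0 ?addr0; apply: tdlt0. Qed.

Lemma admissible_lin d (c : k) v w :
  admissible d v -> admissible d w -> admissible d (c%:P *: v + w).
Proof.
move=> [v1 v2 v3] [w1 w2 w3]; split=> /=.
- by apply: tdltD => //; apply: tdltZ.
- by apply: tdltD => //; apply: tdltZ.
have -> : 'X * (c%:P *: v.1 + w.1) + Y * (c%:P *: v.2 + w.2)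
    = c%:P *: ('X * v.1 + Y * v.2) + ('X * w.1 + Y * w.2).
  by rewrite -!mul_polyC; ring.
by apply: tdltD => //; apply: tdltZ.
Qed.

Lemma admissible_corner d w : admissible d.+1 w -> w.1`_d`_0 = 0.
Proof.
case=> _ _ /(_ d.+1 0%N); rewrite addn0 leqnn => /(_ isT).
by rewrite !coefD coef_XM coef_YM addr0.
Qed.

(* [closed_defect F (U, V) = 0] says that the 1-form [(U dT + V dY) / F] is closed. *)
Definition closed_defect (F : {poly {poly k}}) (w : {poly {poly k}} * {poly {poly k}}) :=
  F * (derivY w.1 - w.2^`()) - (derivY F * w.1 - F^`() * w.2).

Lemma closed_defect_lin F (c : k) v w :
  closed_defect F (c%:P *: v + w) = c%:P *: closed_defect F v + closed_defect F w.
Proof.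
rewrite /closed_defect /= -!mul_polyC derivYD derivYM derivYC derivD derivM !derivC.
by rewrite polyC0 !mul0r !add0r; ring.
Qed.

Lemma closed_defect_pencil F1 F2 (c1 c2 : k) w :
  closed_defect (c1%:P%:P * F1 + c2%:P%:P * F2) w
    = c1%:P%:P * closed_defect F1 w + c2%:P%:P * closed_defect F2 w.
Proof.
rewrite /closed_defect derivYD !derivYM !derivYC !derivD !derivM !derivC.
by rewrite !polyC0 !mul0r !add0r; ring.
Qed.

Section Coordinates.
Variable e : nat.
Definition corner : 'I_e.+1 * 'I_e.+1 := (ord_max, ord0).
Definition coord_index := {x : 'I_e.+1 * 'I_e.+1 | x != corner}.

Lemma card_coord_index : #|{: coord_index}| = (e.+1 ^ 2 - 1)%N.
Proof.
rewrite card_sig -(eq_card (A := predC1 corner)) //.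
by rewrite cardC1 card_prod card_ord subn1 mulnn.
Qed.

(* The coefficients of [U] fill the triangle [i + j <= e] and those of [V] the
   complementary triangle; the top coefficients of [V] are determined by those of [U]. *)
Definition coordf (w : {poly {poly k}} * {poly {poly k}}) (x : 'I_e.+1 * 'I_e.+1) : k :=
  if (x.1 + x.2 <= e)%N then w.1`_x.1`_x.2 else w.2`_(e - x.1)`_(e - x.2).

Definition coord w : 'rV[k]_#|{: coord_index}| :=
  \row_i coordf w (val (enum_val i)).

Lemma coord_lin (c : k) v w : coord (c%:P *: v + w) = c *: coord v + coord w.
Proof.
apply/rowP => i; rewrite !mxE /coordf /=; case: ifP => _.
  by rewrite !coefD coefZ coefCM.
by rewrite !coefD coefZ coefCM.
Qed.

Lemma coord_inj w : admissible e.+1 w -> coord w = 0 -> w = 0.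
Proof.
move=> aw cw; have [t1 t2 t3] := aw.
have cf i j (hi : (i < e.+1)%N) (hj : (j < e.+1)%N) :
    ~~ ((i == e) && (j == 0)%N) -> coordf w (Ordinal hi, Ordinal hj) = 0.
  move=> h; have xc : (Ordinal hi, Ordinal hj) != corner.
    by apply: contra h => /eqP[-> ->]; rewrite !eqxx.
  pose x : coord_index := exist (fun x : 'I_e.+1 * 'I_e.+1 => x != corner) _ xc.
  have /rowP/(_ (enum_rank x)) := cw.
  by rewrite !mxE enum_rankK.
have u0 i j : w.1`_i`_j = 0.
  have [le|lt] := leqP e.+1 (i + j); first exact: t1.
  have [/andP[/eqP -> /eqP ->]|nc] := boolP ((i == e) && (j == 0)%N).
    exact: admissible_corner.
  have hi : (i < e.+1)%N by apply: leq_trans lt; rewrite ltnS leq_addr.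
  have hj : (j < e.+1)%N by apply: leq_trans lt; rewrite ltnS leq_addl.
  by have := cf i j hi hj nc; rewrite /coordf /= -ltnS lt.
have v0 i j : w.2`_i`_j = 0.
  have [le|lt] := leqP e.+1 (i + j); first exact: t2.
  have [eq|ne] := eqVneq (i + j)%N e.
    have := t3 i j.+1; rewrite addnS eq leqnn => /(_ isT).
    rewrite !coefD coef_XM coef_YM => /eqP; case: i {lt eq} => [|i]; first by rewrite add0r => /eqP.
    by rewrite u0 add0r => /eqP.
  have hi : (e - i < e.+1)%N by rewrite ltnS leq_subr.
  have hj : (e - j < e.+1)%N by rewrite ltnS leq_subr.
  have := cf _ _ hi hj; rewrite /coordf /= !subKn; [|by lia|by lia].
  by rewrite ifF; [apply; lia|apply/negbTE; lia].
case: w u0 v0 {aw cw t1 t2 t3 cf} => U V /= u0 v0.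
congr pair; apply/polyP => i; apply/polyP => j; by rewrite (u0, v0) !coef0.
Qed.

End Coordinates.
End TotalDegree.

(** * Closed forms attached to a factorization *)

Section LogDerivative.
Variables (A : comNzRingType) (D : A -> A).
Hypothesis DM : forall x y, D (x * y) = D x * y + x * D y.

Lemma der1 : D 1 = 0.
Proof.
have /eqP := DM 1 1; rewrite !mulr1 mul1r -subr_eq0 opprD addNKr oppr_eq0.
by move/eqP.
Qed.

Lemma derX x f : x * D (x ^+ f) = f%:R * x ^+ f * D x.
Proof.
elim: f => [|f IH]; first by rewrite expr0 der1 mulr0 !mul0r.
rewrite exprS DM mulrDr [x * (x * _)]mulrCA IH -addn1 natrD; ring.
Qed.

(** Cleared of denominators, the logarithmic derivative of a product needs only Leibniz's rule, and
    so applies to both partial derivatives. *)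
Lemma log_derivative (I : eqType) (s : seq I) (P : I -> A) (f : I -> nat) : uniq s ->
  (\prod_(i <- s) P i) * D (\prod_(i <- s) P i ^+ f i)
  = (\prod_(i <- s) P i ^+ f i)
    * \sum_(i <- s) (f i)%:R * (\prod_(j <- s | j != i) P j) * D (P i).
Proof.
elim: s => [|x s IH] /=; first by rewrite !big_nil der1 !mulr0.
case/andP=> xs us; rewrite !big_cons eqxx /=.
have ex : \prod_(j <- s | j != x) P j = \prod_(j <- s) P j.
  rewrite big_seq_cond [RHS]big_seq; apply: eq_bigl => j.
  by case: (boolP (j \in s)) => //= js; apply: contraNneq xs => <-.
have es : \sum_(i <- s) (f i)%:R * (\prod_(j <- x :: s | j != i) P j) * D (P i)
   = P x * \sum_(i <- s) (f i)%:R * (\prod_(j <- s | j != i) P j) * D (P i).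
  rewrite mulr_sumr; apply: eq_big_seq => i is_.
  have xi : x != i by apply: contraNneq xs => ->.
  by rewrite big_cons xi; ring.
rewrite ex es DM.
have IHs := IH us.
set p := \prod_(i <- s) P i in IHs *; set q := \prod_(i <- s) P i ^+ f i in IHs *.
set S := \sum_(i <- s) _ in IHs *.
transitivity (P x * D (P x ^+ f x) * p * q + P x * P x ^+ f x * (p * D q)); first by ring.
by rewrite IHs derX; ring.
Qed.

End LogDerivative.

Section ClosedForms.
Variable k : fieldType.
Implicit Types (F G : {poly {poly k}}).

(** Multiplying numerator and denominator by [G] does not change the 1-form, so closedness may be
    checked on another representative. *)
Lemma closed_defect_scale F G w1 w2 :
  closed_defect (G * F) (G * w1, G * w2) = G ^+ 2 * closed_defect F (w1, w2).
Proof. by rewrite /closed_defect /= !derivYM !derivM; ring. Qed.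

Lemma closed_defect_dlog F : closed_defect F (F^`(), derivY F) = 0.
Proof. by rewrite /closed_defect /= derivY_deriv; ring. Qed.

Lemma closed_defect_quot F (h : {poly {poly k}}) :
  closed_defect (F ^+ 2) (F * h^`() - h * F^`(), F * derivY h - h * derivY F) = 0.
Proof.
rewrite /closed_defect /= expr2 !(derivYB, derivB, derivYM, derivM) !derivY_deriv.
by ring.
Qed.

End ClosedForms.

(* The derivative [(h / q)'] of a rational function has no residue: the case where
   the denominator has order [v] at [t] is reduced to [v = 0] by cancelling zeros of [h]. *)
Lemma derivative_no_residue (k : fieldType) (t : k) (r w h g : {poly k}) v :
  [pchar k] =i pred0 -> r.[t] != 0 -> w.[t] != 0 ->
  r * (('X - t%:P) * (w * h^`() - h * w^`()) - v%:R * h * w) = ('X - t%:P) ^+ v * g ->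
  g.[t] = 0.
Proof.
move=> k0 rt wt; elim: v h g => [|v IH] h g e.
  by move: e; rewrite expr0 mul1r => <-; rewrite !hornerE subrr; ring.
have ht : h.[t] = 0.
  have /(congr1 (fun p => p.[t])) := e.
  rewrite !hornerE subrr exprS !mul0r sub0r => /eqP.
  rewrite mulf_eq0 (negPf rt) oppr_eq0 !mulf_eq0 (negPf wt) orbF /=.
  rewrite -[v.+1%:R]polyC_natr hornerC (natr_eq0_char0 k0) /=.
  by move/eqP.
have /eqP/factor_theorem[h2 eh] := ht.
apply: (IH h2).
have X0 : 'X - t%:P != 0 by rewrite polyXsubC_eq0.
apply: (mulfI X0); rewrite [RHS]mulrA -exprS -e eh derivM derivXsubC -[v.+1]addn1 natrD.
by ring.
Qed.

Lemma card_triangle n :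
  #|[pred x : 'I_n.+1 * 'I_n.+1 | (x.1 + x.2 <= n)%N]| = 'C(n.+2, 2).
Proof.
rewrite -sum1_card -(pair_big_dep xpredT (fun i j : 'I_n.+1 => (i + j <= n)%N) (fun _ _ => 1%N)) /=.
rewrite -bin2_sum big_mkord big_ord_recl add0n (reindex_inj rev_ord_inj) /=.
apply: eq_bigr => i _; rewrite /bump /= add1n.
have le : (i.+1 <= n.+1)%N by rewrite ltn_ord.
under eq_bigl => j.
  have -> : (n.+1 - i.+1 + j <= n)%N = (j < i.+1)%N by move: le; lia.
  over.
by rewrite (big_ord_narrow le) sum1_card card_ord.
Qed.

Section KernelFamily.
Variable k : fieldType.
Hypothesis k0 : [pchar k] =i pred0.
Variables (m : nat) (P : 'I_m.+1 -> {poly {poly k}}) (e delta : 'I_m.+1 -> nat) (tau : 'I_m.+1 -> k).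
Hypothesis e_gt0 : forall i, (0 < e i)%N.
Hypothesis P_deg : forall i, tdlt (delta i).+1 (P i).
Hypothesis P_size : forall i, size (spec 0 (P i)) = (delta i).+1.
Hypothesis P_tau : forall i j, root (spec 0 (P j)) (tau i) = (i == j).
Hypothesis delta_gt0 : forall i, (0 < delta i)%N.
Implicit Types (alpha : 'I_m.+1 -> k) (h : {poly {poly k}}).
Local Notation A := {poly {poly k}}.
Local Notation Y := ('X%:P : A).

Definition mult_part : A := \prod_i P i ^+ (e i).-1.
Definition rad_part : A := \prod_i P i.
Definition cofac i : A := \prod_(j | j != i) P j.
Definition omega : nat := \sum_i delta i * (e i).-1.
Local Notation Q := mult_part.
Local Notation R := rad_part.

(** This is [R dQ / Q], a polynomial because [dQ / Q] has at most simple poles along the [P_i]. *)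
Definition theta_form (D : A -> A) : A := \sum_i (e i).-1%:R * cofac i * D (P i).

Definition form_comp (D : A -> A) alpha h : A :=
  Q * (\sum_i (alpha i)%:P%:P * cofac i * D (P i)) + (R * D h - h * theta_form D).

(* The numerator of [\sum_i alpha_i dP_i / P_i + d(h / Q)] over the denominator [Q * R]. *)
Definition form alpha h : A * A := (form_comp (deriv (R := _)) alpha h, form_comp (@derivY k) alpha h).

Lemma rad_cofac i : R = P i * cofac i.
Proof. by rewrite /rad_part (bigD1 i). Qed.

Lemma theta_formP (D : A -> A) : (forall x y, D (x * y) = D x * y + x * D y) ->
  R * D Q = Q * theta_form D.
Proof. by move=> DM; apply: log_derivative => //; apply: index_enum_uniq. Qed.

Lemma theta_deriv : R * Q^`() = Q * theta_form (deriv (R := _)).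
Proof. by apply: theta_formP => x y; rewrite derivM. Qed.

Lemma theta_derivY : R * derivY Q = Q * theta_form (@derivY k).
Proof. by apply: theta_formP => x y; rewrite derivYM. Qed.

Lemma form_compE (D : A -> A) alpha h : form_comp D alpha h
  = \sum_i (alpha i)%:P%:P * (Q * cofac i * D (P i)) + form_comp D (fun _ => 0) h.
Proof.
rewrite /form_comp [X in _ = _ + (Q * X + _)]big1 ?mulr0 ?add0r; last first.
  by move=> i _; rewrite !polyC0 !mul0r.
congr (_ + _); rewrite mulr_sumr; apply: eq_bigr => i _.
by ring.
Qed.

Lemma P_neq0 i : P i != 0.
Proof.
have : spec 0 (P i) != 0 by rewrite -size_poly_eq0 P_size.
by apply: contra_neq => ->; rewrite rmorph0.
Qed.

Lemma mult_part_neq0 : Q != 0.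
Proof. by apply/prodf_neq0 => i _; rewrite expf_neq0 // P_neq0. Qed.

Lemma rad_part_neq0 : R != 0.
Proof. by apply/prodf_neq0 => i _; rewrite P_neq0. Qed.

Lemma form_closed alpha h : closed_defect (Q * R) (form alpha h) = 0.
Proof.
have zero F : closed_defect F 0 = 0.
  have /eqP := closed_defect_lin F 1 0 0; rewrite polyC1 !scale1r addr0.
  by rewrite -subr_eq0 opprD addNKr oppr_eq0 => /eqP.
have lin F (c : k) v w : closed_defect F v = 0 -> closed_defect F w = 0 ->
    closed_defect F (c%:P *: v + w) = 0.
  by move=> v0 w0; rewrite closed_defect_lin v0 w0 scaler0 addr0.
have -> : form alpha h
    = \sum_i (alpha i)%:P *: (Q * cofac i * (P i)^`(), Q * cofac i * derivY (P i))
      + form (fun _ => 0) h.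
  rewrite /form !(form_compE _ alpha).
  rewrite [in RHS](_ : \sum_i _ = (\sum_i (alpha i)%:P%:P * (Q * cofac i * (P i)^`()),
     \sum_i (alpha i)%:P%:P * (Q * cofac i * derivY (P i)))) //.
  elim/big_ind3: _ => [||i _] //; first by move=> x1 x2 x3 y1 y2 y3 -> ->.
  by rewrite !mul_polyC.
have form_h : closed_defect (Q * R) (form (fun _ => 0) h) = 0.
  have Q0 := mult_part_neq0.
  apply: (mulfI (expf_neq0 2 Q0)); rewrite mulr0 /form -closed_defect_scale.
  (* The form [d(h / Q)] is naturally written over [Q^2], here over [Q * R]; the two are compared
     over [Q^2 * R]. *)
  have -> : Q * (Q * R) = R * Q ^+ 2 by ring.
  have eD (D : A -> A) : R * D Q = Q * theta_form D ->
      Q * form_comp D (fun _ => 0) h = R * (Q * D h - h * D Q).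
    move=> eR; rewrite /form_comp big1 ?mulr0 ?add0r; last by move=> i _; rewrite !polyC0 !mul0r.
    transitivity (R * (Q * D h) - h * (Q * theta_form D)); first by ring.
    by rewrite -eR; ring.
  rewrite /= (eD _ theta_deriv) (eD _ theta_derivY) closed_defect_scale.
  by rewrite closed_defect_quot mulr0.
elim: (index_enum _) => [|i s IH]; first by rewrite big_nil add0r.
rewrite big_cons -addrA; apply: lin => //.
have -> : Q * R = Q * cofac i * P i by rewrite (rad_cofac i); ring.
by rewrite closed_defect_scale closed_defect_dlog mulr0.
Qed.

Lemma tdlt_prod (I : Type) (s : seq I) (p : pred I) (F : I -> A) (d : I -> nat) :
  (forall i, tdlt (d i).+1 (F i)) ->
  tdlt (\sum_(i <- s | p i) d i).+1 (\prod_(i <- s | p i) F i).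
Proof.
move=> H; elim/big_ind2: _ => [|x1 x2 y1 y2 h1 h2|i _] //.
  by have := @tdltC k 1; rewrite !polyC1.
exact: tdltM1.
Qed.

Lemma tdlt_exp d (p : A) n : tdlt d.+1 p -> tdlt (d * n).+1 (p ^+ n).
Proof.
move=> tp; elim: n => [|n IH]; last by rewrite exprS mulnS; apply: tdltM1.
by rewrite expr0 muln0; have := @tdltC k 1; rewrite !polyC1.
Qed.

Lemma tdlt_mult_part : tdlt omega.+1 Q.
Proof. by apply: tdlt_prod => i; apply: tdlt_exp. Qed.

Local Notation rho := (\sum_i delta i)%N.

Lemma tdlt_rad_part : tdlt rho.+1 R.
Proof. exact: tdlt_prod. Qed.

Lemma tdlt_cofac i : tdlt (rho - delta i).+1 (cofac i).
Proof. by rewrite (bigD1 i) //= addKn; apply: tdlt_prod. Qed.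

Lemma delta_le i : (delta i <= rho)%N.
Proof. by rewrite (bigD1 i) //= leq_addr. Qed.

Lemma tdlt_sum n (I : Type) (s : seq I) (F : I -> A) :
  (forall i, tdlt n (F i)) -> tdlt n (\sum_(i <- s) F i).
Proof.
move=> H; elim/big_ind: _ => [||i _] //; first exact: tdlt0.
by move=> x y; apply: tdltD.
Qed.

Lemma tdltCM n (c : k) (p : A) : tdlt n p -> tdlt n (c%:P%:P * p).
Proof. by rewrite mul_polyC; apply: tdltZ. Qed.

Lemma tdlt_natM n c (p : A) : tdlt n p -> tdlt n (c%:R * p).
Proof.
have -> : (c%:R : A) = (c%:R)%:P%:P by rewrite !polyC_natr.
exact: tdltCM.
Qed.

Lemma tdlt_form_comp (D : A -> A) alpha h :
  (forall n (p : A), tdlt n p -> tdlt n.-1 (D p)) -> tdlt omega.+1 h ->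
  tdlt (omega + rho)%N (form_comp D alpha h).
Proof.
move=> tD th.
have tc i : tdlt rho (cofac i * D (P i)).
  apply: tdlt_le (tdltM (@tdlt_cofac i) (tD _ _ (@P_deg i))).
  by rewrite addSn /= subnK // delta_le.
apply: tdltD.
  have -> : (omega + rho = (omega.+1 + rho).-1)%N by rewrite addSn.
  apply: tdltM; first exact: tdlt_mult_part.
  by apply: tdlt_sum => i; rewrite -mulrA; apply: tdltCM.
apply: tdltB.
  have -> : (omega + rho = (rho.+1 + omega).-1)%N by rewrite addSn addnC.
  by apply: tdltM; [apply: tdlt_rad_part|apply: tD th].
have -> : (omega + rho = (omega.+1 + rho).-1)%N by rewrite addSn.
by apply: tdltM => //; apply: tdlt_sum => i; rewrite -mulrA; apply: tdlt_natM.
Qed.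

(** Contraction with the Euler field replaces [dP_i] by [delta_i P_i] up to lower degree. In top
    degree the logarithmic part becomes [Q R \sum_i alpha_i delta_i = 0] and the exact part
    [omega R h - h omega R], which is where the bound [omega] on the degree of [h] enters. *)
Lemma form_admissible alpha h : tdlt omega.+1 h -> \sum_i alpha i * (delta i)%:R = 0 ->
  admissible (omega + rho) (form alpha h).
Proof.
move=> th sum0; split.
- by apply: tdlt_form_comp => // n p; apply: tdlt_deriv.
- by apply: tdlt_form_comp => // n p; apply: tdlt_derivY.
pose E p : A := 'X * p^`() + Y * derivY p.
pose low i := E (P i) - (delta i)%:R * P i.
have tlow i : tdlt (delta i) (low i) by apply: tdlt_euler.
have tlowh : tdlt omega (E h - omega%:R * h) by apply: tdlt_euler.
have -> : 'X * (form alpha h).1 + Y * (form alpha h).2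
   = Q * (\sum_i (alpha i)%:P%:P * (cofac i * low i))
     + (R * (E h - omega%:R * h) - h * \sum_i (e i).-1%:R * (cofac i * low i)).
  have sE (c : 'I_m.+1 -> A) :
      'X * (\sum_i c i * cofac i * (P i)^`()) + Y * (\sum_i c i * cofac i * derivY (P i))
      = \sum_i c i * (cofac i * low i) + R * (\sum_i c i * (delta i)%:R).
    rewrite !mulr_sumr -!big_split /=; apply: eq_bigr => i _.
    by rewrite (rad_cofac i) /low /E; ring.
  have s1 : \sum_i (alpha i)%:P%:P * (delta i)%:R = 0 :> A.
    rewrite -[RHS]polyC0 -[0 in RHS]polyC0 -sum0 !rmorph_sum /=; apply: eq_bigr => i _.
    by rewrite !polyCM !polyC_natr.
  have s2 : \sum_i (e i).-1%:R * (delta i)%:R = omega%:R :> A.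
    by rewrite /omega natr_sum; apply: eq_bigr => i _; rewrite -natrM mulnC.
  have := sE (fun i => (alpha i)%:P%:P); rewrite s1 mulr0 addr0 => e1.
  have := sE (fun i => (e i).-1%:R); rewrite s2 => e2.
  rewrite -e1 /form /form_comp /= -/(theta_form _) -/(theta_form _).
  have -> : \sum_i (e i).-1%:R * (cofac i * low i) =
     'X * theta_form (deriv (R := _)) + Y * theta_form (@derivY k) - R * omega%:R.
    by rewrite /theta_form e2 addrK.
  by rewrite /E; ring.
have tc i : tdlt rho (cofac i * low i).
  apply: tdlt_le (tdltM (@tdlt_cofac i) (@tlow i)).
  by rewrite addSn /= subnK // delta_le.
apply: tdltD.
  have -> : (omega + rho = (omega.+1 + rho).-1)%N by rewrite addSn.
  by apply: tdltM; [apply: tdlt_mult_part|apply: tdlt_sum => i; apply: tdltCM].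
apply: tdltB.
  have -> : (omega + rho = (rho.+1 + omega).-1)%N by rewrite addSn addnC.
  by apply: tdltM => //; apply: tdlt_rad_part.
have -> : (omega + rho = (omega.+1 + rho).-1)%N by rewrite addSn.
by apply: tdltM => //; apply: tdlt_sum => i; apply: tdlt_natM.
Qed.

Lemma form_spec alpha h : form alpha h = 0 ->
  spec 0 Q ^+ 2 * (\sum_i (alpha i)%:P * spec 0 (cofac i) * (spec 0 (P i))^`())
  + spec 0 R * (spec 0 Q * (spec 0 h)^`() - spec 0 h * (spec 0 Q)^`()) = 0.
Proof.
move=> [eT _].
have e1 : Q ^+ 2 * (\sum_i (alpha i)%:P%:P * cofac i * (P i)^`()) + R * (Q * h^`() - h * Q^`()) = 0.
  rewrite mulrBr; have -> : R * (h * Q^`()) = h * (Q * theta_form (deriv (R := _))).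
    by rewrite -theta_deriv; ring.
  by apply: etrans (mulr0 Q); rewrite -[in RHS]eT /form_comp; ring.
have := congr1 (spec 0) e1.
rewrite rmorphD rmorphM rmorphXn rmorph_sum rmorphM rmorphB !rmorphM !spec_deriv rmorph0.
under eq_bigr do rewrite !rmorphM spec_deriv.
have sC (c : k) : spec 0 c%:P%:P = c%:P.
  by rewrite /spec /= map_polyC /= horner_evalE hornerC.
by under eq_bigr do rewrite sC.
Qed.

(** Restricted to [Y = 0], the form has residue [mu alpha_i] at [tau_i], with [mu] the order of
    [P_i] there: the other [P_j] do not vanish at [tau_i], and the derivative of [h / Q] has no
    residue. *)
Lemma form_alpha_eq0 alpha h : form alpha h = 0 -> forall i, alpha i = 0.
Proof.
move=> /form_spec e1 i.
set q := spec 0 Q in e1; set h0 := spec 0 h in e1; set t := tau i.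
have q0 : q != 0.
  rewrite /q /mult_part rmorph_prod; apply/prodf_neq0 => j _.
  by rewrite rmorphXn expf_neq0 // -size_poly_eq0 P_size.
have p0 : spec 0 (P i) != 0 by rewrite -size_poly_eq0 P_size.
have [mu [u ut ep]] := multiplicity_XsubC (spec 0 (P i)) t.
have [nu [w wt eq]] := multiplicity_XsubC q t.
rewrite p0 /= rootE in ut; rewrite q0 /= rootE in wt.
have mu0 : mu != 0%N.
  have := P_tau i i; rewrite eqxx ep; apply: contraTneq => ->.
  by rewrite expr0 mulr1.
have X0 : 'X - t%:P != 0 by rewrite polyXsubC_eq0.
set c := spec 0 (cofac i).
have ct : c.[t] != 0.
  rewrite /c /cofac rmorph_prod horner_prod; apply/prodf_neq0 => j ji.
  by rewrite -rootE P_tau eq_sym.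
have er : spec 0 R = ('X - t%:P) ^+ mu * u * c.
  by rewrite (rad_cofac i) rmorphM ep [u * _]mulrC.
have dX n : ('X - t%:P) * (('X - t%:P) ^+ n)^`() = n%:R * ('X - t%:P) ^+ n.
  by rewrite (derX (D := deriv (R := _))) ?derivXsubC ?mulr1 // => x y; rewrite derivM.
have [s2 es] : exists s2, \sum_(j | j != i) (alpha j)%:P * spec 0 (cofac j) * (spec 0 (P j))^`()
    = ('X - t%:P) ^+ mu * s2.
  elim/big_ind: _ => [|x y [x2 ->] [y2 ->]|j ji]; first by exists 0; rewrite mulr0.
    by exists (x2 + y2); rewrite mulrDr.
  have -> : cofac j = P i * \prod_(l | (l != j) && (l != i)) P l.
    by rewrite /cofac (bigD1 i) //= eq_sym.
  rewrite rmorphM ep; set z := spec 0 (\prod_(l | _) _).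
  by exists ((alpha j)%:P * u * z * (spec 0 (P j))^`()); ring.
(* The residue is carried by [g1], whose value at [t] is [mu alpha_i] times the nonzero values of
   [c] and [u]. *)
pose g1 := (alpha i)%:P * c * (mu%:R * u + ('X - t%:P) * u^`()) + ('X - t%:P) * s2.
have eS : ('X - t%:P) * (\sum_j (alpha j)%:P * spec 0 (cofac j) * (spec 0 (P j))^`())
    = ('X - t%:P) ^+ mu * g1.
  rewrite (bigD1 i) //= es ep derivM -/c.
  transitivity ((alpha i)%:P * c * (('X - t%:P) * u^`() * ('X - t%:P) ^+ mu
     + u * (('X - t%:P) * (('X - t%:P) ^+ mu)^`())) + ('X - t%:P) * (('X - t%:P) ^+ mu * s2)).
    by ring.
  by rewrite dX /g1; ring.
have eW : ('X - t%:P) * (q * h0^`() - h0 * q^`())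
    = ('X - t%:P) ^+ nu * (('X - t%:P) * (w * h0^`() - h0 * w^`()) - nu%:R * h0 * w).
  rewrite eq derivM.
  transitivity (('X - t%:P) * w * ('X - t%:P) ^+ nu * h0^`()
     - h0 * (('X - t%:P) * w^`() * ('X - t%:P) ^+ nu + w * (('X - t%:P) * (('X - t%:P) ^+ nu)^`()))).
    by ring.
  by rewrite dX; ring.
have key : u * c * (('X - t%:P) * (w * h0^`() - h0 * w^`()) - nu%:R * h0 * w)
    = ('X - t%:P) ^+ nu * (- (w ^+ 2 * g1)).
  apply: (mulfI (expf_neq0 nu X0)); apply: (mulfI (expf_neq0 mu X0)).
  apply/eqP; rewrite -subr_eq0; apply/eqP.
  transitivity (('X - t%:P) ^+ mu * u * c * (('X - t%:P) ^+ nu *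
      (('X - t%:P) * (w * h0^`() - h0 * w^`()) - nu%:R * h0 * w))
     + (w * ('X - t%:P) ^+ nu) ^+ 2 * (('X - t%:P) ^+ mu * g1)); first by ring.
  rewrite -eW -er -eS -eq; transitivity (('X - t%:P) * (q ^+ 2 * (\sum_i (alpha i)%:P * spec 0 (cofac i) * (spec 0 (P i))^`())
     + spec 0 R * (q * h0^`() - h0 * q^`()))); first by ring.
  by rewrite e1 mulr0.
have ucn : (u * c).[t] != 0 by rewrite hornerM mulf_neq0.
have := derivative_no_residue k0 ucn wt key.
rewrite hornerN => /eqP; rewrite oppr_eq0 hornerM mulf_eq0 horner_exp expf_eq0 /= (negPf wt) /=.
rewrite /g1 !hornerE subrr !mul0r !addr0 => /eqP.
rewrite -polyC_natr hornerC => /eqP; rewrite !mulf_eq0 (negPf ct) (negPf ut) (natr_eq0_char0 k0).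
by rewrite (negPf mu0) !orbF => /eqP.
Qed.

Lemma deg_lead_Xderiv (F : nzRingType) a (p : {poly F}) v :
  deg_lead a p v -> deg_lead a ('X * p^`()) (v *+ a).
Proof.
move=> [s c]; split.
  apply/leq_sizeP => i ai; rewrite coefXM; case: i ai => // i ai.
  by rewrite coef_deriv nth_default ?mul0rn // (leq_trans s).
rewrite coefXM; case: a s c => [|a] s c /=; first by rewrite mulr0n.
by rewrite coef_deriv c.
Qed.

Lemma mult_part_deg_lead : exists2 l, l != 0 & deg_lead omega (spec 0 Q) l.
Proof.
exists (\prod_i lead_coef (spec 0 (P i)) ^+ (e i).-1).
  apply/prodf_neq0 => i _; rewrite expf_neq0 // lead_coef_eq0 -size_poly_eq0 P_size //.
rewrite /mult_part rmorph_prod /omega.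
elim/big_ind3: _ => [||i _]; first by split; rewrite ?size_poly1 ?coef1.
  by move=> *; apply: deg_leadM.
by rewrite rmorphXn; apply: deg_leadX; split; rewrite ?lead_coefE ?P_size.
Qed.

(** Once [alpha = 0], what vanishes is [d(h / Q)], which makes [h] a constant multiple of [Q]. The
    coefficient of [T^omega] is nonzero in [Q]; requiring it to vanish in [h] fixes that constant to
    0. *)
Lemma form_eq0 alpha h : tdlt omega.+1 h -> h`_omega`_0 = 0 -> form alpha h = 0 ->
  (forall i, alpha i = 0) /\ h = 0.
Proof.
move=> th hw f0; have a0 := form_alpha_eq0 f0; split=> //.
have eD (D : A -> A) : R * D Q = Q * theta_form D -> form_comp D alpha h = 0 -> Q * D h = h * D Q.
  move=> eR; rewrite /form_comp big1 ?mulr0 ?add0r; last by move=> i _; rewrite a0 !polyC0 !mul0r.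
  move=> eh; apply: (mulfI rad_part_neq0).
  apply/eqP; rewrite -subr_eq0; apply/eqP.
  transitivity (Q * (R * D h - h * theta_form D) + h * (Q * theta_form D - R * D Q)); first by ring.
  by rewrite eh eR subrr !mulr0 addr0.
case: f0 => /(eD _ theta_deriv) eT /(eD _ theta_derivY) eY.
have [l l0 dq] := mult_part_deg_lead.
have q0 : spec 0 Q != 0.
  by apply: contra_neq l0 => e0; case: dq => _ <-; rewrite e0 coef0.
have csp (p : A) i : (spec 0 p)`_i = p`_i`_0.
  by rewrite coef_map /= horner_evalE horner_coef0.
(* On [Y = 0], comparing leading coefficients in [q h' = h q'] would give [h] the degree [omega] of
   [q], in characteristic 0, but the degree of [h] is smaller there. *)
have h00 : spec 0 h = 0.
  apply: NNPP => /eqP n0.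
  have dh : deg_lead (size (spec 0 h)).-1 (spec 0 h) (lead_coef (spec 0 h)).
    by split; rewrite // prednK // size_poly_gt0.
  have sh : (size (spec 0 h) <= omega)%N.
    apply/leq_sizeP => i; rewrite csp leq_eqVlt => /orP[/eqP <- //|lt].
    by apply: th; rewrite addn0.
  have := congr1 (spec 0) eT; rewrite !rmorphM !spec_deriv => /(congr1 (fun p => 'X * p)).
  rewrite mulrCA [RHS]mulrCA => eX.
  have [_ c1] := deg_leadM dq (deg_lead_Xderiv dh).
  have [_ c2] := deg_leadM dh (deg_lead_Xderiv dq).
  move: c2; rewrite -eX addnC c1 !mulrnAr [_ * l]mulrC; set x := l * _ => exx.
  have x0 : x != 0 by rewrite mulf_neq0 // lead_coef_eq0.
  have lt : ((size (spec 0 h)).-1 < omega)%N by rewrite prednK // size_poly_gt0.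
  have := mulrnBr x (ltnW lt); rewrite exx subrr -mulr_natr => /eqP.
  by rewrite mulf_eq0 (negPf x0) (natr_eq0_char0 k0) subn_eq0 leqNgt lt.
(* If [h = Y^n h1] with [n > 0], then [Q h_Y = h Q_Y] reduces modulo [Y] to [n q h1 = 0]; so [h] is
   divisible by every power of [Y]. *)
have hY n : exists h1, h = Yc 0 ^+ n * h1.
  elim: n => [|n [h1 eh]]; first by exists h; rewrite mul1r.
  suff /spec_eq0[h2 e2] : spec 0 h1 = 0.
    by exists h2; rewrite eh e2 exprSr mulrA.
  case: n eh => [|n] eh; first by move: h00; rewrite eh mul1r.
  have dYc : Yc 0 * derivY (Yc 0 ^+ n.+1) = n.+1%:R * Yc 0 ^+ n.+1 :> A.
    rewrite (derX (D := @derivY k)) ?/Yc; last by move=> x y; rewrite derivYM.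
    by rewrite derivYC derivXsubC mulr1.
  have Yn0 : Yc 0 ^+ n.+1 != 0 :> A by rewrite expf_neq0 // polyC_eq0 polyXsubC_eq0.
  have : Q * (n.+1%:R * h1 + Yc 0 * derivY h1) = Yc 0 * (h1 * derivY Q).
    apply: (mulfI Yn0); apply/eqP; rewrite -subr_eq0; apply/eqP.
    transitivity (Yc 0 * (Q * (derivY (Yc 0 ^+ n.+1) * h1 + Yc 0 ^+ n.+1 * derivY h1) - Yc 0 ^+ n.+1 * h1 * derivY Q)
       + Q * h1 * (n.+1%:R * Yc 0 ^+ n.+1 - Yc 0 * derivY (Yc 0 ^+ n.+1))); first by ring.
    by rewrite -dYc subrr mulr0 addr0 -derivYM -eh eY subrr mulr0.
  move/(congr1 (spec 0)); rewrite rmorphM rmorphD [in X in _ + X]rmorphM [in RHS]rmorphM spec_Yc !mul0r addr0.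
  rewrite rmorphM rmorph_nat => /eqP; rewrite !mulf_eq0 (negPf q0) /=.
  by rewrite -polyC_natr polyC_eq0 (natr_eq0_char0 k0) => /eqP.
apply/polyP => i; apply/polyP => j; rewrite !coef0.
have [h1 ->] := hY j.+1.
by rewrite /Yc polyC0 subr0 -rmorphXn coefCM coefXnM ltnSn.
Qed.

Lemma form_lin (c : k) alpha beta h g :
  form (fun i => c * alpha i + beta i) (c%:P *: h + g) = c%:P *: form alpha h + form beta g.
Proof.
have E (D : A -> A) : D (c%:P *: h + g) = c%:P *: D h + D g ->
    form_comp D (fun i => c * alpha i + beta i) (c%:P *: h + g)
    = c%:P *: form_comp D alpha h + form_comp D beta g.
  move=> eD; rewrite /form_comp eD -!mul_polyC.
  have -> : \sum_i (c * alpha i + beta i)%:P%:P * cofac i * D (P i)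
      = c%:P%:P * (\sum_i (alpha i)%:P%:P * cofac i * D (P i))
        + \sum_i (beta i)%:P%:P * cofac i * D (P i).
    rewrite mulr_sumr -big_split /=; apply: eq_bigr => i _.
    by rewrite !rmorphD !rmorphM /=; ring.
  by ring.
congr pair; apply: E; first by rewrite derivD derivZ.
by rewrite derivYD -!mul_polyC derivYM derivYC derivC polyC0 mul0r add0r.
Qed.

Lemma form_ext alpha beta h : alpha =1 beta -> form alpha h = form beta h.
Proof.
move=> ab; have E (D : A -> A) : form_comp D alpha h = form_comp D beta h.
  by rewrite /form_comp; congr (_ * _ + _); apply: eq_bigr => i _; rewrite ab.
by rewrite /form !E.
Qed.

Lemma form_sum (T : Type) (s : seq T) (x : T -> k) (al : T -> 'I_m.+1 -> k) (h : T -> A) :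
  \sum_(t <- s) (x t)%:P *: form (al t) (h t)
  = form (fun i => \sum_(t <- s) x t * al t i) (\sum_(t <- s) (x t)%:P *: h t).
Proof.
elim: s => [|t s IH].
  rewrite !big_nil /form /form_comp !big1; try by move=> i _; rewrite big_nil !polyC0 !mul0r.
  have dY0 : derivY (0 : A) = 0 by rewrite -[0]polyC0 derivYC deriv0.
  by rewrite dY0 deriv0 !mulr0 !mul0r subrr addr0.
rewrite !big_cons IH -form_lin; apply: form_ext => i.
by rewrite big_cons.
Qed.

Definition mono_index :=
  {x : 'I_omega.+1 * 'I_omega.+1 | (x.1 + x.2 <= omega)%N && (x != corner omega)}.

Definition mono (x : 'I_omega.+1 * 'I_omega.+1) : A := ('X^(x.2))%:P * 'X^(x.1).

Lemma coef_mono x i j : (mono x)`_i`_j = ((i == x.1) && (j == x.2))%:R.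
Proof.
rewrite /mono coefCM coefXn; case: (i == _); last by rewrite mulr0 coef0.
by rewrite mulr1 coefXn.
Qed.

Lemma kernel_family : exists v : 'I_(m + ('C(omega.+2, 2) - 1)) -> A * A,
  [/\ forall j, admissible (omega + rho) (v j),
      forall j, closed_defect (Q * R) (v j) = 0
    & forall x : _ -> k, \sum_j (x j)%:P *: v j = 0 -> forall j, x j = 0].
Proof.
pose T := ('I_m + mono_index)%type.
have cT : #|{: T}| = (m + ('C(omega.+2, 2) - 1))%N.
  rewrite card_sum card_ord card_sig -card_triangle; congr (_ + _)%N.
  rewrite [in RHS](cardD1 (corner omega)) inE /= addn0 leqnn add1n subn1 /=.
  by apply: eq_card => x; rewrite !inE andbC.
(* The relation [\sum_i alpha_i delta_i = 0] is solved by the [m] vectors with entry [- delta_(i+1)]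
   at [0] and [delta_0] at [i + 1]. The remaining indices are the monomials of degree at most
   [omega] other than [T^omega], which the normalization in [form_eq0] excludes. *)
pose al (t : T) (l : 'I_m.+1) : k := if t is inl i then
   (if l == ord0 then - (delta (lift ord0 i))%:R
    else if l == lift ord0 i then (delta ord0)%:R else 0) else 0.
pose ho (t : T) : A := if t is inr x then mono (val x) else 0.
have hdeg t : tdlt omega.+1 (ho t).
  case: t => [i|[x /andP[xw _]]] /=; first exact: tdlt0.
  move=> i j ij; rewrite coef_mono; case: eqP => //= ei; case: eqP => //= ej.
  by move: ij; rewrite ei ej ltnNge xw.
have hcor t : (ho t)`_omega`_0 = 0.
  case: t => [i|[x /andP[_ xc]]] /=; first by rewrite !coef0.
  rewrite coef_mono; case: eqP => //= e1; case: eqP => //= e2.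
  case/negP: xc; apply/eqP; case: x e1 e2 => x1 x2 /= e1 e2.
  by rewrite /corner; congr pair; apply: val_inj.
have asum t : \sum_i al t i * (delta i)%:R = 0.
  case: t => [i|x] /=; last by rewrite big1 // => l _; rewrite mul0r.
  rewrite big_ord_recl eqxx (bigD1 i) //= eqxx big1 ?addr0.
    by rewrite mulrC mulrN addNr.
  by move=> l li; rewrite (inj_eq lift_inj) (negPf li) mul0r.
pose w t := form (al t) (ho t).
pose v (j : 'I_(m + ('C(omega.+2, 2) - 1))) := w (enum_val (cast_ord (esym cT) j)).
exists v; split=> [j|j|x sx].
- exact: form_admissible.
- exact: form_closed.
pose y (t : T) := x (cast_ord cT (enum_rank t)).
have : \sum_t (y t)%:P *: w t = 0.
  apply: etrans sx; rewrite (reindex (fun j => enum_val (cast_ord (esym cT) j))) /=.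
    by apply: eq_bigr => j _; rewrite /y enum_valK cast_ordKV.
  exists (fun t => cast_ord cT (enum_rank t)) => t _; first by rewrite enum_valK cast_ordKV.
  by rewrite cast_ordK enum_rankK.
rewrite form_sum => /form_eq0[||ya yh].
- by apply: tdlt_sum => t; apply: tdltZ.
- rewrite !coef_sum big1 // => t _; by rewrite coefZ coefCM hcor mulr0.
suff y0 t : y t = 0.
  move=> j; have := y0 (enum_val (cast_ord (esym cT) j)).
  by rewrite /y enum_valK cast_ordKV.
case: t => [i|z].
  have := ya (lift ord0 i); rewrite (bigD1 (inl i)) //= big1 ?addr0.
    move/eqP; rewrite eqxx mulf_eq0 (natr_eq0_char0 k0) [delta _ == 0%N]eqn0Ngt delta_gt0 orbF.
    by move/eqP.
  case=> [l|z] /= ne; last by rewrite mulr0.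
  rewrite (inj_eq lift_inj); case: eqP => [e1|_]; last by rewrite mulr0.
  by case/eqP: ne; rewrite e1.
have := congr1 (fun p : A => p`_(val z).1`_(val z).2) yh; rewrite coef0 coef0 coef_sum coef_sum.
rewrite (bigD1 (inr z)) //= big1 ?addr0.
  by rewrite coefZ coefCM coef_mono !eqxx mulr1.
case=> [l|z'] /= ne; first by rewrite scaler0 !coef0.
rewrite coefZ coefCM coef_mono; case: eqP => //= [e1|_]; last by rewrite mulr0.
case: eqP => [e2|_]; last by rewrite mulr0.
case/eqP: ne; congr inr; apply: val_inj.
rewrite [val z']surjective_pairing [RHS]surjective_pairing.
by congr pair; apply: val_inj.
Qed.

End KernelFamily.

(** * Generic lines *)

Section Shift.
Variables (K : closedFieldType) (n : nat) (b : 'I_n -> K).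
Local Notation M := {mpoly K[n]}.

Definition shift_along (c : K) : {rmorphism M -> {poly M}} :=
  mmap (polyC \o @mpolyC n K) (fun j => ('X_j)%:P + (c * b j)%:MP *: 'X).

Local Notation shift := (shift_along 1).

Lemma shift0 c q : (shift_along c q).[0] = q.
Proof.
pose e1 : {rmorphism M -> M} := horner_eval 0 \o shift_along c.
apply: (mpoly_rmorph_ext (f := e1) (g := idfun)) => [d|i]; rewrite /e1 /=.
  by rewrite mmapC horner_evalE hornerC.
by rewrite mmapX mmap1U horner_evalE !hornerE.
Qed.

Lemma shift_line a q : map_poly (meval a) (shift q) = line a b q.
Proof.
pose e1 : {rmorphism M -> {poly K}} := map_poly (meval a) \o shift.
apply: (mpoly_rmorph_ext (f := e1) (g := line a b)) => [d|i]; rewrite /e1 /=.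
  by rewrite !mmapC /= map_polyC /= mevalC.
rewrite !mmapX !mmap1U rmorphD /= map_polyC /= mevalXU map_polyZ map_polyX /= mevalC.
by rewrite mul1r.
Qed.

Lemma poly_rmorph_ext (R : nzRingType) (S : pzRingType) (e1 e2 : {rmorphism {poly R} -> S}) :
  (forall c, e1 c%:P = e2 c%:P) -> e1 'X = e2 'X -> e1 =1 e2.
Proof.
move=> eC eX; elim/poly_ind=> [|p c IH]; first by rewrite !rmorph0.
by rewrite !rmorphD !rmorphM IH eC eX.
Qed.

(** The substitution [X |-> X + c b T], extended by [T |-> T], is an automorphism of [K[X][T]] for
    [c = 1], and so carries primes to primes. *)
Definition shear c : {rmorphism {poly M} -> {poly M}} := horner_eval 'X \o map_poly (shift_along c).

Lemma shearC c q : shear c q%:P = shift_along c q.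
Proof. by rewrite /shear /= map_polyC horner_evalE hornerC. Qed.

Lemma shearX c : shear c 'X = 'X.
Proof. by rewrite /shear /= map_polyX horner_evalE hornerX. Qed.

Lemma shearK : cancel (shear 1) (shear (- 1)).
Proof.
have H q : shear (- 1) (shift_along 1 q) = q%:P.
  pose e1 : {rmorphism M -> {poly M}} := shear (- 1) \o shift_along 1.
  apply: (mpoly_rmorph_ext (f := e1) (g := polyC)) => [d|i]; rewrite /e1 /=.
    by rewrite mmapC -[LHS]/(shear (- 1) (d%:MP)%:P) shearC /= mmapC.
  rewrite mmapX mmap1U -[LHS]/(shear (- 1) (('X_i)%:P + (1 * b i)%:MP *: 'X)).
  rewrite rmorphD -mul_polyC rmorphM !shearC shearX /= mmapX mmap1U mmapC /=.
  by rewrite !mul1r mulN1r mpolyCN mul_polyC scaleNr addrNK.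
move=> q; pose e2 : {rmorphism {poly M} -> {poly M}} := shear (- 1) \o shear 1.
change (e2 q = idfun q); apply: poly_rmorph_ext => [c|].
  by rewrite -[LHS]/(shear (- 1) (shear 1 c%:P)) shearC H.
by rewrite -[LHS]/(shear (- 1) (shear 1 'X)) !shearX.
Qed.

Lemma shearNK : cancel (shear (- 1)) (shear 1).
Proof.
have H q : shear 1 (shift_along (- 1) q) = q%:P.
  pose e1 : {rmorphism M -> {poly M}} := shear 1 \o shift_along (- 1).
  apply: (mpoly_rmorph_ext (f := e1) (g := polyC)) => [d|i]; rewrite /e1 /=.
    by rewrite mmapC -[LHS]/(shear 1 (d%:MP)%:P) shearC /= mmapC.
  rewrite mmapX mmap1U -[LHS]/(shear 1 (('X_i)%:P + (- 1 * b i)%:MP *: 'X)).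
  rewrite rmorphD -mul_polyC rmorphM !shearC shearX /= mmapX mmap1U mmapC /=.
  by rewrite !mul1r mulN1r mpolyCN mul_polyC scaleNr addrK.
move=> q; pose e2 : {rmorphism {poly M} -> {poly M}} := shear 1 \o shear (- 1).
change (e2 q = idfun q); apply: poly_rmorph_ext => [c|].
  by rewrite -[LHS]/(shear 1 (shear (- 1) c%:P)) shearC H.
by rewrite -[LHS]/(shear 1 (shear (- 1) 'X)) !shearX.
Qed.

Lemma shift_prime q : prime_elt q -> prime_elt (shift q).
Proof.
move=> /prime_polyC pq; rewrite -shearC.
exact: (prime_iso shearNK shearK).
Qed.

Lemma line_translate a t q : line (fun j => a j + b j * t) b q = line a b q \Po ('X + t%:P).
Proof.
pose e1 : {rmorphism M -> {poly K}} := line (fun j => a j + b j * t) b.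
pose cmp : {rmorphism {poly K} -> {poly K}} := horner_eval ('X + t%:P) \o map_poly polyC.
pose e2 : {rmorphism M -> {poly K}} := cmp \o line a b.
apply: (mpoly_rmorph_ext (f := e1) (g := e2)) => [d|i]; rewrite /e1 /e2 /cmp /= horner_evalE -/(_ \Po _).
  by rewrite !mmapC comp_polyC.
rewrite !mmapX !mmap1U comp_polyD comp_polyC comp_polyZ comp_polyX.
by rewrite scalerDr rmorphD /= -[b i *: t%:P]mul_polyC polyCM -addrA [_ * _ + _]addrC.
Qed.

Lemma shift_coef1 a t q : meval (fun j => a j + b j * t) (shift q)`_1 = (line a b q)^`().[t].
Proof.
have -> : meval (fun j => a j + b j * t) (shift q)`_1 = (line (fun j => a j + b j * t) b q)`_1.
  by rewrite -shift_line coef_map.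
rewrite line_translate.
have -> : forall p : {poly K}, p`_1 = p^`().[0].
  by move=> p; rewrite horner_coef0 coef_deriv.
by rewrite deriv_comp !derivE hornerM horner_comp !hornerE.
Qed.

End Shift.

Section Irreducible.
Variables (K : closedFieldType) (n : nat).
Local Notation M := {mpoly K[n]}.

Lemma mconst_unit (p : M) : mconst_nz p <-> p \is a GRing.unit.
Proof.
split=> [[c c0 ->]|]; first by apply: rmorph_unit; rewrite unitfE.
by case/andP=> /eqP e u; exists p@_0; rewrite -?unitfE.
Qed.

Lemma mirreducible_prime (p : M) : mirreducible p -> prime_elt p.
Proof.
case=> p0 [pc pab]; apply: irred_prime; first exact: mpoly_factorial.
split=> //; first by apply/negP => /mconst_unit.
by move=> x y /pab[/mconst_unit|/mconst_unit]; [left|right].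
Qed.

Lemma mirreducible_deg (p : M) : mirreducible p -> (0 < tdeg p)%N.
Proof.
case=> p0 [pc _]; rewrite lt0n; apply/negP => /eqP d0; apply: pc.
have /msize1_polyC e : (msize p <= 1)%N by move: d0; rewrite /tdeg; case: (msize p) => [|[]].
by exists p@_0 => //; apply: contra_neq p0; rewrite {2}e => ->; rewrite mpolyC0.
Qed.

Lemma mhomogeneous_homog (p : M) : mhomogeneous p -> p \is (tdeg p).-homog.
Proof. by move=> hp; apply/dhomogP. Qed.

(** Bezout for [p(X + b T)] and [q(X + b T)] over [K[X]] yields a nonzero [c], in the role of a
    resultant; a base point with [c(a) != 0] keeps the restrictions coprime. The condition at [b]
    gives [p(X + b T)] a positive degree in [T]. *)
Lemma coprime_on_lines (b : 'I_n -> K) (p q : M) d : mirreducible p -> mirreducible q ->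
  p \is d.-homog -> (0 < d)%N -> p.@[b] != 0 -> (forall c, p != c *: q) ->
  exists2 c : M, c != 0 & forall a, c.@[a] != 0 -> coprimep (line a b p) (line a b q).
Proof.
move=> ip iq hp d0 pb npq; have pp := shift_prime b (mirreducible_prime ip).
have ss : (1 < size (shift_along b 1 p))%N.
  have [_ c1] := line_deg_lead (fun _ => 0) b hp.
  rewrite -(shift_line b (fun _ => 0)) coef_map in c1.
  rewrite ltnNge; apply/negP => s1; case/negP: pb; rewrite -c1.
  by rewrite (nth_default 0 (leq_trans s1 d0)); apply/eqP; exact: meval0.
have nd : ~ rdvd (shift_along b 1 p) (shift_along b 1 q).
  case=> u eu; have eq : q = p * u.[0] by rewrite -(shift0 b 1 q) eu hornerM shift0.
  have [_ [ncq qP]] := iq; case: (qP _ _ eq) => [cp|[c c0 ec]].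
    by case: ip => _ [].
  case/negP: (npq c^-1); apply/eqP; rewrite eq ec mulrC mul_mpolyC scalerA mulVf // scale1r //.
have /Pdiv.Idomain.Bezout_coprimepP[[u v] /= e] := prime_coprimep pp ss nd.
have s1 : size (u * shift_along b 1 p + v * shift_along b 1 q) = 1%N.
  by rewrite (eqp_size e) size_poly1.
have e1 := size1_polyC (eq_leq s1).
set c := _`_0 in e1; exists c.
  by rewrite -polyC_eq0 -e1 -size_poly_eq0 s1.
move=> a ca; apply/Bezout_coprimepP.
exists (map_poly (meval a) u, map_poly (meval a) v) => /=.
rewrite -!shift_line -!rmorphM -rmorphD e1 /= map_polyC /= -size_poly_eq1 size_polyC.
by rewrite ca.
Qed.

Lemma common_nonroot (I : eqType) (l : seq I) (Pr : I -> ('I_n -> K) -> Prop) :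
  [pchar K] =i pred0 ->
  (forall i, i \in l -> exists2 c : M, c != 0 & forall a, c.@[a] != 0 -> Pr i a) ->
  exists a, forall i, i \in l -> Pr i a.
Proof.
move=> K0 H; suff [c c0 cP] : exists2 c : M, c != 0 & forall a, c.@[a] != 0 -> forall i, i \in l -> Pr i a.
  by have [a /cP] := mpoly_nonroot K0 c0; exists a.
elim: l H => [|i l IH] H; first by exists 1; rewrite ?oner_neq0.
have [|c c0 cP] := IH; first by move=> j jl; apply: H; rewrite in_cons jl orbT.
have [c' c'0 c'P] := H i (mem_head _ _).
exists (c' * c); first exact: mulf_neq0.
move=> a; rewrite mevalM mulf_eq0 negb_or => /andP[/c'P p1 /cP p2] j.
by rewrite in_cons => /orP[/eqP->|/p2].
Qed.

(** The direction [b] is fixed before the base point [a], since the polynomials that [a] must avoid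
    depend on [b]. *)
Lemma generic_line (l : seq M) : [pchar K] =i pred0 ->
  (forall p, p \in l -> mirreducible p /\ mhomogeneous p) ->
  exists a b : 'I_n -> K, (forall p, p \in l -> p.@[b] != 0)
   /\ (forall p q, p \in l -> q \in l -> (forall c, p != c *: q) ->
         coprimep (line a b p) (line a b q)).
Proof.
move=> K0 H.
have [b bP] : exists b : 'I_n -> K, forall p, p \in l -> p.@[b] != 0.
  apply: common_nonroot => // p /H[[p0 _] _].
  by exists p.
have [a aP] : exists a : 'I_n -> K, forall pq, pq \in [seq (p, q) | p <- l, q <- l] ->
    (forall c, pq.1 != c *: pq.2) -> coprimep (line a b pq.1) (line a b pq.2).
  apply: common_nonroot => // pq /allpairsP[[p q] /= [pl ql ->]] /=.
  have [ip hp] := H _ pl; have [iq hq] := H _ ql.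
  have [npq|ex] := classic (forall c, p != c *: q).
    have [c c0 cP] := coprime_on_lines ip iq (mhomogeneous_homog hp) (mirreducible_deg ip) (bP _ pl) npq.
    by exists c => // a ca _; apply: cP.
  by exists 1; rewrite ?oner_neq0 // => a _ /ex.
exists a, b; split=> // p q pl ql; apply: (aP (p, q)).
by apply/allpairsP; exists (p, q).
Qed.

End Irreducible.

Lemma horner_affine (R : nzRingType) (c d u : R) : (c%:P + d%:P * 'X).[u] = c + d * u.
Proof. by rewrite hornerD hornerMX !hornerC. Qed.

(** * Section by the plane through the generic point *)

Section PlaneSection.
Variables (K : closedFieldType) (n : nat) (a b : 'I_n -> K).
Local Notation M := {mpoly K[n]}.
Local Notation KX := {fraction M}.
Local Notation A := {poly {poly KX}}.

Definition scal : {rmorphism K -> KX} := FracField.tofrac (R := M) \o @mpolyC n K.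

Definition sec_var (j : 'I_n) : A :=
  ((scal (a j))%:P + (tofrac 'X_j - scal (a j))%:P * 'X)%:P + ((scal (b j))%:P)%:P * 'X.

Definition scalA : {rmorphism K -> A} := polyC \o polyC \o scal.

(* Restriction to the plane spanned by the line [a + b T] and the generic
   point: the section at [Y = 0] is the line, the point [T = 0, Y = 1] is generic. *)
Definition sec : {rmorphism M -> A} := mmap scalA sec_var.

Lemma sec_scalar c : sec c%:MP = (scal c)%:P%:P.
Proof. by rewrite /sec /= mmapC. Qed.

Lemma sec_X j : sec 'X_j = sec_var j.
Proof. by rewrite /sec /= mmapX mmap1U. Qed.

Lemma spec_var (u : KX) j : spec u (sec_var j) =
  (scal (a j) + (tofrac 'X_j - scal (a j)) * u)%:P + (scal (b j))%:P * 'X.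
Proof.
rewrite /sec_var rmorphD rmorphM /spec /= !map_polyC /= map_polyX !horner_evalE hornerC.
by rewrite horner_affine.
Qed.

Lemma spec_scalar (u : KX) (c : KX) : spec u c%:P%:P = c%:P.
Proof. by rewrite /spec /= map_polyC /= horner_evalE hornerC. Qed.

Lemma spec0_sec q : spec 0 (sec q) = map_poly scal (line a b q).
Proof.
pose e1 : {rmorphism M -> {poly KX}} := spec 0 \o sec.
pose e2 : {rmorphism M -> {poly KX}} := map_poly scal \o line a b.
apply: (mpoly_rmorph_ext (f := e1) (g := e2)) => [c|i].
  rewrite -[e1 _]/(spec 0 (sec _)) sec_scalar spec_scalar.
  by rewrite -[e2 _]/(map_poly scal (line a b _)) /line /= mmapC map_polyC.
rewrite -[e1 _]/(spec 0 (sec _)) sec_X spec_var mulr0 addr0.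
rewrite -[e2 _]/(map_poly scal (line a b _)) /line /= mmapX mmap1U.
by rewrite rmorphD -mul_polyC rmorphM /= !map_polyC map_polyX.
Qed.

Lemma spec1_sec q : spec 1 (sec q) = map_poly (FracField.tofrac (R := M)) (shift_along b 1 q).
Proof.
pose fr : {rmorphism M -> KX} := FracField.tofrac (R := M).
pose e1 : {rmorphism M -> {poly KX}} := spec 1 \o sec.
pose e2 : {rmorphism M -> {poly KX}} := map_poly fr \o shift_along b 1.
apply: (mpoly_rmorph_ext (f := e1) (g := e2)) => [c|i].
  rewrite -[e1 _]/(spec 1 (sec _)) sec_scalar spec_scalar.
  by rewrite -[e2 _]/(map_poly fr (shift_along b 1 _)) /shift_along /= mmapC map_polyC.
rewrite -[e1 _]/(spec 1 (sec _)) sec_X spec_var mulr1 [scal (a i) + _]addrC subrK.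
rewrite -[e2 _]/(map_poly fr (shift_along b 1 _)) /shift_along /= mmapX mmap1U.
by rewrite rmorphD -mul_polyC rmorphM /= !map_polyC map_polyX mul1r.
Qed.

Lemma ev_sec q : ev 0 1 (sec q) = tofrac q.
Proof.
rewrite -[LHS]/((spec 1 (sec q)).[0]) spec1_sec -[X in _.[X]](rmorph0 (FracField.tofrac (R := M))).
by rewrite horner_map shift0.
Qed.

Lemma ev_sec_deriv q : ev 0 1 (sec q)^`() = tofrac (shift_along b 1 q)`_1.
Proof.
rewrite -[LHS]/((spec 1 (sec q)^`()).[0]) spec_deriv spec1_sec deriv_map.
rewrite -[X in _.[X]](rmorph0 (FracField.tofrac (R := M))) horner_map.
by rewrite horner_coef0 coef_deriv.
Qed.

Lemma tdlt_sec_var j : tdlt 2 (sec_var j).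
Proof.
move=> [|[|i]] [|[|l]] //= _; rewrite /sec_var !(coefD, coefC, coefMX, coefCM) //= ?coefC ?addr0 ?add0r //=.
all: by rewrite ?mulr0 ?addr0 ?coef0.
Qed.

Lemma tdlt_sec d q : q \is d.-homog -> tdlt d.+1 (sec q).
Proof.
move=> hq; rewrite [q in sec q](mpolyE q) rmorph_sum /= big_seq.
elim/big_rec: _ => [|m r mq IH]; first exact: tdlt0.
apply: tdltD => //; rewrite -mul_mpolyC rmorphM sec_scalar; apply: tdltCM.
have <- : mdeg m = d by move/dhomogP: hq; apply.
rewrite mpolyXE_id rmorph_prod mdegE; apply: tdlt_prod => j.
rewrite rmorphXn sec_X.
by have := @tdlt_exp _ 1 _ (m j) (tdlt_sec_var j); rewrite mul1n.
Qed.

Lemma sec_lead d q : q \is d.-homog -> (sec q)`_d = (scal q.@[b])%:P.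
Proof.
move=> hq; have td := tdlt_sec hq.
have e0 : (sec q)`_d`_0 = scal q.@[b].
  have [_ <-] := line_deg_lead a b hq.
  rewrite -horner_coef0 -horner_evalE -coef_map -[map_poly _ _]/(spec 0 (sec q)).
  by rewrite spec0_sec coef_map.
apply/polyP=> j; rewrite coefC; case: j => [|j] //=.
by apply: td; rewrite -addSnnS leq_addr.
Qed.

End PlaneSection.

Section Fibre.
Variables (K : closedFieldType) (n : nat) (a b : 'I_n -> K).
Local Notation M := {mpoly K[n]}.
Local Notation KX := {fraction M}.
Local Notation A := {poly {poly KX}}.

Lemma frac_pchar0 : [pchar K] =i pred0 -> [pchar KX] =i pred0.
Proof. by move=> K0 p; rewrite (fmorph_pchar (scal K n)) K0. Qed.

Lemma size_line (p : M) d : p \is d.-homog -> p.@[b] != 0 -> size (line a b p) = d.+1.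
Proof.
move=> hp pb; have [le lc] := line_deg_lead a b hp.
by apply/anti_leq; rewrite le /= ltnNge; apply: contra pb => le'; rewrite -lc nth_default.
Qed.

(** Coprimality on the line gives each factor a zero there that no other factor shares; these are
    the points [tau_i] at which residues are separated. *)
Lemma fibre_family (s : seq (M * nat)) :
  [pchar K] =i pred0 -> (0 < size s)%N ->
  (forall pe, pe \in s -> [/\ mirreducible pe.1, mhomogeneous pe.1, (0 < pe.2)%N & pe.1.@[b] != 0]) ->
  (forall i j, (i < size s)%N -> (j < size s)%N -> i != j ->
     coprimep (line a b (nth (pe0 K n) s i).1) (line a b (nth (pe0 K n) s j).1)) ->
  exists v : 'I_((size s).-1 + ('C((omega_fib s).+2, 2) - 1)) -> A * A,
    [/\ forall j, admissible (\sum_(pe <- s) tdeg pe.1 * pe.2) (v j),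
        forall j, closed_defect (sec a b (\prod_(pe <- s) pe.1 ^+ pe.2)) (v j) = 0 &
        forall x, \sum_j (x j)%:P *: v j = 0 -> forall j, x j = 0].
Proof.
move=> K0; case es : s => [//|pe1 s1] _; rewrite -es => sP cop.
have sz : size s = (size s1).+1 by rewrite es.
have -> : (size s).-1 = size s1 by rewrite sz.
set m := size s1 in sz *.
pose pe (i : 'I_m.+1) := nth (pe0 K n) s i.
have peP (i : 'I_m.+1) : [/\ mirreducible (pe i).1, mhomogeneous (pe i).1, (0 < (pe i).2)%N & (pe i).1.@[b] != 0].
  by apply: sP; rewrite mem_nth // sz.
have big_pe (R : Type) (idx : R) (op : Monoid.law idx) (F : M * nat -> R) :
    \big[op/idx]_(x <- s) F x = \big[op/idx]_i F (pe i).
  by rewrite (big_nth (pe0 K n)) sz big_mkord.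
pose delta i := tdeg (pe i).1.
have dgt0 i : (0 < delta i)%N by have [/mirreducible_deg] := peP i.
have szl i : size (line a b (pe i).1) = (delta i).+1.
  by have [_ /mhomogeneous_homog h _ pb] := peP i; apply: size_line.
have [tau tauP] : exists tau : 'I_m.+1 -> K, forall i, root (line a b (pe i).1) (tau i).
  apply: (fin_all_exists (P := fun i t => root (line a b (pe i).1) t)) => i.
  by apply/closed_rootP; rewrite szl; have := dgt0 i; case: (delta i).
have tau_ij i j : root (line a b (pe j).1) (tau i) = (i == j).
  apply/idP/eqP => [rj|<-//]; apply: contraTeq rj => ij.
  have cp : coprimep (line a b (pe i).1) (line a b (pe j).1) by apply: cop; rewrite ?sz.
  exact: (coprimep_root cp (tauP i)).
pose P i := sec a b (pe i).1; pose e i := (pe i).2.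
have Pdeg i : tdlt (delta i).+1 (P i).
  by apply: tdlt_sec; have [_ /mhomogeneous_homog h _ _] := peP i.
have Psize i : size (spec 0 (P i)) = (delta i).+1.
  by rewrite /P spec0_sec size_map_poly szl.
have Ptau i j : root (spec 0 (P j)) (scal K n (tau i)) = (i == j).
  by rewrite /P spec0_sec fmorph_root tau_ij.
have := kernel_family (frac_pchar0 K0) e Pdeg Psize Ptau dgt0.
have -> : omega e delta = omega_fib s.
  rewrite /omega_fib (big_pe _ _ addn); apply: eq_bigr => i _.
  by rewrite subn1.
have -> : (omega_fib s + \sum_i delta i)%N = (\sum_(pe <- s) tdeg pe.1 * pe.2)%N.
  rewrite /omega_fib !(big_pe _ _ addn) -big_split; apply: eq_bigr => i _.
  have [_ _ e0 _] := peP i.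
  by rewrite /= subn1 addnC -mulnS prednK.
have -> : mult_part P e * rad_part P = sec a b (\prod_(pe <- s) pe.1 ^+ pe.2).
  rewrite (big_pe _ _ (@GRing.mul _)) rmorph_prod -big_split; apply: eq_bigr => i _.
  have [_ _ e0 _] := peP i.
  by rewrite rmorphXn /= -exprSr prednK.
by [].
Qed.

End Fibre.

(** * Degrees under dehomogenization *)

Lemma msize_prod_exp (R : idomainType) n (I : Type) (s : seq I) (F : I -> {mpoly R[n]}) (m : I -> nat) :
  (forall i, (msize (F i) <= 2)%N) ->
  (msize (\prod_(i <- s) F i ^+ m i) <= (\sum_(i <- s) m i).+1)%N.
Proof.
move=> F2; have M (p q : {mpoly R[n]}) u v : (msize p <= u.+1)%N -> (msize q <= v.+1)%N ->
    (msize (p * q) <= (u + v).+1)%N.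
  move=> hp hq; have [->|p0] := eqVneq p 0; first by rewrite mul0r msize0.
  have [->|q0] := eqVneq q 0; first by rewrite mulr0 msize0.
  by rewrite msizeM //; lia.
elim: s => [|i s IH]; first by rewrite !big_nil msize1.
rewrite !big_cons; apply: (M) => //; elim: (m i) => [|e IHe]; first by rewrite expr0 msize1.
by rewrite exprS; apply: (M _ _ 1 e).
Qed.

Section Dehom.
Variables (K : closedFieldType) (n : nat).

Lemma msize_dehom l (q : {mpoly K[n.+1]}) : (msize (dehom n l q) <= msize q)%N.
Proof.
rewrite [q in dehom n l q]mpolyE rmorph_sum /= big_seq.
elim/big_rec: _ => [|m r mq IH]; first by rewrite msize0.
apply: leq_trans (mmeasureD_le _ _ _) _; rewrite geq_max IH andbT.
rewrite mmapZ; apply: leq_trans (msize_mdeg_lt mq).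
have [->|c0] := eqVneq q@_m 0; first by rewrite mul0r msize0.
rewrite mul_mpolyC msizeZ // mmapX /mmap1 mdegE.
apply: msize_prod_exp => j; rewrite /dehom_var; case: unlift => [i|].
  by apply: leq_trans (msizeZ_le _ _) _; rewrite msizeX mdeg1.
by rewrite msizeC; case: (l != 0).
Qed.

(** A factor [P] that becomes constant at [X_0 = 1] takes up part of the degree [d], which is then
    missing from [f]. *)
Lemma tdeg_quotient_lt d (f : {mpoly K[n]}) (P q : {mpoly K[n.+1]}) (c : K) : (tdeg f <= d)%N ->
  homogenize d f = P * q -> homogenize d f != 0 -> (0 < tdeg P)%N -> dehom n 1 P = c%:MP ->
  (tdeg f < d)%N.
Proof.
move=> fd e nz P0 eP; have := nz; rewrite e mulf_eq0 negb_or => /andP[nP nq].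
have hf := homogenize_homog fd.
have sd : (msize (homogenize d f) <= d.+1)%N.
  rewrite msizeE; apply/bigmax_leqP_seq => m mf _.
  by rewrite ltnS (dhomog_mf hf mf).
have := dehom_homogenize 1 fd; rewrite expr1n scale1r e rmorphM eP mul_mpolyC => ef.
have le : (msize f <= msize q)%N.
  by rewrite -ef; apply: leq_trans (msizeZ_le _ _) (msize_dehom _ _).
move: sd; rewrite e msizeM // /tdeg in P0 *; move: le P0; rewrite /tdeg.
have : (0 < msize q)%N by rewrite lt0n msize_poly_eq0.
by case: (msize P) => [|[|x]] //; case: (msize q) => [|y] //; case: (msize f) => [|z] //=; lia.
Qed.

Lemma composite_const (f g : {mpoly K[n]}) : g != 0 -> tdeg f = 0%N -> tdeg g = 0%N -> composite f g.
Proof.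
move=> g0 df dg.
have cst (p : {mpoly K[n]}) : tdeg p = 0%N -> p = (p@_0)%:MP.
  by move=> dp; apply: msize1_polyC; move: dp; rewrite /tdeg; case: (msize p) => [|[]].
have hC (p : {poly K}) : (map_poly (@cstF K n) p).[0] = @cstF K n p`_0.
  by rewrite horner_coef0 coef_map_id0 // /cstF mpolyC0 rmorph0.
have s3 : size ('X^2 + (f@_0 / g@_0)%:P) = 3.
  by rewrite size_polyDl size_polyXn // size_polyC; case: eqP.
(* A constant is the value at [h = 0] of a polynomial of degree 2, so it counts as composite; this
   rules out [d = 0]. *)
exists ('X^2 + (f@_0 / g@_0)%:P), 1, 0; split.
- exact: coprimep1.
- by rewrite s3 size_poly1.
- by rewrite hC coef1 /cstF rmorph1 oner_neq0.
have gc0 : g@_0 != 0 by apply: contra_neq g0 => e; rewrite (cst _ dg) e mpolyC0.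
rewrite !hC coef1 coefD coefXn coefC /= add0r /cstF mpolyC1 rmorph1 divr1.
rewrite (cst _ df) (cst _ dg) !mcoeffC eqxx !mulr1.
have hom : forall x y : K, y != 0 -> tofrac (x%:MP_[n]) / tofrac y%:MP = tofrac (x / y)%:MP.
  move=> x y y0; exact: esym (fmorph_div (scal K n) x y).
exact: hom.
Qed.

End Dehom.

(** * The pencil *)

Lemma wronskian_neq0 (K : fieldType) (p q : {poly K}) : [pchar K] =i pred0 ->
  coprimep p q -> (1 < size p)%N -> q * p^`() - p * q^`() != 0.
Proof.
move=> K0 cpq sp; rewrite subr_eq0; apply/negP => /eqP e.
have : p %| p^`() by rewrite -(Gauss_dvdpr _ cpq) e dvdp_mulIl.
have [p'0 _|p'0 /(dvdp_leq p'0)] := eqVneq p^`() 0; last first.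
  by rewrite leqNgt lt_size_deriv // -size_poly_gt0 (leq_trans _ sp).
have := congr1 (fun r : {poly K} => r`_(size p).-2) p'0; rewrite coef_deriv coef0.
have -> : (size p).-2.+1 = (size p).-1 by case: (size p) sp => [|[]].
rewrite -mulr_natr => /eqP; rewrite mulf_eq0 -/(lead_coef p) lead_coef_eq0.
rewrite -size_poly_eq0 natr_eq0_char0 //.
by case: (size p) sp => [|[]].
Qed.

Lemma tofrac_wedge (R : idomainType) (x y z w : R) :
  tofrac x * tofrac y - tofrac z * tofrac w = tofrac (x * y - z * w).
Proof. by rewrite rmorphB !rmorphM. Qed.

Section Combination.
Variables (k : fieldType) (c1 c2 : k) (F1 F2 : {poly {poly k}}).

Definition comb : {poly {poly k}} := c1%:P%:P * F1 + c2%:P%:P * F2.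

Lemma comb_tdlt m : tdlt m F1 -> tdlt m F2 -> tdlt m comb.
Proof. by move=> h1 h2; apply: tdltD; apply: tdltCM. Qed.

Lemma comb_coef v1 v2 i : F1`_i = v1%:P -> F2`_i = v2%:P ->
  comb`_i = (c1 * v1 + c2 * v2)%:P.
Proof. by move=> e1 e2; rewrite coefD !coefCM e1 e2 -!polyCM -polyCD. Qed.

Lemma comb_spec u : spec u comb = c1 *: spec u F1 + c2 *: spec u F2.
Proof.
have specC (c : k) : spec u c%:P%:P = c%:P by rewrite /spec /= map_polyC /= horner_evalE hornerC.
by rewrite rmorphD !rmorphM !specC !mul_polyC.
Qed.

Lemma comb_ev t u : ev t u comb = c1 * ev t u F1 + c2 * ev t u F2.
Proof. by rewrite -[LHS]/((spec u _).[t]) comb_spec hornerD !hornerZ. Qed.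

Lemma tdlt_size m (G : {poly {poly k}}) : tdlt m G -> (size G <= m)%N.
Proof.
move=> tG; apply/leq_sizeP => j je; apply/polyP => i; rewrite coef0.
by apply: tG; apply: leq_trans (leq_addr _ _).
Qed.

Lemma tdlt_sizeE m (G : {poly {poly k}}) (l : k) : tdlt m.+1 G -> G`_m = l%:P -> l != 0 ->
  size G = m.+1.
Proof.
move=> tG eG l0; apply/anti_leq; rewrite tdlt_size //= ltnNge; apply: contra l0 => le.
by rewrite -polyC_eq0 -eG nth_default.
Qed.

End Combination.

Lemma comb_deriv (k : fieldType) (c1 c2 : k) (F1 F2 : {poly {poly k}}) :
  (comb c1 c2 F1 F2)^`() = comb c1 c2 F1^`() F2^`().
Proof. by rewrite derivD !deriv_mulC. Qed.

Lemma comb_ev0 (k : fieldType) (t u x y : k) (F1 F2 : {poly {poly k}}) :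
  ev t u F1 = x -> ev t u F2 = y -> ev t u (comb y (- x) F1 F2) = 0.
Proof. by move=> e1 e2; rewrite comb_ev e1 e2 mulNr mulrC subrr. Qed.

Lemma comb_ev_deriv (k : fieldType) (t u x y x' y' : k) (F1 F2 : {poly {poly k}}) :
  ev t u F1^`() = x' -> ev t u F2^`() = y' ->
  ev t u (comb y (- x) F1 F2)^`() = y * x' - x * y'.
Proof. by move=> e1 e2; rewrite comb_deriv comb_ev e1 e2 mulNr. Qed.

Lemma dvdp_comb_spec (k : fieldType) (u c1 c2 : k) (p q B : {poly k}) (F1 F2 : {poly {poly k}}) :
  c1 != 0 -> spec u F1 = p -> spec u F2 = q ->
  B %| spec u (comb c1 (- c2) F1 F2) -> B %| p - (c2 / c1) *: q.
Proof.
move=> c0 e1 e2; rewrite comb_spec e1 e2.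
have -> : c1 *: p + - c2 *: q = c1 *: (p - (c2 / c1) *: q).
  by rewrite scalerBr scalerA mulrC divfK // scaleNr.
by rewrite dvdpZr.
Qed.

Section Pencil.
Variables (K : closedFieldType) (n : nat) (a b : 'I_n -> K).
Local Notation M := {mpoly K[n]}.
Local Notation KX := {fraction M}.
Local Notation A := {poly {poly KX}}.
Variables (fs gs : M) (e : nat).
Hypothesis K0 : [pchar K] =i pred0.
Hypothesis hf : fs \is e.+1.-homog.
Hypothesis hg : gs \is e.+1.-homog.
Hypothesis fb : fs.@[b] != 0.
Hypothesis gb : gs.@[b] != 0.
Hypothesis cop : coprimep (line a b fs) (line a b gs).
Let cX := FracField.tofrac (R := M) \o @mpolyC n K.
Hypothesis irr : forall B : {poly KX},
  B %| (map_poly cX (line a b fs) - (tofrac fs / tofrac gs) *: map_poly cX (line a b gs)) ->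
  (size B <= 1)%N \/ (e.+2 <= size B)%N.

Definition generic_member : A := comb (tofrac gs) (- tofrac fs) (sec a b fs) (sec a b gs).
Local Notation F := generic_member.

Let l : KX := tofrac gs * scal K n fs.@[b] + - tofrac fs * scal K n gs.@[b].

Lemma generic_tdlt : tdlt e.+2 F.
Proof. exact (@comb_tdlt _ _ _ _ _ _ (@tdlt_sec _ _ a b _ _ hf) (@tdlt_sec _ _ a b _ _ hg)). Qed.

Lemma generic_coef : F`_e.+1 = l%:P.
Proof. exact: (comb_coef _ _ (sec_lead a b hf) (sec_lead a b hg)). Qed.

(** If [l] vanished, the two forms would be proportional, against their coprimality on the line. *)
Lemma generic_lead_neq0 : l != 0.
Proof.
have -> : l = tofrac (gs * fs.@[b]%:MP - fs * gs.@[b]%:MP).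
  by rewrite rmorphB !rmorphM /l mulNr.
rewrite tofrac_eq0 subr_eq0; apply/negP => /eqP eq.
have {}eq : gs = (gs.@[b] / fs.@[b]) *: fs.
  rewrite mulrC -scalerA; move: eq; rewrite mulrC mul_mpolyC [RHS]mulrC mul_mpolyC => <-.
  by rewrite scalerA mulVf // scale1r.
move: cop; rewrite eq -mul_mpolyC rmorphM /= /line mmapC mul_polyC coprimepZr; last first.
  by rewrite mulf_neq0 ?invr_eq0.
rewrite -/(line a b fs) coprimepp.
by rewrite (size_line a hf fb).
Qed.

Lemma generic_size : size F = e.+2.
Proof. exact: tdlt_sizeE generic_tdlt generic_coef generic_lead_neq0. Qed.

Lemma generic_ev : ev 0 1 F = 0.
Proof. exact: (comb_ev0 (ev_sec a b fs) (ev_sec a b gs)). Qed.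

(** At the generic point [F_T] is the Wronskian of the two forms in the direction [b]; on the chosen
    line it becomes the Wronskian of coprime nonconstant polynomials, nonzero in characteristic
    0. *)
Lemma generic_ev_deriv : ev 0 1 F^`() != 0.
Proof.
have -> : ev 0 1 F^`() = tofrac (gs * (shift_along b 1 fs)`_1 - fs * (shift_along b 1 gs)`_1).
  apply: etrans (comb_ev_deriv _ _ (ev_sec_deriv a b fs) (ev_sec_deriv a b gs)) _.
  exact: tofrac_wedge.
rewrite tofrac_eq0; apply/negP => /eqP e0.
have sf := size_line a hf fb.
have w0 : line a b gs * (line a b fs)^`() - line a b fs * (line a b gs)^`() != 0.
  by apply: wronskian_neq0 => //; rewrite sf.
have [t] := poly_nonroot K0 w0; case/negP; apply/eqP.
rewrite hornerD hornerN !hornerM -!shift_coef1 !horner_line.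
by rewrite -!mevalM -mevalB e0 meval0.
Qed.

Lemma generic_irreducible B : B %| spec 0 F -> (size B <= 1)%N \/ (e.+2 <= size B)%N.
Proof.
have g0 : tofrac gs != 0.
  by rewrite tofrac_eq0; apply: contraNneq gb => ->; rewrite meval0.
move=> dvB; apply: irr.
exact: (dvdp_comb_spec g0 (spec0_sec a b fs) (spec0_sec a b gs) dvB).
Qed.

Lemma generic_kernel_zero w : admissible e.+1 w -> closed_defect F w = 0 -> w = 0.
Proof.
move=> adm /eqP; have := admissible_corner adm; case: w adm => U V [/= tU tV _] c0.
rewrite /closed_defect /= subr_eq0 => /eqP eq.
have lF : lead_coef F = l%:P by rewrite lead_coefE generic_size generic_coef.
have [] := ruppert_kernel_zero (frac_pchar0 n K0) generic_size (ltn0Sn e) lF generic_lead_neq0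
  generic_irreducible generic_ev generic_ev_deriv (tdlt_size tU) (tdlt_size tV) c0 eq.
by move=> -> ->.
Qed.

End Pencil.

(** Let [x] and [y] be the defects for [F1] and [F2]. From [mu x = - la y] follows
    [mu (cg x - cf y) = - (mu cf + la cg) y]. In the application the determinant [mu cf + la cg] is
    the equation of the fibre at the generic point. *)
Lemma pencil_eigen (k : fieldType) (F1 F2 : {poly {poly k}}) (mu la cf cg : k) w :
  mu * cf + la * cg != 0 -> closed_defect (comb mu la F1 F2) w = 0 ->
  closed_defect F2 w = (- mu / (mu * cf + la * cg))%:P *:
    closed_defect (comb cg (- cf) F1 F2) w.
Proof.
move=> s0; rewrite !closed_defect_pencil -mul_polyC.
move: (closed_defect F1 w) (closed_defect F2 w) => x y e.
have e' : mu%:P%:P * x = - (la%:P%:P * y) by apply/eqP; rewrite -addr_eq0 e.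
set s := (_ + _) in s0 *.
have hs : s^-1%:P%:P * s%:P%:P = 1 :> {poly {poly k}} by rewrite -!polyCM mulVf.
have -> : (- mu / s)%:P%:P = s^-1%:P%:P * - mu%:P%:P :> {poly {poly k}}.
  by rewrite -!polyCN -!polyCM mulrC.
rewrite -[LHS]mul1r -hs -[in LHS]mulrA -[in RHS]mulrA; congr (_ * _).
rewrite /s !polyCN !polyCD !polyCM.
have -> : - mu%:P%:P * (cg%:P%:P * x + - cf%:P%:P * y)
    = - (cg%:P%:P * (mu%:P%:P * x)) + mu%:P%:P * cf%:P%:P * y by ring.
by rewrite e'; ring.
Qed.

Lemma prod_homog (R : idomainType) n (s : seq ({mpoly R[n]} * nat)) (d : {mpoly R[n]} * nat -> nat) :
  (forall pe, pe \in s -> pe.1 \is (d pe).-homog) ->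
  \prod_(pe <- s) pe.1 ^+ pe.2 \is (\sum_(pe <- s) d pe * pe.2)%N.-homog.
Proof.
elim: s => [|pe s IH] h; first by rewrite !big_nil dhomog1.
rewrite !big_cons; apply: dhomogM; last by apply: IH => x xs; apply: h; rewrite in_cons xs orbT.
by apply: dhomogMn; apply: h; rewrite mem_head.
Qed.

Lemma coprimep_prod_exp (R : idomainType) (I J : eqType) (s : seq I) (t : seq J)
    (F : I -> {poly R}) (G : J -> {poly R}) (m : I -> nat) (m' : J -> nat) :
  (forall i j, i \in s -> j \in t -> coprimep (F i) (G j)) ->
  coprimep (\prod_(i <- s) F i ^+ m i) (\prod_(j <- t) G j ^+ m' j).
Proof.
move=> h; rewrite big_seq; elim/big_ind: _ => [|p q hp hq|i si].
- exact: coprime1p.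
- by rewrite coprimepMl hp hq.
apply: coprimep_expl; rewrite big_seq; elim/big_ind: _ => [|p q hp hq|j tj].
- exact: coprimep1.
- by rewrite coprimepMr hp hq.
by apply: coprimep_expr; apply: h.
Qed.

Lemma dvd_mem_prod (R : comNzRingType) (I : eqType) (s : seq I) (F : I -> R) (m : I -> nat) i :
  i \in s -> (0 < m i)%N -> exists q, \prod_(j <- s) F j ^+ m j = F i * q.
Proof.
move=> si mi; rewrite (perm_big _ (perm_to_rem si)) big_cons /=.
by case: (m i) mi => // e _; rewrite exprS -mulrA; eexists.
Qed.

(** A common factor of the forms dehomogenizes to one of [f] and [g], hence to a constant; both
    degrees would then be below [d], their maximum. *)
Lemma no_common_factor (K : closedFieldType) n (f g : {mpoly K[n]}) (d := maxn (tdeg f) (tdeg g))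
    (P q r : {mpoly K[n.+1]}) : mcoprime f g -> (0 < tdeg P)%N ->
  homogenize d f != 0 -> homogenize d g != 0 ->
  homogenize d f = P * q -> homogenize d g = P * r -> False.
Proof.
move=> cfg P0 f0 g0 ef eg.
have df : (tdeg f <= d)%N by rewrite leq_maxl.
have dg : (tdeg g <= d)%N by rewrite leq_maxr.
have dvd (x : {mpoly K[n]}) y : (tdeg x <= d)%N -> homogenize d x = P * y -> mdvd (dehom n 1 P) x.
  move=> dx e; exists (dehom n 1 y); rewrite -rmorphM -e.
  by rewrite dehom_homogenize // expr1n scale1r.
have [c _ eP] := cfg _ (dvd _ _ df ef) (dvd _ _ dg eg).
have := tdeg_quotient_lt df ef f0 P0 eP; have := tdeg_quotient_lt dg eg g0 P0 eP.
by rewrite /d; lia.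
Qed.

(** The excess multiplicities cancel between [m] and [theta], leaving the number of distinct
    factors, and Pascal's rule absorbs [omega] into the binomial. *)
Lemma fibre_count (K : fieldType) n (s : seq ({mpoly K[n]} * nat)) : (0 < size s)%N ->
  (forall pe, pe \in s -> (0 < pe.2)%N) ->
  (m_fib s)%:Z - 1 + (omega_fib s)%:Z + theta_fib s
    = ((size s).-1 + ('C((omega_fib s).+2, 2) - 1))%:Z.
Proof.
move=> s0 e0; rewrite /theta_fib.
have -> : m_fib s = (size s + \sum_(pe <- s) (pe.2 - 1))%N.
  rewrite /m_fib -sum1_size -big_split big_seq [RHS]big_seq; apply: eq_bigr => pe /e0.
  by rewrite /= add1n subn1 => /prednK.
have -> : 'C((omega_fib s).+2, 2) = ('C((omega_fib s).+1, 2) + (omega_fib s).+1)%N.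
  by rewrite binS bin1.
lia.
Qed.

(** * The fibres and their eigenvalues *)

Section PencilFibres.
Variables (K : closedFieldType) (n : nat).
Local Notation M := {mpoly K[n]}.
Local Notation KX := {fraction M}.
Local Notation A := {poly {poly KX}}.
Variables (fs gs : M) (e : nat) (F : option K -> seq (M * nat)).
Hypothesis K0 : [pchar K] =i pred0.
Hypothesis hf : fs \is e.+1.-homog.
Hypothesis hg : gs \is e.+1.-homog.
Local Notation form p := ((P1pt p).1 *: fs + (P1pt p).2 *: gs).
Hypothesis FP : forall p, is_factorization (form p) (F p).

Lemma fibre_mem p pe : pe \in F p -> [/\ mirreducible pe.1, mhomogeneous pe.1 & (0 < pe.2)%N].
Proof.
by move=> /(nthP (pe0 K n))[i si <-]; have [_ [/(_ i si)[? [? ?]] _]] := FP p.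
Qed.

Lemma fibre_nonprop p i j : (i < size (F p))%N -> (j < size (F p))%N -> i != j ->
  forall c, (nth (pe0 K n) (F p) i).1 != c *: (nth (pe0 K n) (F p) j).1.
Proof.
have [_ [irr np]] := FP p; move=> si sj; rewrite neq_ltn => /orP[ij|ji]; first exact: np.
move=> c; apply/eqP => eq; have [[i0 _] _] := irr _ si.
have c0 : c != 0 by apply: contraNneq i0 => c0; rewrite eq c0 scale0r.
have := np _ _ ji si c^-1; rewrite eq scalerA mulVf // scale1r.
by rewrite eqxx.
Qed.

Lemma form_homog p : form p \is e.+1.-homog.
Proof. by apply: rpredD; apply: rpredZ. Qed.

Lemma sec_form (a b : 'I_n -> K) p :
  sec a b (form p) = comb (scal K n (P1pt p).1) (scal K n (P1pt p).2) (sec a b fs) (sec a b gs).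
Proof. by rewrite -!mul_mpolyC rmorphD !rmorphM !sec_scalar. Qed.

Lemma tofrac_form p :
  tofrac (form p) = scal K n (P1pt p).1 * tofrac fs + scal K n (P1pt p).2 * tofrac gs.
Proof. by rewrite -!mul_mpolyC rmorphD !rmorphM. Qed.

Definition eigval p : KX :=
  - scal K n (P1pt p).1 / tofrac (form p).

(** The eigenvalue is the inverse of [- (fs + t gs)] at [(1 : t)], and it is [0] only at
    [(0 : 1)]. *)
Lemma eigval_inj p q : gs != 0 -> form p != 0 -> form q != 0 -> eigval p = eigval q -> p = q.
Proof.
move=> g0 fp0 fq0; rewrite /eigval.
have fp : tofrac (form p) != 0 by rewrite tofrac_eq0.
have fq : tofrac (form q) != 0 by rewrite tofrac_eq0.
have inv_inj (k : fieldType) (x y : k) : x != 0 -> y != 0 -> - 1 / x = - 1 / y -> x = y.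
  by move=> x0 y0; rewrite !mulN1r => /oppr_inj/invr_inj.
have inv_neq0 (k : fieldType) (x : k) : x != 0 -> - 1 / x = 0 -> False.
  by move=> x0 /eqP; rewrite mulN1r oppr_eq0 invr_eq0 (negPf x0).
case: p q fp fq {fp0 fq0} => [t|] [u|] fp fq //.
- rewrite /= rmorph1 => /(inv_inj _ _ _ fp fq)/eqP; rewrite tofrac_eq /= => /eqP/addrI/eqP.
  by rewrite -subr_eq0 -scalerBl scaler_eq0 (negPf g0) orbF subr_eq0 => /eqP ->.
- by rewrite /= rmorph1 rmorph0 oppr0 mul0r => /(inv_neq0 _ _ fp).
- by rewrite /= rmorph1 rmorph0 oppr0 mul0r => /esym/(inv_neq0 _ _ fq).
Qed.

End PencilFibres.

(** The sum over the projective line is bounded on every finite set of points. By [fibre_count] its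
    terms are natural numbers, so almost all of them vanish and the full sum obeys the same
    bound. *)
Theorem theorem2p5 (K : closedFieldType) (n : nat) (f g : {mpoly K[n]}) :
  [pchar K] =i pred0 ->
  g != 0 ->
  mcoprime f g ->
  ~ composite f g ->
  let d := maxn (tdeg f) (tdeg g) in
  forall F : option K -> seq ({mpoly K[n.+1]} * nat),
  (forall p : option K,
     is_factorization ((P1pt p).1 *: homogenize d f + (P1pt p).2 *: homogenize d g)
                      (F p)) ->
  forall s : seq (option K), uniq s ->
  \sum_(p <- s) ((m_fib (F p))%:Z - 1 + (omega_fib (F p))%:Z + theta_fib (F p))
    <= (d ^ 2)%:Z - 1.
Proof.
move=> K0 g0 cfg ncomp d F FP s us.
have df : (tdeg f <= d)%N by rewrite leq_maxl.
have dg : (tdeg g <= d)%N by rewrite leq_maxr.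
have [d0|] := posnP d.
  by case: ncomp; apply: composite_const => //; apply/eqP; rewrite -leqn0 -d0.
have hf := homogenize_homog df; have hg := homogenize_homog dg.
have irr0 := generic_fibre_irreducible K0 ncomp g0 df dg.
have ncf P q r := @no_common_factor _ _ f g P q r cfg.
move: irr0 ncf FP hf hg; rewrite -/d.
set fs := homogenize d f; set gs := homogenize d g.
move: {df dg} d fs gs => [//|e] fs gs irr0 ncf FP hf hg _.
pose form p := (P1pt p).1 *: fs + (P1pt p).2 *: gs.
have formE p : form p = \prod_(pe <- F p) pe.1 ^+ pe.2 := (FP p).1.
(* The fibres of [fs] and [gs] themselves are added, so that the line is generic for these two forms
   as well. *)
pose pts : seq (option K) := [:: Some 0, None & s].
pose L := flatten [seq map fst (F p) | p <- pts].
have memL p pe : p \in pts -> pe \in F p -> pe.1 \in L.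
  by move=> pp pF; apply/flatten_mapP; exists p => //; apply: map_f.
have [P PL|a [b [bL copL]]] := generic_line (l := L) K0.
  have /flatten_mapP[p _ /mapP[pe pF ->]] := PL.
  by have [] := fibre_mem FP pF.
have formb p : p \in pts -> (form p).@[b] != 0.
  move=> pp; rewrite formE rmorph_prod prodf_seq_neq0; apply/allP => pe pF.
  by rewrite /= rmorphXn expf_neq0 //; apply: bL; apply: memL pF.
have fE : fs = form (Some 0) by rewrite /form /= scale1r scale0r addr0.
have gE : gs = form None by rewrite /form /= scale1r scale0r add0r.
have pf : Some 0 \in pts by rewrite !inE eqxx.
have pg : None \in pts by rewrite !inE eqxx orbT.
have fb : fs.@[b] != 0 by rewrite fE formb.
have gb : gs.@[b] != 0 by rewrite gE formb.
have nz (q : {mpoly K[n.+1]}) : q.@[b] != 0 -> q != 0.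
  by apply: contraNneq => ->; rewrite meval0.
have cop : coprimep (line a b fs) (line a b gs).
  have Fl p : line a b (form p) = \prod_(pe <- F p) line a b pe.1 ^+ pe.2.
    rewrite formE rmorph_prod; apply: eq_bigr => pe _; exact: rmorphXn.
  rewrite fE gE !Fl; apply: coprimep_prod_exp => x y xF yF.
  apply: copL; [exact: memL pf xF|exact: memL pg yF|].
  (* Proportional components of these two fibres would be a common factor of [fs] and [gs]. *)
  move=> c; apply/eqP => eq.
  have [[_ [_ _]] _ x2] := fibre_mem FP xF; have [iy _ y2] := fibre_mem FP yF.
  have [q eq1] := dvd_mem_prod fst (m := snd) xF x2.
  have [r eq2] := dvd_mem_prod fst (m := snd) yF y2.
  apply: (ncf y.1 (c%:MP * q) r); first exact: mirreducible_deg iy.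
  - exact: nz.
  - exact: nz.
  - rewrite -/fs fE formE eq1 eq -mul_mpolyC; ring.
  - by rewrite -/gs gE formE eq2.
have sf := size_line a hf fb; have sg := size_line a hg gb.
have irr := irr0 a b cop; rewrite -/fs -/gs sf sg maxnn in irr.
have rd0 : line a b gs != 0 by rewrite -size_poly_eq0 sg.
have {}irr := irr rd0 isT.
pose KX := {fraction {mpoly K[n.+1]}}; pose A := {poly {poly KX}}.
have Fdeg p : p \in pts -> (\sum_(pe <- F p) tdeg pe.1 * pe.2)%N = e.+1.
  move=> pp; have hp : form p \is (\sum_(pe <- F p) tdeg pe.1 * pe.2)%N.-homog.
    rewrite formE; apply: (prod_homog (d := fun pe => tdeg pe.1)) => pe /(fibre_mem FP)[_ hpe _].
    exact: mhomogeneous_homog.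
  have := size_line a hp (formb p pp).
  by rewrite (size_line a (form_homog hf hg p) (formb p pp)) => -[].
have Fsize p : p \in pts -> (0 < size (F p))%N.
  by move=> /Fdeg; case: (F p) => //; rewrite big_nil.
pose N p := ((size (F p)).-1 + ('C((omega_fib (F p)).+2, 2) - 1))%N.
(* The family is chosen for every point of the projective line, so outside [s] it takes the default
   value 0, which is still admissible. *)
have fam p : exists v : 'I_(N p) -> A * A, (forall j, admissible e.+1 (v j)) /\
    (p \in s -> (forall j, closed_defect (sec a b (form p)) (v j) = 0) /\
       forall x, \sum_j (x j)%:P *: v j = 0 -> forall j, x j = 0).
  have [ps|ps] := boolP (p \in s); last first.
    by exists (fun _ => 0); split=> // j; apply: admissible0.
  have pp : p \in pts by rewrite !inE ps !orbT.
  have [||v [v1 v2 v3]] := @fibre_family _ _ a b (F p) K0 (Fsize p pp).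
  - move=> pe pF; have [h1 h2 h3] := fibre_mem FP pF; split=> //.
    exact: bL (memL _ _ pp pF).
  - move=> i j si sj ij; apply: copL; [exact: memL pp (mem_nth _ _)|exact: memL pp (mem_nth _ _)|].
    exact: (fibre_nonprop FP).
  exists v; rewrite formE; split=> [j|_]; last by split.
  by rewrite -(Fdeg p pp); apply: v1.
have [v vP] := all_sig (fun p => constructive_indefinite_description _ (fam p)).
have le : (\sum_(p <- s) N p <= #|{: coord_index e}|)%N.
  apply: (@eigen_card_le KX (A * A)%type A (closed_defect (sec a b gs))
    (closed_defect (generic_member a b fs gs)) (admissible e.+1)
    _ _ _ _ _ _ (@coord KX e) _ _ (option K) s (eigval fs gs) N v us).
  - exact: closed_defect_lin.
  - exact: closed_defect_lin.
  - exact: admissible0.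
  - by move=> c w1 w2; apply: admissible_lin.
  - by move=> w; apply: generic_kernel_zero.
  - exact: coord_lin.
  - by move=> w; apply: coord_inj.
  - move=> p q ps qs; apply: eigval_inj; first exact: nz.
    + by apply: nz; apply: formb; rewrite !inE ps !orbT.
    + by apply: nz; apply: formb; rewrite !inE qs !orbT.
  - by move=> p j; have [h _] := vP p; apply: h.
  - move=> p j ps; have [_ /(_ ps)[h _]] := vP p; have := h j; rewrite sec_form.
    have fp : tofrac (form p) != 0.
      by rewrite tofrac_eq0; apply: nz; apply: formb; rewrite !inE ps !orbT.
    rewrite /eigval tofrac_form; apply: pencil_eigen.
    by rewrite -tofrac_form.
  - by move=> p x ps; have [_ /(_ ps)[_ h]] := vP p; apply: h.
have eqN p : p \in s -> (m_fib (F p))%:Z - 1 + (omega_fib (F p))%:Z + theta_fib (F p) = (N p)%:Z.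
  move=> ps; apply: fibre_count; first by apply: Fsize; rewrite !inE ps !orbT.
  by move=> pe /(fibre_mem FP)[].
rewrite big_seq (eq_bigr _ eqN) -big_seq.
rewrite -(big_morph Posz PoszD (erefl _)).
move: le; rewrite card_coord_index => le.
have : (0 < e.+1 ^ 2)%N by rewrite expn_gt0.
by move: le; move: (e.+1 ^ 2)%N (\sum_(p <- s) N p)%N => x y; clear; lia.
Qed.
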